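(* Let $V$ be a $4n$-dimensional real vector space, $\mathfrak{G}$ a para-quaternionic structure on $V$ and $\mathfrak{H}=(J_1,J_2,J_3)$ a corresponding para-hypercomplex structure. (i) For $n\ge 2$ the $\mathrm{aut}(\mathfrak{G})$-module $\mathcal{R}(\mathrm{aut}(\mathfrak{G}))$ is the (direct) sum of the irreducible submodules $$\mathcal{R}(\mathrm{aut}(\mathfrak{G}))=\mathcal{W}+\mathcal{R}(S^2_h)+\mathcal{R}(S^2_{mix})+\mathcal{R}(\Lambda^2_h)+\mathcal{R}(\Lambda^2_{mix}),$$ where $\mathcal{W}$ is the kernel of the Ricci map and $\mathcal{R}(S^2_h),\mathcal{R}(S^2_{mix}),\mathcal{R}(\Lambda^2_h),\mathcal{R}(\Lambda^2_{mix})$ are the images of $S^2_{\mathfrak{G}},S^2_{mix},\Lambda^2_{\mathfrak{G}},\Lambda^2_{mix}$, respectively, under the map $\phi:B\mapsto R^B$. For $n=1$ the decomposition $\mathcal{R}(\mathrm{aut}(\mathfrak{G}))=\mathcal{W}+\mathcal{R}(S^2_h)+\mathcal{R}(S^2_{mix})+\mathcal{R}(\Lambda^2_h)+\mathcal{R}(\Lambda^2_{mix})$ holds, but the module $\mathcal{W}$ is decomposable as $$\mathcal{W}=\mathcal{W}_++\mathcal{W}_-=\mathcal{R}(\mathfrak{G})+\mathcal{R}(\mathfrak{G}').$$ (ii) $\mathcal{R}(\mathrm{aut}(\mathfrak{H}))=\mathcal{W}+\mathcal{R}(\Lambda^2_h)$ for $n\ge2$, and $\mathcal{R}(\mathrm{aut}(\mathfrak{H}))=\mathcal{W}_-+\mathcal{R}(\Lambda^2_h)$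 for $n=1$.
   Context: Put $\epsilon_1=1$, $\epsilon_2=\epsilon_3=-1$. A para-hypercomplex structure on $V$ is a triple $(J_1,J_2,J_3)$ of endomorphisms with $J_\alpha^2=-\epsilon_\alpha\mathrm{Id}$ and $J_\beta J_\gamma=-\epsilon_\alpha J_\alpha$ for every cyclic permutation $(\alpha,\beta,\gamma)$ of $(1,2,3)$. A para-quaternionic structure is a (Lie) subalgebra $\mathfrak{G}\subset\mathrm{End}(V)$ having such a triple as a basis; the two are then said to correspond to each other. $\mathrm{aut}(\mathfrak{G})$ and $\mathrm{aut}(\mathfrak{H})$ are the normalizer and the centralizer of $\mathfrak{G}$ in $\mathrm{End}(V)$. For $n=1$ one has $\mathrm{aut}(\mathfrak{G})=\mathbb{R}\,\mathrm{Id}\oplus\mathfrak{G}\oplus\mathfrak{G}'$ where $\mathfrak{G}'$ is another para-quaternionic structure on $V$ with $[\mathfrak{G},\mathfrak{G}']=0$; this defines $\mathfrak{G}'$. For a Lie subalgebra $\mathcal{L}\subset\mathrm{End}(V)$, $\mathcal{R}(\mathcal{L})$ (curvature tensors of type $\mathcal{L}$) is the space of $\mathcal{L}$-valued 2-forms $R$ on $V$ satisfying $R(X,Y)Z+R(Y,Z)X+R(Z,X)Y=0$ for all $X,Y,Z\in V$; it is an $\mathcal{L}$-module in the natural way. The Ricci tensor of $R$ is $Ric(R)(Y,Z)=\mathrm{Tr}(X\mapsto R(X,Y)Z)$; the Ricci map is $Ric:\mathcal{R}(\mathrm{aut}(\mathfrak{G}))\to Bil(V)$, where $Bil(V)$ is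 the space of bilinear forms on $V$, and $\mathcal{W}=\ker(Ric)$. For $n=1$, $\mathcal{W}_+=\mathcal{R}(\mathfrak{G})$ and $\mathcal{W}_-=\mathcal{R}(\mathfrak{G}')$. A bilinear form $B$ is hermitian with respect to $\mathfrak{G}$ if $B(JX,Y)=-B(X,JY)$ for all $J\in\mathfrak{G}$, $X,Y\in V$. The projector onto the space of hermitian forms is $\Pi_{\mathfrak{G}}(B)(X,Y)=\frac14\bigl(B(X,Y)+\sum_{\alpha=1}^3\epsilon_\alpha B(J_\alpha X,J_\alpha Y)\bigr)$. $S^2_{\mathfrak{G}}$ and $\Lambda^2_{\mathfrak{G}}$ are the spaces of symmetric, respectively antisymmetric, hermitian forms; $S^2_{mix}=(\mathrm{Id}-\Pi_{\mathfrak{G}})(S^2)$ and $\Lambda^2_{mix}=(\mathrm{Id}-\Pi_{\mathfrak{G}})(\Lambda^2)$ are their complements in the spaces $S^2$, $\Lambda^2$ of all symmetric, respectively antisymmetric, bilinear forms on $V$. For $B\in Bil(V)$, $$R^B(X,Y)Z=(B(Y,X)-B(X,Y))Z+B(Y,Z)X-B(X,Z)Y+\sum_{\alpha=1}^3\epsilon_\alpha\bigl[(B(X,J_\alpha Y)-B(Y,J_\alpha X))J_\alpha Z+B(X,J_\alpha Z)J_\alpha Y-B(Y,J_\alpha Z)J_\alpha X\bigr],$$ and $\phi:Bil(V)\to\mathcal{R}(\mathrm{aut}(\mathfrak{G}))$, $\phi(B)=R^B$. *)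

(* Defs.v *)
From HB Require Import structures.
From mathcomp Require Import all_boot all_order all_algebra.
From mathcomp Require Import boolp classical_sets reals.
Set Implicit Arguments.
Unset Strict Implicit.
Unset Printing Implicit Defensive.
Import GRing.Theory.
Local Open Scope ring_scope.

Section Comprehension.
Variables (K : fieldType) (T : vectType K).

(* The subspace [{x | P x}]; this is meaningful only when P is closed under
   linear combinations, see mem_vspace_of. *)
Definition vspace_of (P : T -> Prop) : {vspace T} :=
  xget 0%VS (fun U : {vspace T} => forall x, x \in U <-> P x).

Lemma mem_vspace_of (P : T -> Prop) :
    P 0 -> (forall a x y, P x -> P y -> P (a *: x + y)) ->
  forall x, x \in vspace_of P <-> P x.
Proof.
move=> P0 PL.
suff [U PU] : exists U : {vspace T}, forall x, x \in U <-> P x.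
  by rewrite /vspace_of; case: xgetP => [V _ //|/(_ U)]; case.
have [n] := ubnP (\dim {:T} - \dim (0%VS : {vspace T})).
have: forall x, x \in (0%VS : {vspace T}) -> P x by move=> x; rewrite memv0 => /eqP->.
elim: n (0%VS : {vspace T}) => // n IHn U PU leUn.
have [[x [Px nUx]]|nU] := pselect (exists x, P x /\ x \notin U).
  apply: (IHn (U + <[x]>)%VS).
    move=> _ /memv_addP[u Uu [_ /vlineP[a ->] ->]].
    by rewrite addrC; apply: PL => //; apply: PU.
  have ltU : (\dim U < \dim (U + <[x]>))%N.
    rewrite ltnNge; apply: contra nUx => leU.
    have /eqP-> : U == (U + <[x]>)%VS by rewrite eqEdim addvSl.
    by apply: (subvP (addvSr U _)); apply: memv_line.
  have leT: (\dim (U + <[x]>) <= \dim {:T})%N by apply/dimvS/subvf.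
  rewrite ltnS in leUn; apply: leq_trans leUn.
  exact: ltn_sub2l (leq_trans ltU leT) ltU.
exists U => x; split=> [/PU //|Px]; apply: contrapT => nUx.
by apply: nU; exists x; split=> //; apply/negP.
Qed.

End Comprehension.

Section BilinearMaps.
Variables (K : fieldType) (U V W : vectType K).

Definition bilinfun (f : U -> V -> W) : 'Hom(U, 'Hom(V, W)) :=
  linfun (fun x => linfun (f x)).

Lemma linfunE (T : vectType K) (f : U -> T) : linear f -> linfun f =1 f.
Proof.
move=> fL.
pose F := GRing.isLinear.Build K U T *:%R f fL.
pose ff : {linear U -> T} := HB.pack f F.
exact: (lfunE ff).
Qed.

End BilinearMaps.

Lemma bilinfunE (K : fieldType) (U V W : vectType K) (f : U -> V -> W) :
    (forall x, linear (f x)) -> (forall y, linear (f^~ y)) ->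
  forall x y, bilinfun f x y = f x y.
Proof.
move=> fr fl x y; rewrite linfunE ?linfunE // => a u v.
by apply/lfunP => z; rewrite !(add_lfunE, scale_lfunE) !linfunE // fl.
Qed.

Section ParaQuaternionic.
Variables (R : realType) (V : vectType R).

Definition Bil := 'Hom(V, 'Hom(V, R^o)).

Definition Tens := 'Hom(V, 'Hom(V, 'End(V))).

Implicit Types (A : 'End(V)) (G L : {vspace 'End(V)}) (J : 'I_3 -> 'End(V)).
Implicit Types (B : Bil) (S : Tens) (X Y Z : V).

Definition lie (A A' : 'End(V)) : 'End(V) := ((A \o A') - (A' \o A))%VF.

Definition lie_subalgebra L := forall A A', A \in L -> A' \in L -> lie A A' \in L.

Definition normalizer L : {vspace 'End(V)} :=
  vspace_of (fun A => forall A', A' \in L -> lie A A' \in L).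

Definition centralizer L : {vspace 'End(V)} :=
  vspace_of (fun A => forall A', A' \in L -> lie A A' = 0).

(* The indices 1, 2, 3 are the elements 0, 1, 2 of 'I_3, where addition is
   modulo 3, so that (i, i + 1, i + 2) ranges over the cyclic permutations. *)
Definition eps (i : 'I_3) : R := if i == 0 then 1 else -1.

Definition parahypercomplex J :=
  (forall i, (J i \o J i)%VF = - eps i *: \1%VF) /\
  (forall i, (J (i + 1) \o J (i + 2%:R))%VF = - eps i *: J i).

Definition corresponds G J :=
  parahypercomplex J /\ basis_of G [seq J i | i : 'I_3].

Definition paraquaternionic G :=
  lie_subalgebra G /\ exists J, corresponds G J.

Definition complementary G G' :=
  [/\ paraquaternionic G',
      forall A A', A \in G -> A' \in G' -> lie A A' = 0,
      normalizer G = (<[\1%VF]> + G + G')%VS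
    & directv (<[\1%VF]> + G + G')].

Definition curv L : {vspace Tens} :=
  vspace_of (fun S =>
    [/\ forall X Y, S X Y \in L,
        forall X Y, S X Y = - S Y X
      & forall X Y Z, S X Y Z + S Y Z X + S Z X Y = 0]).

Definition lie_act A S : Tens :=
  bilinfun (fun X Y => lie A (S X Y) - S (A X) Y - S X (A Y)).

Definition submodule L (U : {vspace Tens}) :=
  (U <= curv L)%VS /\
  forall A S, A \in L -> S \in U -> lie_act A S \in U.

Definition irreducible L (U : {vspace Tens}) :=
  [/\ submodule L U, U != 0%VS
    & forall U', submodule L U' -> (U' <= U)%VS -> U' = 0%VS \/ U' = U].

Definition trace (f : 'End(V)) : R :=
  \tr (passmx.mxof (vbasis {:V}) (vbasis {:V}) f).

Definition ricci S : Bil :=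
  bilinfun (W := R^o) (fun Y Z => trace (linfun (fun X => S X Y Z))).

Definition Ric : 'Hom(Tens, Bil) := linfun ricci.

Definition weyl G : {vspace Tens} := (lker Ric :&: curv (normalizer G))%VS.

Definition S2 : {vspace Bil} := vspace_of (fun B => forall X Y, B X Y = B Y X).

Definition L2 : {vspace Bil} := vspace_of (fun B => forall X Y, B X Y = - B Y X).

Definition hermitian G : {vspace Bil} :=
  vspace_of (fun B => forall A X Y, A \in G -> B (A X) Y = - B X (A Y)).

Definition Pi_form J B : Bil :=
  bilinfun (W := R^o) (fun X Y =>
    4%:R^-1 * (B X Y + \sum_(i < 3) eps i * B (J i X) (J i Y))).

Definition Pi J : 'Hom(Bil, Bil) := linfun (Pi_form J).

Definition S2h G : {vspace Bil} := (S2 :&: hermitian G)%VS.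
Definition L2h G : {vspace Bil} := (L2 :&: hermitian G)%VS.
Definition S2mix J : {vspace Bil} := ((\1 - Pi J)%VF @: S2)%VS.
Definition L2mix J : {vspace Bil} := ((\1 - Pi J)%VF @: L2)%VS.

Definition RB_vec J B X Y Z : V :=
  (B Y X - B X Y) *: Z + B Y Z *: X - B X Z *: Y
  + \sum_(i < 3) eps i *:
      ((B X (J i Y) - B Y (J i X)) *: J i Z
       + B X (J i Z) *: J i Y - B Y (J i Z) *: J i X).

Definition RB J B : Tens := bilinfun (fun X Y => linfun (RB_vec J B X Y)).

Definition phi J : 'Hom(Bil, Tens) := linfun (RB J).

(* [linfun f] agrees with f only when f is linear: the following lemmas check
   that this is so for all the maps above. *)

Lemma lin_add (U W : vectType R) (f g : U -> W) :
  linear f -> linear g -> linear (fun x => f x + g x).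
Proof. by move=> fL gL a x y; rewrite fL gL scalerDr addrACA. Qed.

Lemma lin_opp (U W : vectType R) (f : U -> W) :
  linear f -> linear (fun x => - f x).
Proof. by move=> fL a x y; rewrite fL opprD scalerN. Qed.

Lemma lin_scale (U W : vectType R) (c : R) (f : U -> W) :
  linear f -> linear (fun x => c *: f x).
Proof. by move=> fL a x y; rewrite fL scalerDr !scalerA mulrC. Qed.

Lemma lin_scalel (U W : vectType R) (f : U -> R^o) (w : W) :
  linear f -> linear (fun x => f x *: w).
Proof. by move=> fL a x y; rewrite fL scalerDl -scalerA. Qed.

Lemma lin_sum (U W : vectType R) (f : 'I_3 -> U -> W) :
  (forall i, linear (f i)) -> linear (fun x => \sum_(i < 3) f i x).
Proof.
move=> fL a x y; rewrite scaler_sumr -big_split /=.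
by apply: eq_bigr => i _; apply: fL.
Qed.

Lemma lieE A A' X : lie A A' X = A (A' X) - A' (A X).
Proof. by rewrite /lie add_lfunE opp_lfunE !comp_lfunE. Qed.

Lemma lie_linear_r A : linear (lie A).
Proof.
move=> a A1 A2; apply/lfunP => X.
rewrite !(lieE, add_lfunE, scale_lfunE) linearP -addrA scalerBr -!addrA.
by congr (_ + _); rewrite opprD addrCA.
Qed.

Lemma lieC A A' : lie A A' = - lie A' A.
Proof. by rewrite /lie opprB. Qed.

Lemma lie_linear_l A' : linear (lie^~ A').
Proof. by move=> a A1 A2; rewrite lieC lie_linear_r opprD -scalerN -!lieC. Qed.

Lemma mem_normalizer L A :
  A \in normalizer L <-> (forall A', A' \in L -> lie A A' \in L).
Proof.
apply: mem_vspace_of => [A' _|a A1 A2 H1 H2 A' LA'].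
  by rewrite -(scale0r 0) -[_ *: _]addr0 lie_linear_l scale0r add0r
             /lie comp_lfun0l comp_lfun0r subr0 mem0v.
by rewrite lie_linear_l memvD ?memvZ ?H1 ?H2.
Qed.

Lemma mem_centralizer L A :
  A \in centralizer L <-> (forall A', A' \in L -> lie A A' = 0).
Proof.
apply: mem_vspace_of => [A' _|a A1 A2 H1 H2 A' LA'].
  by rewrite /lie comp_lfun0l comp_lfun0r subr0.
by rewrite lie_linear_l H1 // H2 // scaler0 addr0.
Qed.

Lemma mem_curv L S :
  S \in curv L <->
  [/\ forall X Y, S X Y \in L,
      forall X Y, S X Y = - S Y X
    & forall X Y Z, S X Y Z + S Y Z X + S Z X Y = 0].
Proof.
apply: mem_vspace_of => [|a S1 S2 [L1 A1 B1] [L2 A2 B2]].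
  by split=> *; rewrite !zero_lfunE ?mem0v ?oppr0 ?addr0.
split=> [X Y|X Y|X Y Z]; rewrite !(add_lfunE, scale_lfunE).
- by rewrite memvD ?memvZ.
- by rewrite A1 A2 scalerN opprD.
have -> : forall a1 a2 b1 b2 c1 c2 : V,
  a *: a1 + a2 + (a *: b1 + b2) + (a *: c1 + c2)
  = a *: (a1 + b1 + c1) + (a2 + b2 + c2).
  by move=> *; rewrite !scalerDr [RHS]addrACA; congr (_ + _); rewrite addrACA.
by rewrite B1 B2 scaler0 addr0.
Qed.

Lemma mem_S2 B : B \in S2 <-> forall X Y, B X Y = B Y X.
Proof.
apply: mem_vspace_of => [X Y|a B1 B2 H1 H2 X Y]; first by rewrite !zero_lfunE.
by rewrite !(add_lfunE, scale_lfunE) H1 H2.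
Qed.

Lemma mem_L2 B : B \in L2 <-> forall X Y, B X Y = - B Y X.
Proof.
apply: mem_vspace_of => [X Y|a B1 B2 H1 H2 X Y].
  by rewrite !zero_lfunE oppr0.
by rewrite !(add_lfunE, scale_lfunE) H1 H2 scalerN opprD.
Qed.

Lemma mem_hermitian G B :
  B \in hermitian G <-> forall A X Y, A \in G -> B (A X) Y = - B X (A Y).
Proof.
apply: mem_vspace_of => [A X Y _|a B1 B2 H1 H2 A X Y GA].
  by rewrite !zero_lfunE oppr0.
by rewrite !(add_lfunE, scale_lfunE) H1 // H2 // scalerN opprD.
Qed.

Lemma lie_actE A S X Y Z :
  lie_act A S X Y Z
  = A (S X Y Z) - S X Y (A Z) - S (A X) Y Z - S X (A Y) Z.
Proof.
rewrite /lie_act bilinfunE => [|X'|Y'].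
- by rewrite 2!add_lfunE 2!opp_lfunE lieE.
- apply: lin_add; first apply: lin_add; try apply: lin_opp.
  + by move=> a Y1 Y2; rewrite linearP lie_linear_r.
  + exact: linearP.
  + by move=> a Y1 Y2; rewrite !linearP.
- apply: lin_add; first apply: lin_add; try apply: lin_opp.
  + by move=> a X1 X2; rewrite linearP add_lfunE scale_lfunE lie_linear_r.
  + by move=> a X1 X2; rewrite !linearP add_lfunE scale_lfunE.
  + by move=> a X1 X2; rewrite linearP add_lfunE scale_lfunE.
Qed.

Lemma trace_linear : linear (trace : 'End(V) -> R^o).
Proof. by move=> a f g; rewrite /trace passmx.mxof_linear mxtraceD mxtraceZ. Qed.

Lemma ricciE S Y Z : ricci S Y Z = trace (linfun (fun X => S X Y Z)).
Proof.
have L Y' Z' : linear (fun X => S X Y' Z').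
  by move=> a X1 X2; rewrite linearP !(add_lfunE, scale_lfunE).
rewrite /ricci bilinfunE // => [Y'|Z'] a u v; rewrite -trace_linear;
  congr trace; apply/lfunP => X; rewrite add_lfunE scale_lfunE !linfunE //.
  by rewrite linearP.
by rewrite linearP add_lfunE scale_lfunE.
Qed.

Lemma RicE S Y Z : Ric S Y Z = trace (linfun (fun X => S X Y Z)).
Proof.
rewrite /Ric linfunE ?ricciE // => a S1 S2'; apply/lfunP => Y'; apply/lfunP => Z'.
rewrite !(add_lfunE, scale_lfunE) !ricciE -trace_linear.
have L S' : linear (fun X => S' X Y' Z').
  by move=> b X1 X2; rewrite linearP !(add_lfunE, scale_lfunE).
congr trace; apply/lfunP => X; rewrite add_lfunE scale_lfunE !(linfunE (L _)).
by rewrite !(add_lfunE, scale_lfunE).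
Qed.

Lemma Bil_linear_l B Y : linear (B^~ Y).
Proof. by move=> a X1 X2; rewrite linearP add_lfunE scale_lfunE. Qed.

Lemma Pi_formE J B X Y :
  Pi_form J B X Y
  = 4%:R^-1 * (B X Y + \sum_(i < 3) eps i * B (J i X) (J i Y)).
Proof.
rewrite /Pi_form bilinfunE // => Z; apply: (lin_scale (W := R^o));
  (apply: lin_add; last by (apply: lin_sum => i; apply: (lin_scale (W := R^o));
     move=> a Y1 Y2; rewrite linearP ?Bil_linear_l ?linearP)).
- exact: linearP.
- exact: Bil_linear_l.
Qed.

Lemma PiE J B X Y :
  Pi J B X Y = 4%:R^-1 * (B X Y + \sum_(i < 3) eps i * B (J i X) (J i Y)).
Proof.
rewrite /Pi linfunE ?Pi_formE // => a B1 B2.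
apply/lfunP => X'; apply/lfunP => Y'; rewrite !(add_lfunE, scale_lfunE) !Pi_formE.
have ev Z1 Z2 : linear (fun B => B Z1 Z2 : R^o).
  by move=> b B' B''; rewrite !(add_lfunE, scale_lfunE).
suff PL : linear (fun B => 4%:R^-1 *:
    (B X' Y' + \sum_(i < 3) eps i *: (B (J i X') (J i Y') : R^o)) : R^o) by exact: PL.
by apply: lin_scale; apply: lin_add => //; apply: lin_sum => i; apply: lin_scale.
Qed.

Lemma RBE J B X Y Z : RB J B X Y Z = RB_vec J B X Y Z.
Proof.
have Br X' : linear (B X' : V -> R^o) by exact: linearP.
have BJr X' i : linear (fun Y' => B X' (J i Y') : R^o).
  by move=> a Y1 Y2; rewrite !linearP.
have Bl := Bil_linear_l B.
have JL i : linear (J i) by exact: linearP.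
have idL : linear (fun X' : V => X') by [].
have BJl i Y' : linear (fun X' => B (J i X') Y' : R^o).
  by move=> a X1 X2; rewrite linearP Bl.
have lZ X' Y' : linear (RB_vec J B X' Y').
  rewrite /RB_vec; repeat first [exact: Br | exact: BJr | exact: JL | exact: idL
    | apply: lin_add | apply: lin_opp | apply: lin_sum => i | apply: lin_scale
    | apply: lin_scalel].
have lY X' Z' : linear (fun Y' => RB_vec J B X' Y' Z').
  rewrite /RB_vec; repeat first [exact: Br | exact: BJr | exact: BJl | exact: Bl
    | exact: JL | exact: idL
    | apply: lin_add | apply: lin_opp | apply: lin_sum => i | apply: lin_scale
    | apply: lin_scalel].
have lX Y' Z' : linear (fun X' => RB_vec J B X' Y' Z').
  rewrite /RB_vec; repeat first [exact: Br | exact: BJr | exact: BJl | exact: Bl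
    | exact: JL | exact: idL
    | apply: lin_add | apply: lin_opp | apply: lin_sum => i | apply: lin_scale
    | apply: lin_scalel].
rewrite /RB bilinfunE => [|X'|Y']; first exact: linfunE.
  move=> a u v; apply/lfunP => Z'; rewrite add_lfunE scale_lfunE.
  by rewrite !(linfunE (lZ _ _)); exact: lY.
move=> a u v; apply/lfunP => Z'; rewrite add_lfunE scale_lfunE.
by rewrite !(linfunE (lZ _ _)); exact: lX.
Qed.

Lemma phiE J B X Y Z : phi J B X Y Z = RB_vec J B X Y Z.
Proof.
rewrite /phi linfunE ?RBE // => a B1 B2; apply/lfunP => X'; apply/lfunP => Y'.
apply/lfunP => Z'; rewrite !(add_lfunE, scale_lfunE) !RBE.
have ev Z1 Z2 : linear (fun B => B Z1 Z2 : R^o).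
  by move=> b B' B''; rewrite !(add_lfunE, scale_lfunE).
suff PL : linear (fun B => RB_vec J B X' Y' Z') by exact: PL.
rewrite /RB_vec; repeat first [exact: ev
    | apply: lin_add | apply: lin_opp | apply: lin_sum => i | apply: lin_scale
    | apply: lin_scalel].
Qed.

End ParaQuaternionic.

(* Main.v *)
Require Import Defs.
From HB Require Import structures.
From mathcomp Require Import all_boot all_order all_algebra.
From mathcomp Require Import boolp classical_sets reals.
From mathcomp Require Import ring lra.
Set Implicit Arguments.
Unset Strict Implicit.
Unset Printing Implicit Defensive.
Import Order.TTheory GRing.Theory Num.Theory.
Local Open Scope ring_scope.

(* In suitable coordinates V = R^2 (x) R^N with N = 2n, where G acts as sl_2 on
   the first factor, the centralizer of G is gl_N, and the normalizer is their
   sum. A bilinear form splits into four parts according to its symmetry in each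
   of the two factors, which gives the modules S2h, S2mix, L2h and L2mix. On each
   of them Ric o phi is the multiplication by a nonzero scalar, whence the
   decomposition of the curvature tensors, and acting with rank one endomorphisms
   shows that each is irreducible.
   For a Ricci-flat curvature tensor, the Bianchi identity and its traces kill the
   sl_2 component when N > 2; for N = 2 they make this component satisfy the
   Bianchi identity on its own. The remaining gl_N component is
   area(h, k) l (x) T(x, y, z) with T totally symmetric, and its Ricci tensor
   vanishes exactly when T is trace-free. When N > 2, rank one
   endomorphisms carry any nonzero trace-free T to all of them. *)

(** The relations make the [J i] generate a copy of M_2(R), so the splitting of V is real: [J 1] has
    eigenvalues 1 and -1, and [J 0] exchanges the two eigenspaces. Symmetry types become eigenspaces
    because the Casimir element of sl_2 acts on R^2 (x) R^2 as one minus twice the swap. On forms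
    with signs s and c the composite Ric o phi is 2(N + 2 - s - c), which is positive because s and
    c are at most 1. The value N = 2 is singled out by one contraction: if an alternating h on R^N
    satisfies h(x,y)z + h(y,z)x + h(z,x)y = 0, then (N - 2)h = 0, whereas in the plane this identity
    always holds. The obstacle to the irreducibility of W is that the natural basis tensors,
    symmetrized products e^i e^j e^k (x) e_m, are not trace-free when m is one of i, j, k. The
    submodule is therefore enlarged by the symmetrized products q (x) Id, the basis tensors are
    reached there, and the extra part is removed at the end by a trace. No weight theory is used:
    the fourth power of a square-zero rank one endomorphism already isolates a single decomposable
    tensor. *)

Section LinearTests.
Variables (K : fieldType) (W : vectType K).

(** The test functionals are the coordinates in a basis. Only the linearity rules of [f] are
    exposed, so that [vring] can hand an identity of vectors to [ring] with the values of [f] as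
    scalar unknowns. *)
Lemma vect_ext (u w : W) :
    (forall f : W -> K, {morph f : x y / x + y} -> {morph f : x / - x} ->
       f 0 = 0 -> (forall a x, f (a *: x) = a * f x) -> f u = f w) -> u = w.
Proof.
move=> H; rewrite (coord_vbasis (memvf u)) (coord_vbasis (memvf w)).
apply: eq_bigr => i _; congr (_ *: _); apply: H => [x y|x||a x].
- exact: linearD.
- exact: linearN.
- exact: linear0.
- exact: linearZ.
Qed.

End LinearTests.

Section Homs.
Variables (K : fieldType) (U W : vectType K).
Implicit Types (f g : 'Hom(U, W)).

Lemma homD f x y : f (x + y) = f x + f y. Proof. exact: linearD. Qed.
Lemma homZ f a x : f (a *: x) = a *: f x. Proof. exact: linearZ. Qed.
Lemma homN f x : f (- x) = - f x. Proof. exact: linearN. Qed.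
Lemma homB f x y : f (x - y) = f x - f y. Proof. exact: linearB. Qed.
Lemma hom0 f : f 0 = 0. Proof. exact: linear0. Qed.
Lemma hom_sum f (I : finType) (F : I -> U) :
  f (\sum_i F i) = \sum_i f (F i).
Proof. exact: linear_sum. Qed.
Lemma appD f g x : (f + g) x = f x + g x. Proof. exact: add_lfunE. Qed.
Lemma appZ a f x : (a *: f) x = a *: f x. Proof. exact: scale_lfunE. Qed.
Lemma appN f x : (- f) x = - f x. Proof. exact: opp_lfunE. Qed.
Lemma appB f g x : (f - g) x = f x - g x. Proof. by rewrite appD appN. Qed.
Lemma app0 x : (0 : 'Hom(U, W)) x = 0. Proof. exact: zero_lfunE. Qed.
End Homs.

Ltac vring := apply: vect_ext;
  let f := fresh in let fD := fresh in let fN := fresh in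
  let f0 := fresh in let fZ := fresh in
  intros f fD fN f0 fZ; rewrite ?(f0, fD, fN, fZ); ring.

Section Trace.
Variables (R : realType) (V : vectType R).

Lemma trace_comp (f g : 'End(V)) : trace (f \o g)%VF = trace (g \o f)%VF.
Proof.
by rewrite /trace !(passmx.mxof_comp _ _ (vbasisP _)) mxtrace_mulC.
Qed.

Lemma traceD (f g : 'End(V)) : trace (f + g) = trace f + trace g.
Proof. by rewrite -[f]scale1r trace_linear !scale1r. Qed.

Lemma trace0 : trace (0 : 'End(V)) = 0.
Proof. by apply: (@addrI _ (trace (0 : 'End(V)))); rewrite -traceD !addr0. Qed.

Lemma traceZ a (f : 'End(V)) : trace (a *: f) = a * trace f.
Proof. by rewrite -[a *: f]addr0 trace_linear trace0 addr0. Qed.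

Lemma traceN (f : 'End(V)) : trace (- f) = - trace f.
Proof. by rewrite -scaleN1r traceZ mulN1r. Qed.

Lemma trace_sum n (F : 'I_n -> 'End(V)) :
  trace (\sum_(i < n) F i) = \sum_(i < n) trace (F i).
Proof.
elim: n F => [|n IH] F; first by rewrite !big_ord0 trace0.
by rewrite !big_ord_recl traceD IH.
Qed.

Lemma trace_lie (f g : 'End(V)) : trace (lie f g) = 0.
Proof. by rewrite /lie traceD traceN trace_comp subrr. Qed.

Lemma traceE (f : 'End(V)) :
  trace f = \sum_(i < \dim {:V}) coord (vbasis {:V}) i (f (vbasis {:V})`_i).
Proof.
rewrite /trace /mxtrace; apply: eq_bigr => i _.
by rewrite /passmx.mxof /lin1_mx mxE /= passmx.vecof_delta mxE.
Qed.

Lemma trace_rank1 (a : V -> R^o) (w : V) :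
  linear a -> trace (linfun (fun X => a X *: w)) = a w.
Proof.
move=> aL; pose a' : {linear V -> R^o} :=
  HB.pack a (GRing.isLinear.Build R V R^o *:%R a aL).
rewrite traceE [in RHS](coord_vbasis (memvf w)).
rewrite -[a _]/(a' _) linear_sum; apply: eq_bigr => i _.
rewrite linearZ linfunE; last exact: lin_scalel.
by rewrite linearZ /= mulrC.
Qed.

End Trace.

(** * Coordinates V = R^2 (x) R^N adapted to the triple [J] *)

Section Frames.
Variable R : realType.

Lemma sum2E (W : nmodType) (F : 'I_2 -> W) : \sum_(a < 2) F a = F 0 + F 1.
Proof. by rewrite big_ord_recl big_ord1; congr (_ + F _); apply: val_inj. Qed.

Lemma sum3E (W : nmodType) (F : 'I_3 -> W) :
  \sum_(i < 3) F i = F 0 + F 1 + F 2%:R.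
Proof.
rewrite !big_ord_recl big_ord0 addr0 addrA.
by congr (_ + F _ + F _); apply: val_inj.
Qed.

Lemma ord2P (P : 'I_2 -> Prop) : P 0 -> P 1 -> forall a, P a.
Proof.
move=> P0 P1 [[|[|//]] lt_a2].
  by have -> : Ordinal lt_a2 = 0 by apply: val_inj.
by have -> : Ordinal lt_a2 = 1 by apply: val_inj.
Qed.

Lemma ord3P (P : 'I_3 -> Prop) : P 0 -> P 1 -> P 2%:R -> forall a, P a.
Proof.
move=> P0 P1 P2 [[|[|[|//]]] lt_a].
- by have -> : Ordinal lt_a = 0 by apply: val_inj.
- by have -> : Ordinal lt_a = 1 by apply: val_inj.
- by have -> : Ordinal lt_a = 2%:R by apply: val_inj.
Qed.

Definition mx2 (p q r s : R) : 'M[R]_2 := \matrix_(a, b)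
  if a == 0 then if b == 0 then p else q else if b == 0 then r else s.

(** A basis of sl_2(R) with the relations of [J], chosen so that [J 1] is diagonal and its
    eigenspaces are the two copies of R^N. *)
Definition jmx (i : 'I_3) : 'M[R]_2 :=
  if i == 0 then mx2 0 (- 1) 1 0
  else if i == 1 then mx2 1 0 0 (- 1) else mx2 0 1 1 0.

Definition dlt n (k : 'I_n) : 'cV[R]_n := delta_mx k 0.

Lemma dltE n (k l : 'I_n) : dlt k l 0 = (l == k)%:R.
Proof. by rewrite mxE eqxx andbT. Qed.

Lemma cvE n (x : 'cV[R]_n) : x = \sum_(k < n) x k 0 *: dlt k.
Proof.
apply/colP => l; rewrite summxE (bigD1 l) //= big1 => [|k /negPf nkl].
  by rewrite !mxE !eqxx mulr1 addr0.
by rewrite !mxE eq_sym nkl mulr0.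
Qed.

Lemma sum_dlt n (F : 'I_n -> R) (k : 'I_n) :
  \sum_(l < n) (l == k)%:R * F l = F k.
Proof.
rewrite (bigD1 k) //= big1 => [|l /negPf->]; last by rewrite mul0r.
by rewrite eqxx mul1r addr0.
Qed.

(* [V] is identified with the tensor product of R^2, on which the [J i] act by
   the matrices [jmx i], and R^N; [tau] is the tensor product of vectors and
   [cmp] the two components of a vector. *)
Record frame (V : vectType R) (J : 'I_3 -> 'End(V)) (N : nat) := Frame {
  tau : 'Hom('cV[R]_2, 'Hom('cV[R]_N, V));
  cmp : 'I_2 -> 'Hom(V, 'cV[R]_N);
  frameK : forall X, X = \sum_(a < 2) tau (dlt a) (cmp a X);
  cmp_tau : forall a h x, cmp a (tau h x) = h a 0 *: x;
  J_tau : forall i h x, J i (tau h x) = tau (jmx i *m h) x }.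

Variables (V : vectType R) (J : 'I_3 -> 'End(V)) (N : nat) (F : frame J N).
Local Notation t := (tau F).
Implicit Types (h k l : 'cV[R]_2) (x y z : 'cV[R]_N) (m : 'M[R]_2) (M : 'M[R]_N).

Lemma tau_linl x : linear (fun h => t h x).
Proof. by move=> a h k; rewrite linearP add_lfunE scale_lfunE. Qed.

Lemma tauDl h k x : t (h + k) x = t h x + t k x.
Proof. by have := tau_linl x 1 h k; rewrite !scale1r. Qed.

Lemma tauZl a h x : t (a *: h) x = a *: t h x.
Proof. by rewrite linearZ scale_lfunE. Qed.

Lemma tauDr h x y : t h (x + y) = t h x + t h y.
Proof. exact: linearD. Qed.

Lemma tauZr a h x : t h (a *: x) = a *: t h x.
Proof. exact: linearZ. Qed.

Lemma tau_inj h x y : h != 0 -> t h x = t h y -> x = y.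
Proof.
move=> h0 E.
have [a ha] : exists a, h a 0 != 0.
  by apply/existsP; apply: contraNT h0 => /existsPn H; apply/eqP/colP => a;
     rewrite mxE; apply/eqP; have := H a; rewrite negbK.
by apply: (scalerI ha); rewrite -!(cmp_tau F) E.
Qed.

Lemma dlt_neq0 n (k : 'I_n) : dlt k != 0.
Proof.
apply/eqP => /colP/(_ k); rewrite !mxE !eqxx => /eqP.
by rewrite oner_eq0.
Qed.

Lemma frame_ind (P : V -> Prop) :
    (forall X Y, P X -> P Y -> P (X + Y)) -> (forall h x, P (t h x)) ->
  forall X, P X.
Proof. by move=> PD Pt X; rewrite (frameK F X) sum2E; apply: PD. Qed.

Lemma frame_ext (W : vectType R) (f g : 'Hom(V, W)) :
  (forall h x, f (t h x) = g (t h x)) -> f = g.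
Proof.
move=> E; apply/lfunP; apply: frame_ind => // X Y EX EY.
by rewrite !homD EX EY.
Qed.

(** [f] is a sum of rank one maps, one for each coordinate functional of the frame, and the trace of
    a rank one map is known; no change of basis is needed. *)
Lemma frame_trace (f : 'End(V)) :
  trace f = \sum_(a < 2) \sum_(k < N) (cmp F a (f (t (dlt a) (dlt k)))) k 0.
Proof.
pose G (a : 'I_2) (k : 'I_N) : V -> R^o := fun X => cmp F a X k 0.
have GL a (k : 'I_N) : linear (G a k) by move=> c X Y; rewrite /G linearP !mxE.
have {1}-> : f = \sum_(a < 2) \sum_(k < N)
    linfun (fun X => G a k X *: f (t (dlt a) (dlt k))).
  apply/lfunP => X; rewrite {1}(frameK F X) hom_sum sum_lfunE.
  apply: eq_bigr => a _; rewrite sum_lfunE {1}(cvE (cmp F a X)) !hom_sum.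
  apply: eq_bigr => k _; rewrite tauZr homZ linfunE //.
  exact: lin_scalel.
rewrite trace_sum; apply: eq_bigr => a _; rewrite trace_sum.
by apply: eq_bigr => k _; rewrite trace_rank1.
Qed.

(** The endomorphism 1 (x) M. These maps will form the centralizer of G, and the maps m (x) 1 given
    by [gH] with m trace-free will form G. *)
Definition gE M : 'End(V) :=
  linfun (fun X => \sum_(a < 2) t (dlt a) (M *m cmp F a X)).

Definition gH m : 'End(V) :=
  linfun (fun X => \sum_(a < 2) t (m *m dlt a) (cmp F a X)).

Lemma gE_tau M h x : gE M (t h x) = t h (M *m x).
Proof.
rewrite /gE linfunE => [|c X Y].
  rewrite [in RHS](cvE h) linear_sum sum_lfunE; apply: eq_bigr => a _.
  by rewrite cmp_tau -scalemxAr tauZr tauZl.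
rewrite scaler_sumr -big_split; apply: eq_bigr => a _ /=.
by rewrite linearP mulmxDr -scalemxAr linearP.
Qed.

Lemma gH_tau m h x : gH m (t h x) = t (m *m h) x.
Proof.
rewrite /gH linfunE => [|c X Y].
  rewrite [in RHS](cvE h) mulmx_sumr linear_sum sum_lfunE.
  apply: eq_bigr => a _.
  by rewrite cmp_tau tauZr -scalemxAr tauZl.
rewrite scaler_sumr -big_split; apply: eq_bigr => a _ /=.
by rewrite !linearP.
Qed.

Lemma J_gH i : J i = gH (jmx i).
Proof. by apply: frame_ext => h x; rewrite J_tau gH_tau. Qed.

End Frames.

Section FrameExistence.
Variables (R : realType) (V : vectType R) (J : 'I_3 -> 'End(V)).

(** The trace of the identity is computed in two ways. *)
Lemma frame_dim N (F : frame J N) : \dim {:V} = (2 * N)%N.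
Proof.
have := frame_trace F \1%VF.
rewrite /trace passmx.mxof1 ?(basis_free (vbasisP _)) // mxtrace1.
under eq_bigr => a _ do under eq_bigr => k _ do
  rewrite id_lfunE cmp_tau dltE eqxx scale1r dltE eqxx.
rewrite sum2E !sumr_const card_ord -mulrnDl -mulr2n -mulrnA => /eqP.
by rewrite eqr_nat mulnC => /eqP ->; rewrite mulnC.
Qed.

Hypothesis pJ : parahypercomplex J.

Lemma J_sq i X : J i (J i X) = - eps R i *: X.
Proof. by rewrite -comp_lfunE pJ.1 scale_lfunE id_lfunE. Qed.

Lemma J_cyc i X : J (i + 1) (J (i + 2%:R) X) = - eps R i *: J i X.
Proof. by rewrite -comp_lfunE pJ.2 scale_lfunE. Qed.

Lemma J00 X : J 0 (J 0 X) = - X.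
Proof. by rewrite J_sq /eps eqxx scaleN1r. Qed.

Lemma J11 X : J 1 (J 1 X) = X.
Proof. by rewrite J_sq /eps /= opprK scale1r. Qed.

Lemma J01 X : J 0 (J 1 X) = J 2%:R X.
Proof.
have e1 : (2%:R + 1 : 'I_3) = 0 by apply: val_inj.
have e2 : (2%:R + 2%:R : 'I_3) = 1 by apply: val_inj.
by have := J_cyc 2%:R X; rewrite e1 e2 /eps /= opprK scale1r.
Qed.

Lemma J20 X : J 2%:R (J 0 X) = J 1 X.
Proof.
have e1 : (1 + 1 : 'I_3) = 2%:R by apply: val_inj.
have e2 : (1 + 2%:R : 'I_3) = 0 by apply: val_inj.
by have := J_cyc 1 X; rewrite e1 e2 /eps /= opprK scale1r.
Qed.

Lemma J10 X : J 1 (J 0 X) = - J 0 (J 1 X).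
Proof.
have e Y : J 1 Y = - J 0 (J 2%:R Y) by rewrite -J01 J00 opprK.
by rewrite [LHS]e J20.
Qed.

(** R^N is the fixed space [E0] of [J 1]. Since [J 0] anticommutes with [J 1], it identifies [E0]
    with the other eigenspace, and (h, x) is sent to h_0 x + h_1 [J 0] x. *)
Lemma frame_exists : exists N, inhabited (frame J N).
Proof.
pose E0 := lker (J 1 - \1)%VF; pose b := vbasis E0; exists (\dim E0).
have fixE X : X \in E0 -> J 1 X = X.
  by rewrite memv_ker appB id_lfunE subr_eq0 => /eqP.
have Efix X : J 1 X = X -> X \in E0.
  by rewrite memv_ker appB id_lfunE subr_eq0 => ->.
pose tf (h : 'cV[R]_2) (x : 'cV[R]_(\dim E0)) : V :=
  \sum_k x k 0 *: (h 0 0 *: b`_k + h 1 0 *: J 0 b`_k).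
have tfr h : linear (tf h).
  move=> a x y; rewrite /tf scaler_sumr -big_split; apply: eq_bigr => k _ /=.
  by rewrite !mxE scalerDl scalerA.
have tfl x : linear (tf^~ x).
  move=> a h k; rewrite /tf scaler_sumr -big_split; apply: eq_bigr => i _ /=.
  by rewrite !mxE; vring.
(* The two components in [E0]: [pi0] projects onto [E0]; [pi1] projects onto the other eigenspace
   and carries the result back by - [J 0], the inverse of [J 0]. *)
pose pi0 X := 2%:R^-1 *: (X + J 1 X).
pose pi1 X := - 2%:R^-1 *: J 0 (X - J 1 X).
have pi0L : linear pi0 by move=> a X Y; rewrite /pi0 homD homZ; vring.
have pi1L : linear pi1.
  by move=> a X Y; rewrite /pi1 !(homB, homD, homZ); vring.
have pi0E X : pi0 X \in E0 by apply: Efix; rewrite /pi0 homZ homD J11 addrC.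
have pi1E X : pi1 X \in E0.
  apply: Efix; rewrite /pi1 homZ J10 !homB J11.
  by congr (_ *: _); vring.
pose cf (a : 'I_2) (X : V) : 'cV[R]_(\dim E0) :=
  \col_k coord b k (if a == 0 then pi0 X else pi1 X).
have cfL a : linear (cf a).
  move=> c X Y; apply/colP => k; rewrite !mxE.
  by case: ifP => _; rewrite ?pi0L ?pi1L linearP.
have half (X : V) : 2%:R^-1 *: (X + X) = X.
  have -> : X + X = 2%:R *: X by rewrite scaler_nat mulr2n.
  by rewrite scalerA mulVf ?scale1r // pnatr_eq0.
have bE (k : 'I_(\dim E0)) : (b`_k : V) \in E0 by apply/vbasis_mem/mem_nth; rewrite size_tuple.
have sumb (x : 'cV[R]_(\dim E0)) : \sum_k x k 0 *: b`_k \in E0.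
  by apply: memv_suml => k _; apply: memvZ.
have tfE h x : tf h x = h 0 0 *: (\sum_k x k 0 *: b`_k)
    + h 1 0 *: J 0 (\sum_k x k 0 *: b`_k).
  rewrite hom_sum !scaler_sumr -big_split; apply: eq_bigr => k _ /=.
  by rewrite homZ; vring.
have J1tf h x : J 1 (tf h x) = h 0 0 *: (\sum_k x k 0 *: b`_k)
    - h 1 0 *: J 0 (\sum_k x k 0 *: b`_k).
  by rewrite tfE homD !homZ J10 fixE // scalerN.
have coordE (x : 'cV[R]_(\dim E0)) k : coord b k (\sum_k x k 0 *: b`_k) = x k 0.
  by rewrite coord_sum_free // (basis_free (vbasisP _)).
have cfE a h x : cf a (tf h x) = h a 0 *: x.
  apply/colP => k; rewrite !mxE; move: a; apply: ord2P => /=.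
    have -> : pi0 (tf h x) = h 0 0 *: (\sum_k x k 0 *: b`_k).
      by rewrite -[RHS]half /pi0 J1tf tfE; vring.
    by rewrite linearZ /= coordE.
  have -> : pi1 (tf h x) = h 1 0 *: (\sum_k x k 0 *: b`_k).
    rewrite -[RHS]half /pi1 J1tf tfE !(homB, homD, homN, homZ) J00; vring.
  by rewrite linearZ /= coordE.
have tfK X : X = \sum_(a < 2) tf (dlt R a) (cf a X).
  have cb (U : V) : U \in E0 -> \sum_k coord b k U *: b`_k = U.
    by move=> EU; rewrite -coord_vbasis.
  rewrite sum2E !tfE !dltE /= scale0r addr0 scale1r scale0r add0r scale1r.
  rewrite (eq_bigr (fun k => coord b k (pi0 X) *: b`_k)); last first.
    by move=> k _; rewrite mxE.
  rewrite [X in _ = _ + J 0 X](eq_bigr (fun k => coord b k (pi1 X) *: b`_k)); last first.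
    by move=> k _; rewrite mxE.
  by rewrite !cb // /pi1 homZ J00 /pi0 -[LHS]half; vring.
pose tt := bilinfun tf.
pose cc a := linfun (cf a).
have ttE h x : tt h x = tf h x by apply: bilinfunE.
have ccE a X : cc a X = cf a X by apply: linfunE.
constructor; apply: (@Frame _ _ _ _ tt cc) => [X|a h x|i h x].
- by rewrite {1}(tfK X); apply: eq_bigr => a _; rewrite ttE ccE.
- by rewrite ttE ccE.
rewrite !ttE; move: i; apply: ord3P.
- rewrite !tfE homD !homZ J00 /jmx eqxx !mxE !sum2E !mxE /=; vring.
- rewrite J1tf tfE /jmx /= !mxE !sum2E !mxE /=; vring.
- rewrite -J01 J1tf tfE homB !homZ J00 /jmx /= !mxE !sum2E !mxE /=; vring.
Qed.

End FrameExistence.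

(** * The Bianchi identity and its contractions, in components *)

Section BianchiAlgebra.
Variables (R : realType) (N : nat).
Local Notation E := 'cV[R]_N.
Implicit Types (x y z : E) (a b c d : 'I_2).

Definition ctr (f : E -> E) : R := \sum_k f (dlt R k) k 0.

(** Linearity in the form in which a contraction uses it, see [ctr_rank1]. *)
Definition coordwise (g : E -> R) := forall x, \sum_k x k 0 * g (dlt R k) = g x.

Lemma ctrD (f g : E -> E) : ctr (fun x => f x + g x) = ctr f + ctr g.
Proof. by rewrite /ctr -big_split; apply: eq_bigr => k _; rewrite mxE. Qed.

Lemma ctrN (f : E -> E) : ctr (fun x => - f x) = - ctr f.
Proof. by rewrite /ctr -sumrN; apply: eq_bigr => k _; rewrite mxE. Qed.

Lemma ctrZ (c : R) (f : E -> E) : ctr (fun x => c *: f x) = c * ctr f.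
Proof. by rewrite /ctr mulr_sumr; apply: eq_bigr => k _; rewrite mxE. Qed.

Lemma ctr_id : ctr id = N%:R.
Proof.
rewrite /ctr (eq_bigr (fun=> 1)) ?sumr_const ?card_ord // => k _.
by rewrite dltE eqxx.
Qed.

Lemma ctr_scal (c : R) : ctr (fun x => c *: x) = c * N%:R.
Proof. by rewrite -ctr_id -ctrZ. Qed.

Lemma ctr_rank1 (g : E -> R) y : coordwise g -> ctr (fun x => g x *: y) = g y.
Proof. by move=> <-; apply: eq_bigr => k _; rewrite mxE mulrC. Qed.

Lemma ctr_eq0 (f : E -> E) : (forall x, f x = 0) -> ctr f = 0.
Proof. by move=> f0; apply: big1 => k _; rewrite f0 mxE. Qed.

Lemma linear_coordwise (g : E -> R^o) : linear g -> coordwise g.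
Proof.
move=> gL x; pose g' : {linear E -> R^o} :=
  HB.pack g (GRing.isLinear.Build R E R^o *:%R g gL).
rewrite [in RHS](cvE x) -[g _]/(g' _) linear_sum.
by apply: eq_bigr => k _; rewrite linearZ.
Qed.

(** For a curvature tensor S, [A a b x y] is the gl_N component of S(e_a (x) x, e_b (x) y), and
    [w a b x y c d] is the entry in row c and column d of its sl_2 component. The hypothesis
    [bianchi] is the e_d component of the cyclic sum whose third argument is e_c (x) z. *)
Variables (A : 'I_2 -> 'I_2 -> E -> E -> E -> E)
          (w : 'I_2 -> 'I_2 -> E -> E -> 'I_2 -> 'I_2 -> R).
Hypothesis N_gt0 : (0 < N)%N.
Hypothesis wl : forall a b c d y, coordwise (fun x => w a b x y c d).
Hypothesis wC : forall a b c d x y, w a b x y c d = - w b a y x c d.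
Hypothesis AC : forall a b x y z, A a b x y z = - A b a y x z.
Hypothesis wt : forall a b x y, w a b x y 0 0 + w a b x y 1 1 = 0.
Hypothesis bianchi : forall a b c d x y z,
  (d == c)%:R *: A a b x y z + w a b x y d c *: z
  + ((d == a)%:R *: A b c y z x + w b c y z d a *: x)
  + ((d == b)%:R *: A c a z x y + w c a z x d b *: y) = 0.
Hypothesis ricci_flat : forall b c y z,
  ctr (fun x => A c b x y z) + \sum_(d < 2) w d b z y d c = 0.

Let n : R := N%:R.

Let n_gt0 : 0 < n. Proof. by rewrite ltr0n. Qed.

Let wr a b c d y : coordwise (fun x => w a b y x c d).
Proof.
move=> x; rewrite wC -wl -sumrN; apply: eq_bigr => k _.
by rewrite wC mulrN.
Qed.

Let coordwiseN g : coordwise g -> coordwise (fun x => - g x).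
Proof.
by move=> gl x; rewrite -gl -sumrN; apply: eq_bigr => k _; rewrite mulrN.
Qed.

Let coordwiseD g h : coordwise g -> coordwise h -> coordwise (fun x => g x + h x).
Proof.
move=> gl hl x; rewrite -gl -hl -big_split; apply: eq_bigr => k _.
by rewrite mulrDr.
Qed.

Section TwoIndices.
Variables (a b : 'I_2).
Hypothesis nab : a != b.

Let nba : (b == a) = false. Proof. by rewrite eq_sym (negPf nab). Qed.
Let sumab (g : 'I_2 -> R) : \sum_(d < 2) g d = g a + g b.
Proof.
rewrite sum2E; move: nab; move: a b.
by apply: ord2P; apply: ord2P => //; rewrite addrC.
Qed.

Let wbb i j x y : w i j x y b b = - w i j x y a a.
Proof.
move: (wt i j x y); rewrite -(sum2E (fun c => w i j x y c c)) sumab addrC.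
by move/eqP; rewrite addr_eq0 => /eqP.
Qed.

(** The identities respect the weights of the diagonal torus of sl_2, which separates the unknowns
    into three groups: [q] alone, the pair [g], [f], and the triple [m], [k], [l]. *)
Let g x y := w a a x y a a.
Let f x y := w a b x y b a.
Let m x y := w a a x y a b.
Let k x y := w a b x y a a.
Let q x y := w a a x y b a.
Let l x y := w b b x y b a.

Let gC x y : g x y = - g y x. Proof. exact: wC. Qed.
Let mC x y : m x y = - m y x. Proof. exact: wC. Qed.
Let qC x y : q x y = - q y x. Proof. exact: wC. Qed.
Let fl y : coordwise (f^~ y). Proof. exact: wl. Qed.
Let fr y : coordwise (f y). Proof. exact: wr. Qed.
Let gl y : coordwise (g^~ y). Proof. exact: wl. Qed.
Let gr y : coordwise (g y). Proof. exact: wr. Qed.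
Let kl y : coordwise (k^~ y). Proof. exact: wl. Qed.
Let kr y : coordwise (k y). Proof. exact: wr. Qed.
Let ml y : coordwise (m^~ y). Proof. exact: wl. Qed.
Let ql y : coordwise (q^~ y). Proof. exact: wl. Qed.
Let qr y : coordwise (q y). Proof. exact: wr. Qed.

(** The instance c = d = b of [bianchi], where only one of the three gl_N terms survives. *)
Let Aaa x y z : A a a x y z = g x y *: z - f y z *: x + f x z *: y.
Proof.
have := bianchi a a b b x y z; rewrite eqxx nba !scale0r !add0r scale1r.
rewrite wbb -/(g x y) -/(f y z) (wC b a) -/(f x z).
move=> H; apply: subr0_eq; rewrite -[RHS]H; vring.
Qed.

Lemma bianchi_f y z : n * f y z = 2%:R * g z y.
Proof.
have := ricci_flat a a y z.
rewrite sumab (wC b a) -/(g z y) -/(f y z).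
have -> : (fun x => A a a x y z) = fun x => g x y *: z + - (f y z *: x) + f x z *: y.
  by apply: funext => x; rewrite Aaa.
rewrite !ctrD ctrN ctr_scal !ctr_rank1 // -/n => H.
by apply: subr0_eq; rewrite -[RHS]oppr0 -[in RHS]H; ring.
Qed.

(** Contract over z: the first term gives n h(x,y), and each of the other two gives h(y,x) = -
    h(x,y). *)
Let cyc_zero (h : E -> E -> R) : (forall y, coordwise (h y)) ->
  (forall x y, h x y = - h y x) ->
  (forall x y z, h x y *: z + h y z *: x + h z x *: y = 0) ->
  forall x y, (n - 2%:R) * h x y = 0.
Proof.
move=> hr hC H x y.
have hl z : coordwise (h^~ z).
  by move=> u; rewrite hC -hr -sumrN; apply: eq_bigr => i _; rewrite hC mulrN.
have := ctr_eq0 (H x y).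
by rewrite !ctrD ctr_scal !ctr_rank1 // -/n (hC y x) => H'; rewrite -[RHS]H'; ring.
Qed.

Lemma bianchi_g x y : (n - 2%:R) * g x y = 0.
Proof.
(* This is the coefficient of z left by the Bianchi identity with all indices equal to a, once [Aaa]
   has eliminated the gl_N component. By [bianchi_f] it is (2n + 4)/n times [g]. *)
pose h x y := 2%:R * g x y + f y x + - f x y.
have nh u v : n * h u v = (2%:R * n + 4%:R) * g u v.
  by rewrite /h mulrDr mulrDr mulrN !bianchi_f (gC v u); ring.
have hC u v : h u v = - h v u by rewrite /h (gC u v); ring.
have hr u : coordwise (h u).
  apply: coordwiseD; last exact: coordwiseN.
  apply: coordwiseD; last by [].
  move=> v; rewrite -gr mulr_sumr; apply: eq_bigr => i _; ring.
have hcyc u v z : h u v *: z + h v z *: u + h z u *: v = 0.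
  have := bianchi a a a a u v z; rewrite eqxx !scale1r !Aaa => H.
  by rewrite -[RHS]H /h /g; vring.
have := cyc_zero hr hC hcyc x y; move/(congr1 ( *%R n)).
rewrite mulr0 mulrCA nh => H.
have c0 : 2%:R * n + 4%:R != 0 by rewrite gt_eqF // addr_gt0 ?mulr_gt0 ?ltr0n.
by apply: (mulfI c0); rewrite mulr0 -[RHS]H; ring.
Qed.

Lemma bianchi_q x y : (n - 2%:R) * q x y = 0.
Proof.
apply: cyc_zero => // u v z; have := bianchi a a a b u v z.
by rewrite nba !scale0r !add0r.
Qed.

(** The Bianchi identity for the indices a, a, b in the e_a component. Contracting it over z gives
    [bianchi_mk], and over x gives [bianchi_t]. *)
Let Aab x y z : m x y *: z + A a b y z x + k y z *: x
  - A a b x z y - k x z *: y = 0.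
Proof.
have := bianchi a a b a x y z.
rewrite eqxx (negPf nab) scale0r add0r !scale1r (AC b a) (wC b a) => H.
by rewrite -[RHS]H /m /k; vring.
Qed.

Let ric_ba y x : ctr (fun z => A b a z y x) = - m x y - k y x.
Proof.
have := ricci_flat a b y x; rewrite sumab wbb (wC b a) opprK.
rewrite -/(m x y) -/(k y x) => /eqP; rewrite addr_eq0 => /eqP ->.
by rewrite opprD.
Qed.

Let ric_ab z y : ctr (fun x => A a b x z y) = - k y z - l y z.
Proof.
have := ricci_flat b a z y; rewrite sumab.
rewrite -/(k y z) -/(l y z) => /eqP; rewrite addr_eq0 => /eqP ->.
by rewrite opprD.
Qed.

Lemma bianchi_mk x y : (n + 2%:R) * m x y = 2%:R * (k x y - k y x).
Proof.
have := ctr_eq0 (fun z => Aab x y z).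
rewrite !ctrD !ctrN ctr_scal !ctr_rank1 // -/n.
rewrite (_ : (fun z => A a b y z x) = fun z => - A b a z y x); last first.
  by apply: funext => z; rewrite AC.
rewrite (_ : (fun z => A a b x z y) = fun z => - A b a z x y); last first.
  by apply: funext => z; rewrite AC.
rewrite !ctrN !ric_ba (mC y x) => H.
by apply: subr0_eq; rewrite -[RHS]H; ring.
Qed.

Lemma bianchi_t y z : ctr (A a b y z) = - (n * k y z) - m z y - l y z.
Proof.
have := ctr_eq0 (fun x => Aab x y z).
rewrite !ctrD !ctrN ctr_scal !ctr_rank1 // -/n ric_ab => H.
by apply: subr0_eq; rewrite -[RHS]H; ring.
Qed.

End TwoIndices.

Section SwappedIndices.
Variables (a b : 'I_2).
Hypothesis nab : a != b.

Let nba : b != a. Proof. by rewrite eq_sym. Qed.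

Let wbb x y : w b a x y b b = w a b y x a a.
Proof.
rewrite wC; move: (wt a b y x) => H.
have : w a b y x a a + w a b y x b b = 0.
  move: nab H; move: (w a b y x) => u; move: a b.
  by apply: ord2P; apply: ord2P => // _; rewrite addrC.
by move/eqP; rewrite addr_eq0 => /eqP.
Qed.

(** [bianchi_mk] is used for (a, b) and for (b, a). Exchanging the indices transposes [k], by
    antisymmetry and tracelessness, so the two right-hand sides are opposite. *)
Lemma bianchi_ml x y : w b b x y b a = - w a a x y a b.
Proof.
have c0 : n + 2%:R != 0 by rewrite gt_eqF // addr_gt0 ?ltr0n.
apply: (mulfI c0); rewrite mulrN bianchi_mk // bianchi_mk // !wbb; ring.
Qed.

(** The contractions of A a b x y and A b a y x are opposite, so the two instances of [bianchi_t]
    add up to zero. *)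
Lemma bianchi_km x y : n * w a b x y a a = 2%:R * w a a x y a b.
Proof.
have := bianchi_t nab x y; have := bianchi_t nba y x.
rewrite wbb bianchi_ml.
rewrite (_ : ctr (A b a y x) = - ctr (A a b x y)); last first.
  by rewrite -ctrN; congr ctr; apply: funext => z; rewrite AC.
rewrite (wC a a a b y x) => H1 H2.
have c0 : (2%:R : R) != 0 by rewrite pnatr_eq0.
have : ctr (A a b x y) - ctr (A a b x y) = 0 by rewrite subrr.
rewrite {1}H2 H1 => H.
by apply: (mulfI c0); apply: subr0_eq; rewrite -[RHS]oppr0 -[in RHS]H; ring.
Qed.

(** By [bianchi_km], [k] is alternating. Then (n + 2)m = 4k and nk = 2m give n(n + 2)k = 8k, and n^2
    + 2n - 8 = (n - 2)(n + 4). *)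
Lemma bianchi_k x y : (n - 2%:R) * w a b x y a a = 0.
Proof.
have k2 u v := bianchi_km u v.
have kC : w a b y x a a = - w a b x y a a.
  by apply: (mulfI (lt0r_neq0 n_gt0)); rewrite mulrN !k2 (wC a a); ring.
have := bianchi_mk nab x y; rewrite kC => H.
have c0 : n + 4%:R != 0 by rewrite gt_eqF // addr_gt0 ?ltr0n.
apply: (mulfI c0); rewrite mulr0.
have : (n + 2%:R) * (n * w a b x y a a) = 8%:R * w a b x y a a.
  by rewrite k2 mulrCA H; ring.
by move=> E0; rewrite -[RHS](subrr (8%:R * w a b x y a a)) -{1}E0; ring.
Qed.

End SwappedIndices.

Let i01 : (0 : 'I_2) != 1. Proof. by []. Qed.
Let i10 : (1 : 'I_2) != 0. Proof. by []. Qed.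

Let w11E a b x y : w a b x y 1 1 = - w a b x y 0 0.
Proof. by apply/eqP; rewrite -addr_eq0 addrC wt. Qed.

Lemma bianchi_zero : N != 2%N -> forall a b c d x y, w a b x y c d = 0.
Proof.
move=> N2; have n2 : n - 2%:R != 0 by rewrite subr_eq0 eqr_nat.
have cancel (r : R) : (n - 2%:R) * r = 0 -> r = 0.
  by move/eqP; rewrite mulf_eq0 (negPf n2) => /eqP.
have c2 : (2%:R : R) != 0 by rewrite pnatr_eq0.
have g0 x y : w 0 0 x y 0 0 = 0 by apply/cancel/(bianchi_g i01).
have g1 x y : w 1 1 x y 1 1 = 0 by apply/cancel/(bianchi_g i10).
have q0 x y : w 0 0 x y 1 0 = 0 by apply/cancel/(bianchi_q i01).
have q1 x y : w 1 1 x y 0 1 = 0 by apply/cancel/(bianchi_q i10).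
have k0 x y : w 0 1 x y 0 0 = 0 by apply/cancel/(bianchi_k i01).
have k1 x y : w 1 0 x y 1 1 = 0 by apply/cancel/(bianchi_k i10).
have m0 x y : w 0 0 x y 0 1 = 0.
  by apply: (mulfI c2); rewrite -(bianchi_km i01) k0 !mulr0.
have m1 x y : w 1 1 x y 1 0 = 0.
  by apply: (mulfI c2); rewrite -(bianchi_km i10) k1 !mulr0.
have f0 x y : w 0 1 x y 1 0 = 0.
  by apply: (mulfI (lt0r_neq0 n_gt0)); rewrite (bianchi_f i01) g0 !mulr0.
have f1 x y : w 1 0 x y 0 1 = 0.
  by apply: (mulfI (lt0r_neq0 n_gt0)); rewrite (bianchi_f i10) g1 !mulr0.
have s0 x y : w 1 1 x y 0 0 = 0 by have := wt 1 1 x y; rewrite g1 addr0.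
have s1 x y : w 1 0 x y 0 0 = 0 by have := wt 1 0 x y; rewrite k1 addr0.
have p0 x y : w 0 1 x y 0 1 = 0 by rewrite wC f1 oppr0.
have p1 x y : w 1 0 x y 1 0 = 0 by rewrite wC f0 oppr0.
move=> a b c d x y; move: a b c d.
by apply: ord2P; apply: ord2P; apply: ord2P; apply: ord2P;
  rewrite ?w11E ?(g0, g1, q0, q1, k0, m0, m1, f0, f1, s0, s1, p0, p1) ?oppr0.
Qed.

(* For [N = 2] the six 2-forms reduce to five, the components of a totally
   symmetric tensor of order four. *)
Lemma bianchi_two : N = 2%N -> forall a b c d x y,
  (w a b x y d c = w b c x y d a) * (w a b x y d c = - w a b y x d c).
Proof.
move=> N2; have n2 : n = 2%:R by rewrite /n N2.
have c2 : (2%:R : R) != 0 by rewrite pnatr_eq0.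
have km x y : w 0 1 x y 0 0 = w 0 0 x y 0 1.
  by apply: (mulfI c2); rewrite -{1}n2 (bianchi_km i01).
have f01 x y : w 0 1 x y 1 0 = - w 0 0 x y 0 0.
  by apply: (mulfI c2); rewrite -{1}n2 (bianchi_f i01) (wC 0 0); ring.
have f10 x y : w 1 0 x y 0 1 = - w 1 1 x y 1 1.
  by apply: (mulfI c2); rewrite -{1}n2 (bianchi_f i10) (wC 1 1); ring.
have ml x y : w 1 1 x y 1 0 = - w 0 0 x y 0 1 by exact: (bianchi_ml i01).
have w0101 x y : w 0 1 x y 0 1 = - w 1 1 x y 1 1.
  by rewrite wC f10 (wC 1 1 1 1 y x); ring.
have w00 x y : w 1 1 x y 0 0 = - w 1 1 x y 1 1 by rewrite w11E opprK.
have w1000 x y : w 1 0 x y 0 0 = w 0 0 x y 0 1 by rewrite wC km (wC 0 0 0 1 y x) opprK.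
have w1010 x y : w 1 0 x y 1 0 = - w 0 0 x y 0 0.
  by rewrite wC f01 (wC 0 0 0 0 y x) !opprK.
have rules := (km, f01, f10, ml, w0101, w1000, w1010).
move=> a b c d x y; split; move: a b c d.
  by apply: ord2P; apply: ord2P; apply: ord2P; apply: ord2P;
    rewrite ?rules ?(w11E 0) ?(w11E 1 0) ?w00 ?rules ?opprK.
by apply: ord2P; apply: ord2P; apply: ord2P; apply: ord2P;
  rewrite ?rules ?(w11E 0) ?(w11E 1 0) ?w00 ?rules ?opprK -?wC //;
  rewrite wC ?opprK.
Qed.

End BianchiAlgebra.

(** An alternating form on the plane is a multiple of the determinant, for which the identity is the
    linear relation between three plane vectors given by Cramer's rule. *)
Lemma cyclic_area (R : realType) (N : nat) (h : 'cV[R]_N -> 'cV[R]_N -> R) :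
    N = 2%N -> (forall x, coordwise (h x)) -> (forall x y, h x y = - h y x) ->
  forall x y z, h x y *: z + h y z *: x + h z x *: y = 0.
Proof.
move=> N2; subst N => hr hC x y z.
have h0 u : h u u = 0.
  by have /eqP := hC u u; rewrite -subr_eq0 opprK -mulr2n mulrn_eq0 => /eqP.
have hl u v : h v u = v 0 0 * h (dlt R 0) u + v 1 0 * h (dlt R 1) u.
  by rewrite hC -hr sum2E (hC (dlt R 0)) (hC (dlt R 1)); ring.
have hE u v : h u v = (u 0 0 * v 1 0 - u 1 0 * v 0 0) * h (dlt R 0) (dlt R 1).
  rewrite -hr sum2E !(hl _ u) !h0 (hC (dlt R 1)); ring.
rewrite !(hE x y, hE y z, hE z x).
by apply/colP; apply: ord2P; rewrite !mxE; ring.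
Qed.

(** * Totally symmetric tensors T(x, y, z) with values in R^N, under rank one endomorphisms *)

Section SymmetricTensors.
Variables (R : realType) (N : nat).
Local Notation E := 'cV[R]_N.
Implicit Types (x y z u v : E) (a b : R).

Definition dot (xi : 'rV[R]_N) x : R := (xi *m x) 0 0.

Implicit Types (xi eta al be ga : 'rV[R]_N).

Lemma dotD xi x y : dot xi (x + y) = dot xi x + dot xi y.
Proof. by rewrite /dot mulmxDr mxE. Qed.

Lemma dotZ xi a x : dot xi (a *: x) = a * dot xi x.
Proof. by rewrite /dot -scalemxAr mxE. Qed.

Lemma dotN xi x : dot xi (- x) = - dot xi x.
Proof. by rewrite -scaleN1r dotZ mulN1r. Qed.

Lemma dotDl xi eta x : dot (xi + eta) x = dot xi x + dot eta x.
Proof. by rewrite /dot mulmxDl mxE. Qed.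

Lemma dotZl xi a x : dot (a *: xi) x = a * dot xi x.
Proof. by rewrite /dot -scalemxAl mxE. Qed.

Lemma dot_tr x y : dot x^T y = dot y^T x.
Proof. by rewrite /dot !mxE; apply: eq_bigr => i _; rewrite !mxE mulrC. Qed.

Lemma dot_dlt (k : 'I_N) x : dot (dlt R k)^T x = x k 0.
Proof.
rewrite /dot mxE -[RHS](sum_dlt (fun i => x i 0)); apply: eq_bigr => i _.
by rewrite !mxE eqxx andbT.
Qed.

Lemma rank1_mul v xi x : (v *m xi) *m x = dot xi x *: v.
Proof. by rewrite -mulmxA [xi *m x]mx11_scalar mul_mx_scalar. Qed.

Lemma dot_neq0 xi : xi != 0 -> exists x, dot xi x = 1.
Proof.
move=> xi0; have [k hk] : exists k, xi 0 k != 0.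
  by apply/existsP; apply: contraNT xi0 => /existsPn H; apply/eqP/rowP => k;
     rewrite mxE; apply/eqP; have := H k; rewrite negbK.
exists ((xi 0 k)^-1 *: dlt R k).
by rewrite dotZ -[xi]trmxK dot_tr trmxK dot_dlt mxE mulVf.
Qed.

Lemma dot_neq0r v : v != 0 -> exists xi, dot xi v = 1.
Proof.
rewrite -(inj_eq (@trmx_inj _ _ _)) trmx0 => /dot_neq0 [x hx].
by exists x^T; rewrite dot_tr.
Qed.

Lemma common_annihilator v w :
  (2 < N)%N -> exists2 xi, xi != 0 & dot xi v = 0 /\ dot xi w = 0.
Proof.
move=> N3; pose M := row_mx v w.
have : kermx M != 0.
  rewrite -mxrank_eq0 mxrank_ker -lt0n subn_gt0.
  by apply: leq_ltn_trans (rank_leq_col _) _.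
move=> /rowV0Pn [xi /sub_kermxP]; rewrite mul_mx_row => H xi0.
exists xi => //; move: H => /eqP.
rewrite -row_mx0 => /eqP /eq_row_mx [H1 H2].
by rewrite /dot H1 H2 mxE.
Qed.

(** The Lie algebra action of the endomorphism x |-> xi(x) v: with a plus sign on the value and a
    minus sign on each argument. *)
Definition rank1_act v xi (T : E -> E -> E -> E) x y z : E :=
  dot xi (T x y z) *: v - dot xi x *: T v y z - dot xi y *: T x v z
  - dot xi z *: T x y v.

Record symmetric3 (T : E -> E -> E -> E) : Prop := Symmetric3 {
  sym3_lin : forall a x x' y z, T (a *: x + x') y z = a *: T x y z + T x' y z;
  sym3_12 : forall x y z, T x y z = T y x z;
  sym3_23 : forall x y z, T x y z = T x z y }.

Definition trace_free (T : E -> E -> E -> E) := forall x y, ctr (T x y) = 0.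

Section Polarization.
Variable f : E -> E -> E -> E -> R.
Hypothesis fD : forall x x' y z u, f (x + x') y z u = f x y z u + f x' y z u.
Hypothesis f12 : forall x y z u, f x y z u = f y x z u.
Hypothesis f23 : forall x y z u, f x y z u = f x z y u.
Hypothesis f34 : forall x y z u, f x y z u = f x y u z.
Hypothesis f0 : forall x, f x x x x = 0.

Let fN x y z u : f (- x) y z u = - f x y z u.
Proof.
have f00 : f 0 y z u = 0.
  by apply: (@addrI _ (f 0 y z u)); rewrite -fD !addr0.
by apply/eqP; rewrite -addr_eq0 -fD addNr f00.
Qed.

Let fD2 x y y' z u : f x (y + y') z u = f x y z u + f x y' z u.
Proof. by rewrite f12 fD f12 (f12 y'). Qed.
Let fD3 x y z z' u : f x y (z + z') u = f x y z u + f x y z' u.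
Proof. by rewrite f23 fD2 f23 (f23 x z'). Qed.
Let fD4 x y z u u' : f x y z (u + u') = f x y z u + f x y z u'.
Proof. by rewrite f34 fD3 f34 (f34 x y u'). Qed.
Let fN2 x y z u : f x (- y) z u = - f x y z u.
Proof. by rewrite f12 fN f12. Qed.
Let fN3 x y z u : f x y (- z) u = - f x y z u.
Proof. by rewrite f23 fN2 f23. Qed.
Let fN4 x y z u : f x y z (- u) = - f x y z u.
Proof. by rewrite f34 fN3 f34. Qed.

Let fE := (fD, fD2, fD3, fD4, fN, fN2, fN3, fN4).

Let nf1 v w : ((f v v w v = f v v v w) * (f v w v v = f v v v w)
  * (f w v v v = f v v v w))%type.
Proof. by rewrite (f12 w) (f23 v w) (f34 v v w). Qed.

Let nf2 v w : ((f v w v w = f v v w w) * (f v w w v = f v v w w)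
  * (f w v v w = f v v w w) * (f w v w v = f v v w w)
  * (f w w v v = f v v w w))%type.
Proof.
have e1 : f v w v w = f v v w w by rewrite f23.
have e2 : f v w w v = f v v w w by rewrite f34.
have e3 : f w v w v = f v v w w by rewrite f12.
by rewrite e1 e2 e3 (f12 w) e1 -e3 (f23 w v).
Qed.

Let nf3 (a v w : E) : ((f a v w v = f a v v w) * (f a w v v = f a v v w))%type.
Proof. by rewrite (f23 a w) (f34 a v w). Qed.

(** Comparing v + w with v - w isolates the part odd in w, [H1]. Doubling w in [H1] separates its
    two terms, [H3]. For v fixed, the same device applied to the cubic form gives [H2], and one more
    polarization ends the proof. *)
Lemma polarization4 x y z u : f x y z u = 0.
Proof.
have H1 v w : f v v v w + f v w w w = 0.
  have := f0 (v + w); have := f0 (v - w).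
  rewrite !fE !opprK !f0 !(nf1 v w) !(nf1 w v) !(nf2 v w); lra.
have H3 v w : f v w w w = 0.
  by have := H1 v (w + w); have := H1 v w; rewrite !fE; lra.
have H2 v w s : f v w w s = 0.
  have := H3 v (w + s); have := H3 v (w - s).
  by rewrite !fE !opprK !H3 !(nf3 v w s) !(nf3 v s w); lra.
have := H2 x (y + z) u; rewrite !fE !H2 addr0 add0r (f23 x z y); lra.
Qed.

End Polarization.

Lemma symmetric3_linr T : symmetric3 T -> forall a x x' y z,
  (T y (a *: x + x') z = a *: T y x z + T y x' z) *
  (T y z (a *: x + x') = a *: T y z x + T y z x').
Proof.
move=> [Tl T12 T23] a x x' y z.
have H u w : T u (a *: x + x') w = a *: T u x w + T u x' w.
  by rewrite T12 Tl T12 (T12 x').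
by split; [exact: H | rewrite T23 H T23 (T23 y x')].
Qed.

(* Contracting the polarized identity [v_j T(v,v,v)_i = v_i T(v,v,v)_j] over
   [j] gives [(N + 2) T = 0], since [T] is trace-free. *)
Lemma symmetric3_eq0 T : symmetric3 T -> trace_free T ->
    (forall v xi, dot xi v = 0 -> dot xi (T v v v) = 0) ->
  forall x y z, T x y z = 0.
Proof.
move=> Ts Tt T0 x y z; have [Tl T12 T23] := Ts.
have TD1 u u' v w : T (u + u') v w = T u v w + T u' v w.
  by rewrite -[u in LHS]scale1r Tl scale1r.
have TD2 u u' v w : T v (u + u') w = T v u w + T v u' w.
  by rewrite T12 TD1 !(T12 v).
have TD3 u u' v w : T v w (u + u') = T v w u + T v w u'.
  by rewrite T23 TD2 !(T23 v w).
have H i j : T x y z i 0 * (j == j)%:R - (i == j)%:R * T x y z j 0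
  + (x j 0 * T y z (dlt R j) i 0 - x i 0 * T y z (dlt R j) j 0)
  + (y j 0 * T x z (dlt R j) i 0 - y i 0 * T x z (dlt R j) j 0)
  + (z j 0 * T x y (dlt R j) i 0 - z i 0 * T x y (dlt R j) j 0) = 0.
  (* [p] is symmetric in its first three arguments only; [f] symmetrizes it over the choice of the
     fourth. *)
  pose p x y z u := u j 0 * T x y z i 0 - u i 0 * T x y z j 0.
  pose f x y z u := p x y z u + p u y z x + p x u z y + p x y u z.
  have T13 u v w : T u v w = T w v u by rewrite T12 T23 T12.
  have fD u u' v w s : f (u + u') v w s = f u v w s + f u' v w s.
    by rewrite /f /p !(TD1, TD2, TD3) !mxE; ring.
  have f12 u v w s : f u v w s = f v u w s.
    by rewrite /f /p (T12 v u) (T12 v s) (T12 s u) (T12 u s) (T12 s v) (T12 v u); ring.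
  have f23 u v w s : f u v w s = f u w v s.
    by rewrite /f /p !(T23 _ w v) (T23 u w s) (T23 u s v); ring.
  have f34 u v w s : f u v w s = f u v s w.
    by rewrite /f /p (T13 s v w) (T23 u s w) ; ring.
  have f0 u : f u u u u = 0.
    suff p0 : p u u u u = 0 by rewrite /f p0 !addr0.
    (* This covector annihilates u, and its value on T(u, u, u) is [p u u u u]. *)
    have := T0 u (u j 0 *: (dlt R i)^T - u i 0 *: (dlt R j)^T).
    rewrite -scaleNr !dotDl !dotZl !dot_dlt => /(_ _)/wrap[]; first by ring.
    by rewrite /p => <-; ring.
  rewrite -[RHS](polarization4 fD f12 f23 f34 f0 x y z (dlt R j)) /f /p !dltE.
  rewrite (T13 (dlt R j)) (T12 z) (T23 x (dlt R j)) eqxx; ring.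
apply/colP => i; rewrite mxE.
have n0 : (N%:R + 2%:R : R) != 0 by rewrite -natrD pnatr_eq0 addnC.
apply: (mulfI n0); rewrite mulr0.
have TC u v (w : E) k : \sum_j w j 0 * T u v (dlt R j) k 0 = T u v w k 0.
  apply: (linear_coordwise (g := fun w => T u v w k 0)) => a s s'.
  by rewrite (symmetric3_linr Ts) !mxE.
have tC u v : \sum_j T u v (dlt R j) j 0 = 0 by exact: Tt.
have : \sum_(j < N) (0 : R) = 0 by rewrite sumr_const mul0rn.
rewrite -(eq_bigr _ (fun j _ => H i j)) !(big_split, sumrN) /= !TC.
rewrite -!mulr_sumr !tC !mulr0 !subr0.
rewrite (eq_bigr (fun=> 1)); last by move=> j _; rewrite eqxx.
rewrite sumr_const card_ord.
rewrite (eq_bigr (fun j => (j == i)%:R * T x y z j 0)); last first.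
  by move=> j _; rewrite eq_sym.
rewrite (sum_dlt (fun j => T x y z j 0)) (T23 x z y) (T23 y z x) (T12 y x z) => H0.
by rewrite -[RHS]H0; ring.
Qed.

End SymmetricTensors.

Section SymmetricTensorModule.
Variables (R : realType) (N : nat).
Local Notation E := 'cV[R]_N.
Implicit Types (x y z u v w : E) (a b : R) (T : E -> E -> E -> E).
Implicit Types (xi eta al be ga : 'rV[R]_N).

Lemma linear_expand (f : E -> E) :
  linear f -> forall x, f x = \sum_k x k 0 *: f (dlt R k).
Proof.
move=> fL x; pose f' : {linear E -> E} :=
  HB.pack f (GRing.isLinear.Build R E E *:%R f fL).
rewrite {1}(cvE x) -[f _]/(f' _) linear_sum.
by apply: eq_bigr => k _; rewrite linearZ.
Qed.

Lemma rank1_act2 T v xi : symmetric3 T -> dot xi v = 0 ->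
  forall x y z, rank1_act v xi (rank1_act v xi T) x y z =
    (2%:R * dot xi x * dot xi y) *: T v v z
    + (2%:R * dot xi x * dot xi z) *: T v v y
    + (2%:R * dot xi y * dot xi z) *: T v v x
    - (2%:R * (dot xi x * dot xi (T v y z) + dot xi y * dot xi (T v x z)
       + dot xi z * dot xi (T v x y))) *: v.
Proof.
move=> [Tl T12 T23] xv x y z; rewrite /rank1_act.
rewrite !(dotD, dotN, dotZ) !xv (T12 x v z) (T23 x y v) (T12 x v y).
rewrite (T12 x v v) (T23 v y v) (T23 v x v).
vring.
Qed.

Lemma rank1_act_sym v xi T : symmetric3 T -> symmetric3 (rank1_act v xi T).
Proof.
move=> Ts; have [Tl T12 T23] := Ts; split=> [a x x' y z|x y z|x y z].
- by rewrite /rank1_act !(Tl, symmetric3_linr Ts, dotD, dotZ); vring.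
- rewrite /rank1_act (T12 y x) (T12 v x) (T12 y v) (T12 y x); vring.
- rewrite /rank1_act (T23 x z y) (T23 v z y) (T23 x z v) (T23 x v y); vring.
Qed.

(** The endomorphism squares to zero, so each of the four slots (three arguments and the value)
    absorbs exactly one factor. There are 4! orders, and the three argument slots contribute the
    sign. *)
Lemma rank1_act4 T v xi : symmetric3 T -> dot xi v = 0 ->
  forall x y z,
    rank1_act v xi (rank1_act v xi (rank1_act v xi (rank1_act v xi T))) x y z =
    (- 24%:R * dot xi (T v v v) * dot xi x * dot xi y * dot xi z) *: v.
Proof.
move=> Ts xv x y z; have Ts2 := rank1_act_sym v xi (rank1_act_sym v xi Ts).
rewrite (rank1_act2 Ts2 xv) !(rank1_act2 Ts xv) !(dotD, dotN, dotZ) !xv.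
vring.
Qed.

(** The sum over all six permutations of the product al be ga, tensored with u; in particular
    [pure xi xi xi v] carries a factor 6. *)
Definition pure al be ga u x y z : E :=
  (dot al x * (dot be y * dot ga z + dot be z * dot ga y)
   + dot al y * (dot be x * dot ga z + dot be z * dot ga x)
   + dot al z * (dot be x * dot ga y + dot be y * dot ga x)) *: u.

Lemma rank1_act_pure w eta al be ga u x y z :
  rank1_act w eta (pure al be ga u) x y z =
  dot eta u *: pure al be ga w x y z - dot al w *: pure eta be ga u x y z
  - dot be w *: pure al eta ga u x y z - dot ga w *: pure al be eta u x y z.
Proof. by rewrite /rank1_act /pure !dotZ; vring. Qed.

(** [Q] is a module of trace-free tensors, kept as a predicate on plain functions and required to be
    stable only under rank one endomorphisms. *)
Variable Q : (E -> E -> E -> E) -> Prop.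
Hypothesis Qlin : forall a T T', Q T -> Q T' ->
  Q (fun x y z => a *: T x y z + T' x y z).
Hypothesis Qact : forall v xi T, Q T -> Q (rank1_act v xi T).
Hypothesis Qtf : forall T, Q T -> trace_free T.

Let fun3_ext T T' : (forall x y z, T x y z = T' x y z) -> T = T'.
Proof.
by move=> H; apply: funext => x; apply: funext => y; apply: funext => z.
Qed.

Let Qext T T' : (forall x y z, T x y z = T' x y z) -> Q T -> Q T'.
Proof. by move=> /fun3_ext ->. Qed.

Variable T0 : E -> E -> E -> E.
Hypothesis QT0 : Q T0.

(** The symmetrized product of q with the identity. Its contraction is (N + 2)q, so these tensors
    complement the trace-free ones among the symmetric tensors. *)
Definition form_id (q : E -> E -> R) x y z : E :=
  q y z *: x + q x z *: y + q x y *: z.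

Definition symform (q : E -> E -> R) :=
  (forall x y, q x y = q y x) /\ forall a x y z, q x (a *: y + z) = a * q x y + q x z.

(* [Q] extended by the complement of the trace-free tensors. *)
Let Q' T := exists2 q, symform q &
  Q (fun x y z => T x y z - form_id q x y z).

Let Q'ext T T' : (forall x y z, T x y z = T' x y z) -> Q' T -> Q' T'.
Proof. by move=> /fun3_ext ->. Qed.

Let Q'lin a T T' : Q' T -> Q' T' -> Q' (fun x y z => a *: T x y z + T' x y z).
Proof.
move=> [q [qs ql] QT] [q' [qs' ql'] QT'].
exists (fun x y => a * q x y + q' x y).
  by split=> [x y|b x y z]; [rewrite qs qs' | rewrite ql ql'; ring].
apply: Qext (Qlin a QT QT') => x y z.
by rewrite /form_id; vring.
Qed.

Let Q'act v xi T : Q' T -> Q' (rank1_act v xi T).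
Proof.
move=> [q [qs ql] QT].
exists (fun x y => - dot xi x * q v y - dot xi y * q v x).
  split=> [x y|b x y z]; first by ring.
  by rewrite ql dotD dotZ; ring.
apply: Qext (Qact v xi QT) => x y z.
rewrite /rank1_act /form_id.
by rewrite !(dotD, dotN, dotZ) (qs x v) (qs y v); vring.
Qed.

Let Q'form q : symform q -> Q' (form_id q).
Proof.
move=> sq; exists q => //.
by apply: Qext (Qlin (- 1) QT0 QT0) => x y z; vring.
Qed.

Let Q'0 : Q' (fun _ _ _ => 0).
Proof.
apply: Q'ext (Q'form (q := fun _ _ => 0) _) => [x y z|].
  by rewrite /form_id !scale0r !addr0.
by split=> *; rewrite ?mulr0 ?addr0.
Qed.

Let Q'Z a T : Q' T -> Q' (fun x y z => a *: T x y z).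
Proof. by move=> QT; apply: Q'ext (Q'lin a QT Q'0) => x y z; rewrite addr0. Qed.

Let Q'Zinv a T : a != 0 -> Q' (fun x y z => a *: T x y z) -> Q' T.
Proof.
move=> a0 /(Q'Z a^-1); apply: Q'ext => x y z.
by rewrite scalerA mulVf // scale1r.
Qed.

Let Q'D T T' : Q' T -> Q' T' -> Q' (fun x y z => T x y z + T' x y z).
Proof. by move=> QT /(Q'lin 1 QT); apply: Q'ext => x y z; rewrite scale1r. Qed.

Let Q'B T T' : Q' T -> Q' T' -> Q' (fun x y z => T x y z - T' x y z).
Proof. by move=> QT QT'; apply: Q'ext (Q'lin (- 1) QT' QT) => x y z; vring. Qed.

Let Q'sum (I : finType) (T : I -> E -> E -> E -> E) :
  (forall i, Q' (T i)) -> Q' (fun x y z => \sum_i T i x y z).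
Proof.
move=> QT; elim: (index_enum I) => [|i s IH].
  by apply: Q'ext Q'0 => x y z; rewrite big_nil.
by apply: Q'ext (Q'D (QT i) IH) => x y z; rewrite big_cons.
Qed.

Let pureC12 al be ga u x y z : pure al be ga u x y z = pure be al ga u x y z.
Proof. by rewrite /pure; congr (_ *: _); ring. Qed.
Let pureC23 al be ga u x y z : pure al be ga u x y z = pure al ga be u x y z.
Proof. by rewrite /pure; congr (_ *: _); ring. Qed.

(** With xi(w) = 1 and al(v) = 0, the endomorphism w (x) al leaves the factor v alone and replaces
    one xi at a time by - al. The covectors replaced earlier add terms that are already known to lie
    in [Q']. *)
Let spread xi v : xi != 0 -> dot xi v = 0 -> Q' (pure xi xi xi v) ->
  forall al be ga, dot al v = 0 -> dot be v = 0 -> dot ga v = 0 ->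
  Q' (pure al be ga v).
Proof.
move=> /dot_neq0 [w xw] xv Q0.
have H1 al : dot al v = 0 -> Q' (pure al xi xi v).
  move=> av; apply: (@Q'Zinv (- 3%:R)); first by rewrite oppr_eq0 pnatr_eq0.
  apply: Q'ext (Q'act w al Q0) => x y z.
  rewrite rank1_act_pure av xw (pureC12 xi al) (pureC23 xi xi al) (pureC12 xi al).
  vring.
have H2 al be : dot al v = 0 -> dot be v = 0 -> Q' (pure al be xi v).
  move=> av bv; apply: (@Q'Zinv (- 2%:R)); first by rewrite oppr_eq0 pnatr_eq0.
  apply: Q'ext (Q'D (Q'act w be (H1 al av)) (Q'Z (dot al w) (H1 be bv))) => x y z.
  by rewrite rank1_act_pure bv xw (pureC23 al xi be); vring.
move=> al be ga av bv gv.
apply: (@Q'Zinv (- 1)); first by rewrite oppr_eq0 oner_neq0.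
apply: Q'ext (Q'D (Q'act w ga (H2 al be av bv)) (Q'D
  (Q'Z (dot al w) (H2 be ga bv gv)) (Q'Z (dot be w) (H2 al ga av gv)))) => x y z.
rewrite rank1_act_pure gv xw (pureC12 ga be) (pureC23 al be ga) (pureC12 be ga).
by rewrite (pureC23 al ga be); vring.
Qed.

Hypothesis N_ge3 : (2 < N)%N.

(** To move from v to w, go through a covector om that kills both; it exists because N > 2. The
    endomorphism w (x) eta with eta(v) = 1 then turns om^3 (x) v into om^3 (x) w. *)
Let spread_all xi v : v != 0 -> xi != 0 -> dot xi v = 0 -> Q' (pure xi xi xi v) ->
  forall w al be ga, dot al w = 0 -> dot be w = 0 -> dot ga w = 0 ->
  Q' (pure al be ga w).
Proof.
move=> v0 xi0 xv Q0 w; have [om om0 [ov ow]] := common_annihilator v w N_ge3.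
have [eta ev] := dot_neq0r v0.
apply: (spread om0 ow).
have := Q'act w eta (spread xi0 xv Q0 ov ov ov).
by apply: Q'ext => x y z; rewrite rank1_act_pure ev ow; vring.
Qed.

Let edlt (i j : 'I_N) : dot (dlt R i)^T (dlt R j) = (i == j)%:R.
Proof. by rewrite dot_dlt dltE. Qed.

(** Only a repeated index m is not covered by [spread_all]. Such tensors have nonzero trace, so the
    argument compares them with one another and uses that [form_id] lies in [Q']. *)
Let full xi v : v != 0 -> xi != 0 -> dot xi v = 0 -> Q' (pure xi xi xi v) ->
  forall i j k m : 'I_N, Q' (pure (dlt R i)^T (dlt R j)^T (dlt R k)^T (dlt R m)).
Proof.
move=> v0 xi0 xv Q0; have all0 := spread_all v0 xi0 xv Q0.
pose p i j k m := pure (dlt R i)^T (dlt R j)^T (dlt R k)^T (dlt R m).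
have pC12 i j k m : p i j k m = p j i k m by apply: fun3_ext => *; exact: pureC12.
have pC23 i j k m : p i j k m = p i k j m by apply: fun3_ext => *; exact: pureC23.
have off i j k m : i != m -> j != m -> k != m -> Q' (p i j k m).
  by move=> im jm km; apply: all0; rewrite edlt (negPf im, negPf jm, negPf km).
suff diag j k m : Q' (p m j k m).
  move=> i j k m; case: (eqVneq i m) => [->|im]; first exact: diag.
  case: (eqVneq j m) => [->|jm]; first by rewrite -/(p _ _ _ _) pC12; exact: diag.
  case: (eqVneq k m) => [->|km]; last exact: off.
  by rewrite -/(p _ _ _ _) pC23 pC12; exact: diag.
have [l /andP[lj lk]] : exists l, (l != j) && (l != k).
  apply/existsP; apply: contraLR N_ge3 => /existsPn H.
  rewrite -leqNgt -[N]card_ord -(cardsT 'I_N).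
  apply: leq_trans (_ : #|[set j; k]| <= 2)%N; last by rewrite cards2; case: (j != k).
  apply/subset_leq_card/fintype.subsetP => i _; rewrite !inE.
  by have := H i; rewrite negb_and !negbK.
have jl : (j == l) = false by rewrite eq_sym (negPf lj).
have kl : (k == l) = false by rewrite eq_sym (negPf lk).
(* Act by e_i (x) e^l on p i j k l, which is available for i different from l because j and k differ
   from l. *)
have step i : Q' (fun x y z => p i j k i x y z
    - (1 + (j == i)%:R + (k == i)%:R) *: p l j k l x y z).
  have [->|il] := eqVneq i l.
    by apply: Q'ext Q'0 => x y z; rewrite jl kl !mulr0n !addr0 scale1r subrr.
  have := Q'act (dlt R i) (dlt R l)^T (off i j k l il _ _).
  rewrite jl kl => /(_ isT isT).
  apply: Q'ext => x y z; rewrite rank1_act_pure !edlt !eqxx !scale1r.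
  rewrite -/(p i j k i) -/(p l j k l) -/(p i l k l) -/(p i j l l).
  have -> : (j == i)%:R *: p i l k l x y z = (j == i)%:R *: p l j k l x y z.
    by case: eqP => [<-|_]; rewrite ?scale0r // pC12.
  have -> : (k == i)%:R *: p i j l l x y z = (k == i)%:R *: p l j k l x y z.
    by case: eqP => [<-|_]; rewrite ?scale0r // (pC12 l) (pC23 j) (pC12 j).
  by vring.
pose q x y : R := dot (dlt R j)^T x * dot (dlt R k)^T y
                + dot (dlt R j)^T y * dot (dlt R k)^T x.
have sq : symform q by split=> *; rewrite /q ?dotD ?dotZ; ring.
have sump x y z : \sum_i p i j k i x y z = form_id q x y z.
  rewrite (eq_bigr (fun i => x i 0 *: (q y z *: dlt R i) + y i 0 *: (q x z *: dlt R i)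
     + z i 0 *: (q x y *: dlt R i))); last first.
    by move=> i _; rewrite /p /pure !(dot_dlt i) /q; vring.
  rewrite !big_split /=; congr (_ + _ + _);
    by rewrite [X in _ = _ *: X]cvE scaler_sumr; apply: eq_bigr => i _;
       rewrite !scalerA mulrC.
have Ql : Q' (p l j k l).
  (* Sum [step] over i: the first terms add up to a [form_id], and the coefficients of p l j k l add
     up to N + 1 + 1. *)
  apply: (@Q'Zinv (N%:R + 2%:R)); first by rewrite -natrD pnatr_eq0 addnC.
  apply: Q'ext (Q'B (Q'form sq) (Q'sum step)) => x y z.
  rewrite sumrB sump opprB addrC subrK -scaler_suml; congr (_ *: _).
  rewrite !big_split /= sumr_const card_ord -addrA.
  congr (_ + _); rewrite -[RHS]/(1 + 1); congr (_ + _).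
    by rewrite -[RHS](sum_dlt (fun=> 1) j); apply: eq_bigr => i _; rewrite mulr1 eq_sym.
  by rewrite -[RHS](sum_dlt (fun=> 1) k); apply: eq_bigr => i _; rewrite mulr1 eq_sym.
apply: Q'ext (Q'D (step m) (Q'Z (1 + (j == m)%:R + (k == m)%:R) Ql)) => x y z.
by rewrite subrK.
Qed.

Hypothesis sT0 : symmetric3 T0.
Hypothesis T0_neq0 : exists x y z, T0 x y z != 0.

Lemma symmetric3_irreducible T : symmetric3 T -> trace_free T -> Q T.
Proof.
move=> Ts Tt.
(* If no such pair existed, [symmetric3_eq0] would make [T0] vanish. *)
have [[v xi] [/= xv xT]] : exists p : E * 'rV_N,
    dot p.2 p.1 = 0 /\ dot p.2 (T0 p.1 p.1 p.1) != 0.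
  apply: contrapT => H; have [x [y [z]]] := T0_neq0; case/eqP.
  apply: (symmetric3_eq0 sT0 (Qtf QT0)) => v xi xv; apply: contrapT => xT.
  by apply: H; exists (v, xi); split=> //; apply/eqP.
have v0 : v != 0.
  apply: contraNneq xT => ->; rewrite /= in xv *.
  have -> : T0 0 0 0 = 0.
    by have := sym3_lin sT0 (- 1) 0 0 0 0; rewrite scaler0 addr0 scaleN1r addNr.
  by rewrite /dot mulmx0 mxE.
have xi0 : xi != 0.
  by apply: contraNneq xT => ->; rewrite /dot mul0mx mxE.
have pQ : Q' (pure xi xi xi v).
  (* The factor -24 of [rank1_act4] divided by the factor 6 in [pure xi xi xi v]. *)
  apply: (@Q'Zinv (- 4%:R * dot xi (T0 v v v))).
    by rewrite mulf_neq0 // oppr_eq0 pnatr_eq0.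
  have : Q' T0.
    exists (fun _ _ => 0); first by split=> *; rewrite ?mulr0 ?addr0.
    apply: Qext QT0 => x y z.
    by rewrite /form_id !scale0r !addr0 subr0.
  move=> /(Q'act v xi)/(Q'act v xi)/(Q'act v xi)/(Q'act v xi).
  apply: Q'ext => x y z; rewrite (rank1_act4 sT0 xv) /pure; vring.
have pT := full v0 xi0 xv pQ.
have [q [qs ql] QTq] : Q' T.
  (* Expanding T on basis tensors with [pure] in place of plain products counts each of the six
     permutations of the arguments once. *)
  apply: (@Q'Zinv 6%:R); first by rewrite pnatr_eq0.
  apply: Q'ext (Q'sum (fun i => Q'sum (fun j => Q'sum (fun k => Q'sum (fun m =>
    Q'Z (T (dlt R i) (dlt R j) (dlt R k) m 0) (pT i j k m)))))) => x y z.
  pose S x y z := \sum_i \sum_j \sum_k (x i 0 * y j 0 * z k 0) *: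
    T (dlt R i) (dlt R j) (dlt R k).
  have SE x' y' z' : S x' y' z' = T x' y' z'.
    have [Tl T12 T23] := Ts.
    have T1 u u' : linear (fun w => T w u u') by move=> a w w'; exact: Tl.
    have T2 u u' : linear (fun w => T u w u').
      by move=> a w w'; rewrite (symmetric3_linr Ts).
    have T3 u u' : linear (fun w => T u u' w).
      by move=> a w w'; rewrite (symmetric3_linr Ts).
    rewrite (linear_expand (T1 y' z') x'); apply: eq_bigr => i _.
    rewrite (linear_expand (T2 (dlt R i) z') y') scaler_sumr; apply: eq_bigr => j _.
    rewrite (linear_expand (T3 (dlt R i) (dlt R j)) z') !scaler_sumr.
    by apply: eq_bigr => k _; rewrite !scalerA.
  transitivity (S x y z + S x z y + S y x z + S y z x + S z x y + S z y x).
    rewrite /S -!big_split; apply: eq_bigr => i _ /=.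
    rewrite -!big_split; apply: eq_bigr => j _ /=.
    rewrite -!big_split; apply: eq_bigr => k _ /=.
    rewrite -!scalerDl [X in _ = _ *: X]cvE scaler_sumr; apply: eq_bigr => m _.
    by rewrite /pure !dot_dlt; vring.
  rewrite !SE; have [Tl T12 T23] := Ts.
  rewrite (T23 x z y) (T12 y x z) (T12 z x y) (T23 x z y) (T12 z y x) (T23 y z x) (T12 y x z).
  by vring.
(* T and T minus [form_id q] are both trace-free, so (N + 2)q = 0 and the enlargement from [Q] to
   [Q'] is undone. *)
have q0 x y : q x y = 0.
  have := Qtf QTq x y; have := Tt x y.
  rewrite (_ : (fun z => _) = fun z => T x y z + (- (q y z *: x) + - (q x z *: y)
    + - (q x y *: z))); last first.
    by apply: funext => z; rewrite /form_id; vring.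
  have qc u : coordwise (q u) by apply: linear_coordwise => a s s'; rewrite ql.
  rewrite !ctrD !ctrN !ctr_rank1 // ctr_scal => -> H.
  have n0 : (N%:R + 2%:R : R) != 0 by rewrite -natrD pnatr_eq0 addnC.
  apply: (mulfI n0); rewrite mulr0 -[RHS]oppr0 -[in RHS]H (qs y x); ring.
by apply: Qext QTq => x y z; rewrite /form_id !q0 !scale0r !addr0 subr0.
Qed.

End SymmetricTensorModule.

(** * The normalizer and the centralizer of G in a frame *)

Section SpanOfFamily.
Variables (K : fieldType) (W : vectType K).

Lemma mem_span_family (I : finType) (v : I -> W) (w : W) :
  w \in <<[seq v i | i : I]>>%VS <-> exists c : I -> K, w = \sum_i c i *: v i.
Proof.
rewrite span_def big_map big_enum /=; split.
  move=> /memv_sumP[u uP ->]; have /choice[c cP] : forall i, exists c, u i = c *: v i.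
    by move=> i; have /vlineP := uP i isT.
  by exists c; apply: eq_bigr => i _.
move=> [c ->]; apply/memv_sumP; exists (fun i => c i *: v i) => // i _.
exact/memvZ/memv_line.
Qed.

Lemma free_family n (v : 'I_n -> W) :
  (forall c : 'I_n -> K, \sum_i c i *: v i = 0 -> forall i, c i = 0) ->
  free [seq v i | i : 'I_n].
Proof.
move=> H; have -> : [seq v i | i : 'I_n] = [tuple v i | i < n] by [].
apply/freeP => c; rewrite (eq_bigr (fun i => c i *: v i)); first exact: H.
by move=> i _; rewrite -tnth_nth tnth_mktuple.
Qed.

End SpanOfFamily.

Section Normalizer.
Variables (R : realType) (V : vectType R) (J : 'I_3 -> 'End(V)) (N : nat).
Variables (F : frame J N) (G : {vspace 'End(V)}).
Hypothesis GJ : corresponds G J.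
Local Notation t := (tau F).
Implicit Types (h k l : 'cV[R]_2) (x y z : 'cV[R]_N) (m : 'M[R]_2) (M : 'M[R]_N).
Implicit Types (A : 'End(V)).

Lemma mem_GJ A : A \in G <-> exists c : 'I_3 -> R, A = \sum_i c i *: J i.
Proof. by have [_ /andP[/eqP <- _]] := GJ; exact: mem_span_family. Qed.

Lemma J_in_G i : J i \in G.
Proof.
apply/mem_GJ; exists (fun j => (j == i)%:R).
rewrite (bigD1 i) //= big1 => [|j /negPf->]; last by rewrite scale0r.
by rewrite eqxx scale1r addr0.
Qed.

Lemma gHD m m' : gH F (m + m') = gH F m + gH F m'.
Proof.
by apply: (@frame_ext _ _ _ _ F) => h x; rewrite appD !gH_tau mulmxDl tauDl.
Qed.

Lemma gHZ a m : gH F (a *: m) = a *: gH F m.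
Proof.
by apply: (@frame_ext _ _ _ _ F) => h x; rewrite appZ !gH_tau -scalemxAl tauZl.
Qed.

Lemma gED M M' : gE F (M + M') = gE F M + gE F M'.
Proof.
by apply: (@frame_ext _ _ _ _ F) => h x; rewrite appD !gE_tau mulmxDl tauDr.
Qed.

Lemma gEZ a M : gE F (a *: M) = a *: gE F M.
Proof.
by apply: (@frame_ext _ _ _ _ F) => h x; rewrite appZ !gE_tau -scalemxAl tauZr.
Qed.

Lemma gH_scalar a : gH F a%:M = a *: \1%VF.
Proof.
by apply: (@frame_ext _ _ _ _ F) => h x; rewrite gH_tau appZ id_lfunE mul_scalar_mx tauZl.
Qed.

Lemma gE_scalar a : gE F a%:M = a *: \1%VF.
Proof.
by apply: (@frame_ext _ _ _ _ F) => h x; rewrite gE_tau appZ id_lfunE mul_scalar_mx tauZr.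
Qed.

Lemma comp_gH m m' : (gH F m \o gH F m')%VF = gH F (m *m m').
Proof. by apply: (@frame_ext _ _ _ _ F) => h x; rewrite comp_lfunE !gH_tau mulmxA. Qed.

Lemma comp_gE M M' : (gE F M \o gE F M')%VF = gE F (M *m M').
Proof. by apply: (@frame_ext _ _ _ _ F) => h x; rewrite comp_lfunE !gE_tau mulmxA. Qed.

Lemma comp_gEH M m : (gE F M \o gH F m)%VF = (gH F m \o gE F M)%VF.
Proof. by apply: (@frame_ext _ _ _ _ F) => h x; rewrite !comp_lfunE !gH_tau !gE_tau gH_tau. Qed.

Lemma mx2_ext m m' : m 0 0 = m' 0 0 -> m 0 1 = m' 0 1 -> m 1 0 = m' 1 0 ->
  m 1 1 = m' 1 1 -> m = m'.
Proof. by move=> *; apply/matrixP; apply: ord2P; apply: ord2P. Qed.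

Lemma traceless_jmx (m : 'M[R]_2) : m 0 0 + m 1 1 = 0 <->
  exists c : 'I_3 -> R, m = \sum_i c i *: jmx R i.
Proof.
split=> [|[c ->]]; last by rewrite !summxE !sum3E /jmx /= !mxE /=; ring.
move=> /eqP; rewrite addrC addr_eq0 => /eqP tm.
exists (fun i => if i == 0 then 2%:R^-1 * (m 1 0 - m 0 1)
        else if i == 1 then m 0 0 else 2%:R^-1 * (m 1 0 + m 0 1)).
have c2 : (2%:R : R) != 0 by rewrite pnatr_eq0.
by rewrite sum3E; apply: mx2_ext; rewrite /jmx /= !mxE /= ?tm; field.
Qed.

Lemma gH_sum (c : 'I_3 -> R) : gH F (\sum_i c i *: jmx R i) = \sum_i c i *: J i.
Proof. by rewrite !sum3E !gHD !gHZ !(J_gH F). Qed.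

Lemma mem_G_gH A : A \in G <-> exists2 m : 'M[R]_2, m 0 0 + m 1 1 = 0 & A = gH F m.
Proof.
rewrite mem_GJ; split=> [[c ->]|[m /traceless_jmx[c ->] ->]].
  by rewrite -gH_sum; eexists; last by []; apply/traceless_jmx; exists c.
by exists c; rewrite gH_sum.
Qed.

(** Commuting with [J 1], A preserves e_0 (x) R^N, where M is read off; commuting with [J 0], which
    maps e_0 to e_1, forces the same M on the other copy. *)
Lemma commJ_gE A : (forall i X, A (J i X) = J i (A X)) -> exists M, A = gE F M.
Proof.
move=> AJ.
pose M : 'M[R]_N := \matrix_(i, j) (cmp F 0 (A (t (dlt R 0) (dlt R j)))) i 0.
have j0 : jmx R 0 *m dlt R 0 = dlt R 1 /\ jmx R 1 *m dlt R 0 = dlt R 0.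
  by split; apply/colP; apply: ord2P; rewrite !mxE sum2E !mxE /=; ring.
exists M; apply: (@frame_ext _ _ _ _ F) => h x; rewrite gE_tau.
have A0 y : A (t (dlt R 0) y) = t (dlt R 0) (M *m y).
  pose u := cmp F 0 (A (t (dlt R 0) y)); pose v := cmp F 1 (A (t (dlt R 0) y)).
  have E : A (t (dlt R 0) y) = t (dlt R 0) u + t (dlt R 1) v.
    by rewrite {1}(frameK F (A _)) sum2E.
  have v0 : v = 0.
    have := AJ 1 (t (dlt R 0) y); rewrite (J_tau F) j0.2 E homD !(J_tau F) j0.2.
    move=> /(congr1 (cmp F 1)); rewrite !homD !cmp_tau !mxE !sum2E !mxE /=.
    rewrite !(mul0r, mulr0, mulr1, mul1r, addr0, add0r, scale0r, scale1r) scaleN1r.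
    move=> /eqP; rewrite -subr_eq0 opprK -mulr2n -scaler_nat scaler_eq0 pnatr_eq0 /=.
    by move/eqP.
  rewrite E v0 hom0 addr0; congr (t _ _); rewrite /u.
  apply/colP => i; rewrite [RHS]mxE.
  rewrite {1}(cvE y) !hom_sum summxE; apply: eq_bigr => j _.
  by rewrite !homZ !mxE mulrC.
have A1 y : A (t (dlt R 1) y) = t (dlt R 1) (M *m y).
  by rewrite -j0.1 -!(J_tau F) AJ A0.
rewrite (cvE h) !hom_sum !sum_lfunE hom_sum !sum2E; by rewrite !tauZl !homZ A0 A1.
Qed.

Lemma mem_centralizer_gE A : A \in centralizer G <-> exists M, A = gE F M.
Proof.
rewrite mem_centralizer; split=> [AG|[M ->] _ /mem_G_gH[m _ ->]].
  apply: commJ_gE => i X; apply/eqP; rewrite -subr_eq0 -lieE AG ?app0 //.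
  exact: J_in_G.
by rewrite /lie comp_gEH subrr.
Qed.

Let pJ : parahypercomplex J := GJ.1.

Lemma J02 X : J 0 (J 2%:R X) = - J 1 X.
Proof. by rewrite -(J01 pJ) (J00 pJ). Qed.
Lemma J10' X : J 1 (J 0 X) = - J 2%:R X.
Proof. by rewrite (J10 pJ) (J01 pJ). Qed.
Lemma J12 X : J 1 (J 2%:R X) = - J 0 X.
Proof. by rewrite -(J01 pJ) (J10 pJ) (J11 pJ). Qed.
Lemma J21 X : J 2%:R (J 1 X) = J 0 X.
Proof. by rewrite -(J01 pJ) (J11 pJ). Qed.
Lemma J22 X : J 2%:R (J 2%:R X) = X.
Proof. by rewrite -{1}(J01 pJ) J12 homN (J00 pJ) opprK. Qed.

Definition Jtable := (J00 pJ, J01 pJ, J02, J10', J11 pJ, J12, J20 pJ, J21, J22).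

(* The average of [A] over the conjugations by [1], [J 0], [J 1], [J 2] commutes
   with the [J i], and differs from [A] by an element of the algebra generated by
   [G]. *)
Lemma mem_normalizer_gHE A :
  A \in normalizer G <-> exists m M, A = gH F m + gE F M.
Proof.
rewrite mem_normalizer; split; last first.
  move=> [m [M ->]] _ /mem_G_gH[m' tm' ->]; apply/mem_G_gH.
  exists (m *m m' - m' *m m); first by rewrite !mxE !sum2E; ring.
  rewrite -[- (m' *m m)]scaleN1r gHD gHZ scaleN1r -!comp_gH.
  apply/lfunP => X; rewrite lieE appB !comp_lfunE !appD homD.
  have -> : gE F M (gH F m' X) = gH F m' (gE F M X).
    by rewrite -!comp_lfunE comp_gEH.
  by vring.
move=> AG; have /choice[m mP] : forall i, exists m, lie A (J i) = gH F m.
  by move=> i; have /mem_G_gH[m _ ->] := AG _ (J_in_G i); exists m.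
have AJ i X : J i (A X) = A (J i X) - gH F (m i) X by rewrite -mP lieE; vring.
(* Here - eps i [J i] is the inverse of [J i], so each summand is a conjugate of A. As [A, [J i]] is
   [gH (m i)], it differs from A by eps i [m i] [jmx i] on the first factor, which explains the
   correction in [C]. *)
pose B X : V := \sum_i - eps R i *: J i (A (J i X)).
pose C : 'End(V) := A - gH F (4%:R^-1 *: \sum_i - eps R i *: (m i *m jmx R i)).
have c4 : (4%:R : R) != 0 by rewrite pnatr_eq0.
have CE X : C X = 4%:R^-1 *: (A X + B X).
  rewrite /C appB gHZ appZ; apply: (scalerI c4).
  rewrite scalerBr !scalerA divff // !scale1r /B !sum3E /eps /= !gHD !gHZ -!comp_gH.
  rewrite -!(J_gH F) !appD !appZ !comp_lfunE !AJ !Jtable !homN.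
  by vring.
have [M CM] : exists M, C = gE F M.
  apply: commJ_gE => i X; rewrite !CE homZ homD; congr (_ *: _).
  rewrite /B !sum3E /eps /=; move: i.
  by apply: ord3P; rewrite !(homD, homZ) !Jtable ?homN; vring.
exists (4%:R^-1 *: \sum_i - eps R i *: (m i *m jmx R i)), M.
by rewrite -CM /C addrC subrK.
Qed.

Lemma gE_normalizer M : gE F M \in normalizer G.
Proof.
apply/mem_normalizer_gHE; exists 0, M.
by rewrite -[0 : 'M__](scale0r 0) gHZ scale0r add0r.
Qed.

Lemma gH_normalizer m : gH F m \in normalizer G.
Proof.
apply/mem_normalizer_gHE; exists m, 0.
by rewrite -[0 : 'M__](scale0r 0) gEZ scale0r addr0.
Qed.

Lemma centralizer_normalizer : (centralizer G <= normalizer G)%VS.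
Proof.
by apply/subvP => A /mem_centralizer_gE[M ->]; exact: gE_normalizer.
Qed.

Lemma sub_normalizer : (G <= normalizer G)%VS.
Proof. by apply/subvP => A /mem_G_gH[m _ ->]; exact: gH_normalizer. Qed.

(** Scalars belong to both gl_2 and gl_N; half the trace of m is moved into M. *)
Lemma normalizer_traceless A : A \in normalizer G ->
  exists (m : 'M[R]_2) (M : 'M[R]_N), m 0 0 + m 1 1 = 0 /\ A = gH F m + gE F M.
Proof.
move=> /mem_normalizer_gHE[m [M ->]].
pose a := 2%:R^-1 * (m 0 0 + m 1 1).
exists (m - a%:M), (M + a%:M); split.
  have c2 : (2%:R : R) != 0 by rewrite pnatr_eq0.
  by rewrite !mxE /= /a; field.
by rewrite gHD gED -scaleN1r gHZ gH_scalar gE_scalar; vring.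
Qed.

End Normalizer.

(** * Invariance of curvature spaces and equivariance of the Ricci map *)

Section CurvatureModules.
Variables (R : realType) (V : vectType R).
Implicit Types (L : {vspace 'End(V)}) (A : 'End(V)) (S : Tens V) (B : Bil V).
Implicit Types (X Y Z : V).

Lemma tens_ext S S' : (forall X Y Z, S X Y Z = S' X Y Z) -> S = S'.
Proof. by move=> H; apply/lfunP => X; apply/lfunP => Y; apply/lfunP => Z. Qed.

Lemma curvS L L' : (L <= L')%VS -> (curv L <= curv L')%VS.
Proof.
move=> /subvP LL'; apply/subvP => S /mem_curv[SL SC SB].
by apply/mem_curv; split=> // X Y; apply: LL'.
Qed.

Lemma lie_act_curv L A S :
  A \in normalizer L -> S \in curv L -> lie_act A S \in curv L.
Proof.
move=> /mem_normalizer AL /mem_curv[SL SC SB]; apply/mem_curv; split=> [X Y|X Y|X Y Z].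
- have -> : lie_act A S X Y = lie A (S X Y) - S (A X) Y - S X (A Y).
    by apply/lfunP => Z; rewrite lie_actE appB appB lieE; vring.
  by apply: memvB (SL _ _); apply: memvB (SL _ _); apply: AL (SL _ _).
- by apply/lfunP => Z; rewrite appN !lie_actE (SC X Y) (SC (A X) Y) (SC X (A Y));
    rewrite !(appN, homN); vring.
rewrite !lie_actE.
transitivity (A (S X Y Z + S Y Z X + S Z X Y)
  - (S (A X) Y Z + S Y Z (A X) + S Z (A X) Y)
  - (S X (A Y) Z + S (A Y) Z X + S Z X (A Y))
  - (S X Y (A Z) + S Y (A Z) X + S (A Z) X Y)); first by rewrite !homD; vring.
by rewrite SB (SB (A X)) (SB X (A Y)) (SB X Y (A Z)) hom0 !subr0.
Qed.

Definition bil_act A B : Bil V :=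
  bilinfun (W := R^o) (fun X Y => - B (A X) Y - B X (A Y)).

Lemma bil_actE A B X Y : bil_act A B X Y = - B (A X) Y - B X (A Y).
Proof.
rewrite /bil_act bilinfunE // => [X' a Y1 Y2|Y' a X1 X2] /=.
  by rewrite !(homD, homZ); vring.
by rewrite !(homD, homZ, appD, appZ); vring.
Qed.

Lemma bil_ext B B' : (forall X Y, B X Y = B' X Y) -> B = B'.
Proof. by move=> H; apply/lfunP => X; apply/lfunP => Y. Qed.

Definition ric_op S Y Z : 'End(V) := linfun (fun X => S X Y Z).

Lemma ric_opE S Y Z X : ric_op S Y Z X = S X Y Z.
Proof.
by rewrite /ric_op linfunE // => a X1 X2; rewrite !(homD, homZ, appD, appZ).
Qed.

(** The terms in which A acts on the value and on the contracted argument cancel under the trace,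
    since trace(AB) = trace(BA). *)
Lemma Ric_lie_act A S : Ric V (lie_act A S) = bil_act A (Ric V S).
Proof.
apply: bil_ext => Y Z; rewrite bil_actE !RicE -!/(ric_op _ _ _).
rewrite (_ : ric_op _ Y Z = (A \o ric_op S Y Z) - ric_op S Y (A Z)
   - (ric_op S Y Z \o A) - ric_op S (A Y) Z)%VF.
  by rewrite !(traceD, traceN) (trace_comp A); ring.
apply/lfunP => X; rewrite !appB !comp_lfunE !ric_opE lie_actE; vring.
Qed.

End CurvatureModules.

(** * The map phi and its Ricci tensor in a frame *)

Section FrameTensors.
Variables (R : realType) (V : vectType R) (J : 'I_3 -> 'End(V)) (N : nat).
Variables (F : frame J N) (G : {vspace 'End(V)}).
Hypothesis GJ : corresponds G J.
Local Notation t := (tau F).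
Implicit Types (h k l : 'cV[R]_2) (x y z : 'cV[R]_N) (m : 'M[R]_2) (M : 'M[R]_N).
Implicit Types (A : 'End(V)) (S : Tens V) (B : Bil V) (X Y Z : V).

Lemma bil_frame_ext B B' :
  (forall h x k y, B (t h x) (t k y) = B' (t h x) (t k y)) -> B = B'.
Proof.
move=> H; apply: (@frame_ext _ _ _ _ F) => h x.
by apply: (@frame_ext _ _ _ _ F) => k y.
Qed.

Lemma tens_frame_ext S S' :
  (forall h x k y l z, S (t h x) (t k y) (t l z) = S' (t h x) (t k y) (t l z)) ->
  S = S'.
Proof.
move=> H; apply: (@frame_ext _ _ _ _ F) => h x; apply: (@frame_ext _ _ _ _ F) => k y.
by apply: (@frame_ext _ _ _ _ F) => l z.
Qed.

(** The sum of eps i J_i (x) J_i is, up to scale, the Casimir tensor of sl_2, here evaluated on R^2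
    (x) R^2. It is what removes the sums over the [J i] from [phi] and [Pi]. *)
Lemma casimir (W : vectType R) (f : 'cV[R]_2 -> 'cV[R]_2 -> W) h k :
    (forall k, linear (f^~ k)) -> (forall h, linear (f h)) ->
  \sum_(i < 3) eps R i *: f (jmx R i *m h) (jmx R i *m k) = f h k - 2%:R *: f k h.
Proof.
move=> fl fr.
have E (u : 'cV[R]_2) : u = u 0 0 *: dlt R 0 + u 1 0 *: dlt R 1.
  by rewrite {1}(cvE u) sum2E.
have j0 (u : 'cV[R]_2) : jmx R 0 *m u = - u 1 0 *: dlt R 0 + u 0 0 *: dlt R 1.
  by rewrite [LHS]E /jmx /= !mxE !sum2E !mxE /=; congr (_ *: _ + _ *: _); ring.
have j1 (u : 'cV[R]_2) : jmx R 1 *m u = u 0 0 *: dlt R 0 + - u 1 0 *: dlt R 1.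
  by rewrite [LHS]E /jmx /= !mxE !sum2E !mxE /=; congr (_ *: _ + _ *: _); ring.
have j2 (u : 'cV[R]_2) : jmx R 2%:R *m u = u 1 0 *: dlt R 0 + u 0 0 *: dlt R 1.
  by rewrite [LHS]E /jmx /= !mxE !sum2E !mxE /=; congr (_ *: _ + _ *: _); ring.
have f00 k' : f 0 k' = 0.
  by have := fl k' (- 1) 0 0; rewrite scaler0 addr0 scaleN1r addNr.
have f0r h' : f h' 0 = 0.
  by have := fr h' (- 1) 0 0; rewrite scaler0 addr0 scaleN1r addNr.
have flE a u v k' : f (a *: u + v) k' = a *: f u k' + f v k' by exact: fl.
have fE a b k' : f (a *: dlt R 0 + b *: dlt R 1) k' =
    a *: f (dlt R 0) k' + b *: f (dlt R 1) k'.
  by rewrite flE -[b *: _]addr0 flE f00 addr0.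
have fE' a b h' : f h' (a *: dlt R 0 + b *: dlt R 1) =
    a *: f h' (dlt R 0) + b *: f h' (dlt R 1).
  by rewrite fr -[b *: _]addr0 fr f0r addr0.
rewrite sum3E !j0 !j1 !j2 [f h k](_ : _ =
  f (h 0 0 *: dlt R 0 + h 1 0 *: dlt R 1) (k 0 0 *: dlt R 0 + k 1 0 *: dlt R 1));
  last by rewrite -!E.
rewrite [f k h](_ : _ =
  f (k 0 0 *: dlt R 0 + k 1 0 *: dlt R 1) (h 0 0 *: dlt R 0 + h 1 0 *: dlt R 1));
  last by rewrite -!E.
by rewrite !fE !fE' /eps /=; vring.
Qed.

(** By [casimir], each sum over i becomes a term with the vectors of R^2 in place plus a term with
    two of them swapped. The coefficients B(X,Y) and B(Y,X) of Z cancel, and the four survivors come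
    with a factor 2. *)
Lemma phi_frame B h x k y l z :
  phi J B (t h x) (t k y) (t l z) =
  2%:R *: (B (t k y) (t h z) *: t l x - B (t h x) (t k z) *: t l y
           + B (t k y) (t l x) *: t h z - B (t h x) (t l y) *: t k z).
Proof.
pose f1 h l := B (t k y) (t h z) *: t l x.
pose f2 k l := B (t h x) (t k z) *: t l y.
pose f3 l h := B (t k y) (t l x) *: t h z.
pose f4 l k := B (t h x) (t l y) *: t k z.
have lin (u : V) (v w : 'cV[R]_N) : (forall k', linear (fun h' => B u (t h' v) *: t k' w))
   /\ forall h', linear (fun k' => B u (t h' v) *: t k' w).
  split=> [k'|h'] a s s'.
    by rewrite !(homD, homZ, appD, appZ) /GRing.scale /=; vring.
  by rewrite !(homD, homZ, appD, appZ); vring.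
have C1 := casimir l h (lin (t k y) z x).1 (lin (t k y) z x).2.
have C2 := casimir l k (lin (t h x) z y).1 (lin (t h x) z y).2.
have C3 := casimir h l (lin (t k y) x z).1 (lin (t k y) x z).2.
have C4 := casimir k l (lin (t h x) y z).1 (lin (t h x) y z).2.
rewrite phiE /RB_vec.
rewrite (_ : \sum_(i < 3) _ = (B (t h x) (t k y) *: t l z - 2%:R *: (B (t h x) (t l y) *: t k z))
  - (B (t k y) (t h x) *: t l z - 2%:R *: (B (t k y) (t l x) *: t h z))
  + ((B (t h x) (t l z) *: t k y - 2%:R *: (B (t h x) (t k z) *: t l y))
  - (B (t k y) (t l z) *: t h x - 2%:R *: (B (t k y) (t h z) *: t l x)))).
  by vring.
rewrite -C1 -C2 -C3 -C4 -!sumrB -big_split; apply: eq_bigr => i _ /=.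
by rewrite !(J_tau F); vring.
Qed.

End FrameTensors.

Section FunRow.
Variables (R : realType) (n : nat).

Definition fun_row (f : 'cV[R]_n -> R) : 'rV[R]_n := \row_k f (dlt R k).

Lemma dot_fun_row f x : coordwise f -> dot (fun_row f) x = f x.
Proof. by move=> <-; rewrite /dot mxE; apply: eq_bigr => k _; rewrite mxE mulrC. Qed.

End FunRow.

Section PhiFrame.
Variables (R : realType) (V : vectType R) (J : 'I_3 -> 'End(V)) (N : nat).
Variables (F : frame J N) (G : {vspace 'End(V)}).
Hypothesis GJ : corresponds G J.
Local Notation t := (tau F).
Implicit Types (h k l : 'cV[R]_2) (x y z : 'cV[R]_N) (m : 'M[R]_2) (M : 'M[R]_N).
Implicit Types (A : 'End(V)) (S : Tens V) (B : Bil V) (X Y Z : V).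

Lemma bil_tau_coordE B X k : coordwise (fun x => B X (t k x)).
Proof. by apply: linear_coordwise => a x y; rewrite !(homD, homZ). Qed.

Lemma bil_tau_coordEl B X k : coordwise (fun x => B (t k x) X).
Proof. by apply: linear_coordwise => a x y; rewrite !(homD, homZ, appD, appZ). Qed.

Lemma bil_tau_coordH B X x : coordwise (fun k => B X (t k x)).
Proof.
by apply: linear_coordwise => a k l; rewrite !(homD, homZ, appD, appZ) ?(homD, homZ).
Qed.

Lemma bil_tau_coordHl B X x : coordwise (fun k => B (t k x) X).
Proof.
by apply: linear_coordwise => a k l;
  rewrite !(homD, homZ, appD, appZ) ?(homD, homZ, appD, appZ).
Qed.

Lemma frame_ind_dlt (P : V -> Prop) :
    (forall X Y, P X -> P Y -> P (X + Y)) -> (forall a x, P (t (dlt R a) x)) ->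
  forall X, P X.
Proof. by move=> PD Pt X; rewrite (frameK F X) sum2E; apply: PD. Qed.

Lemma bianchi_dlt S :
  (forall a x b y c z, S (t (dlt R a) x) (t (dlt R b) y) (t (dlt R c) z)
     + S (t (dlt R b) y) (t (dlt R c) z) (t (dlt R a) x)
     + S (t (dlt R c) z) (t (dlt R a) x) (t (dlt R b) y) = 0) ->
  forall X Y Z, S X Y Z + S Y Z X + S Z X Y = 0.
Proof.
have sum3D (u v w u' v' w' : V) : u + v + w = 0 -> u' + v' + w' = 0 ->
    (u + u') + (v + v') + (w + w') = 0.
  by move=> H1 H2; have := congr2 +%R H1 H2; rewrite addr0 => <-; vring.
move=> HS X Y Z; move: X; apply: frame_ind_dlt => [X X' H1 H2|a x].
  by rewrite (homD S) (homD (S Y Z)) (homD (S Z)) !appD sum3D.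
move: Y; apply: frame_ind_dlt => [Y Y' H1 H2|b y].
  by rewrite (homD S) (homD (S (t _ _))) (homD (S Z (t _ _))) !appD sum3D.
move: Z; apply: frame_ind_dlt => [Z Z' H1 H2|c z]; last exact: HS.
by rewrite (homD S) (homD (S (t _ _))) (homD (S (t _ _) (t _ _))) !appD sum3D.
Qed.

Lemma bianchi_frame S :
  (forall h x k y l z, S (t h x) (t k y) (t l z) + S (t k y) (t l z) (t h x)
     + S (t l z) (t h x) (t k y) = 0) ->
  forall X Y Z, S X Y Z + S Y Z X + S Z X Y = 0.
Proof. by move=> HS; apply: bianchi_dlt => *; exact: HS. Qed.

Lemma phi_curv B : phi J B \in curv (normalizer G).
Proof.
apply/mem_curv; split=> [X Y|X Y|].
- move: X; apply: (@frame_ind _ _ _ _ F) => [X X' HX HX'|h x]; first by rewrite homD appD memvD.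
  move: Y; apply: (@frame_ind _ _ _ _ F) => [Y Y' HY HY'|k y]; first by rewrite homD memvD.
  apply/(mem_normalizer_gHE F GJ).
  (* In [phi_frame], the two terms that keep z form an endomorphism of R^2, and the two that keep l
     form one of R^N. *)
  exists (2%:R *: (h *m fun_row (fun l => B (t k y) (t l x))
                   - k *m fun_row (fun l => B (t h x) (t l y)))).
  exists (2%:R *: (x *m fun_row (fun z => B (t k y) (t h z))
                   - y *m fun_row (fun z => B (t h x) (t k z)))).
  apply: (@frame_ext _ _ _ _ F) => l z; rewrite phi_frame appD gH_tau gE_tau.
  rewrite -!scalemxAl !mulmxBl !rank1_mul !dot_fun_row;
    try exact: bil_tau_coordE; try exact: bil_tau_coordH.
  by rewrite -!scaleN1r !(tauZl, tauZr, tauDl, tauDr); vring.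
- apply/lfunP => Z; rewrite appN !phiE /RB_vec !sum3E; vring.
by apply: bianchi_frame => h x k y l z; rewrite !phi_frame; vring.
Qed.

Lemma phi_equivariant A B : A \in normalizer G ->
  phi J (bil_act A B) = lie_act A (phi J B).
Proof.
move=> /(mem_normalizer_gHE F GJ)[m [M ->]].
apply: (@tens_frame_ext _ _ _ _ F) => h x k y l z; rewrite lie_actE phi_frame.
move: (phi J B) (phi_frame F B) => S SE.
rewrite !bil_actE !appD !gH_tau !gE_tau !(homD B) !(homD (B _)).
rewrite (homD (S _ _)) (homD S) (homD (S _)) !appD !SE.
rewrite !(homZ (gH F m)) !(homZ (gE F M)) !(homD (gH F m)) !(homD (gE F M)).
rewrite !(homN (gH F m)) !(homN (gE F M)) !(homZ (gH F m)) !(homZ (gE F M)).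
by rewrite !gH_tau !gE_tau; vring.
Qed.

Lemma frame_traceE (f : 'End(V)) :
  trace f = \sum_(a < 2) ctr (fun x => cmp F a (f (t (dlt R a) x))).
Proof. exact: frame_trace. Qed.

Lemma Ric_frame S k y l z :
  Ric V S (t k y) (t l z)
  = \sum_(a < 2) ctr (fun x => cmp F a (S (t (dlt R a) x) (t k y) (t l z))).
Proof.
rewrite RicE -/(ric_op _ _ _) frame_traceE.
by apply: eq_bigr => a _; apply: eq_bigr => i _; rewrite ric_opE.
Qed.

End PhiFrame.

Section RicciPhi.
Variables (R : realType) (V : vectType R) (J : 'I_3 -> 'End(V)) (N : nat).
Variables (F : frame J N) (G : {vspace 'End(V)}).
Hypothesis GJ : corresponds G J.
Local Notation t := (tau F).
Implicit Types (h k l : 'cV[R]_2) (x y z : 'cV[R]_N) (m : 'M[R]_2) (M : 'M[R]_N).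
Implicit Types (A : 'End(V)) (S : Tens V) (B : Bil V) (X Y Z : V).

Lemma Ric_phi B k y l z :
  Ric V (phi J B) (t k y) (t l z) =
  2%:R * ((N%:R + 2%:R) * B (t k y) (t l z) - B (t l y) (t k z) - B (t k z) (t l y)).
Proof.
rewrite (Ric_frame F).
rewrite (eq_bigr (fun a : 'I_2 => 2%:R * (N%:R * (l a 0 * B (t k y) (t (dlt R a) z))
   - l a 0 * B (t (dlt R a) y) (t k z) + B (t k y) (t l z) - k a 0 * B (t (dlt R a) z) (t l y)))).
  have := bil_tau_coordH F B (t k y) z l; have := bil_tau_coordHl F B (t k z) y l.
  have := bil_tau_coordHl F B (t l y) z k; rewrite !sum2E => <- <- <-; ring.
move=> a _; rewrite (_ : (fun x => _) = fun x => 2%:R *: ((l a 0 * B (t k y) (t (dlt R a) z)) *: x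
   + - (B (t (dlt R a) x) (t k z) *: (l a 0 *: y)) + B (t k y) (t l x) *: z
   + - (B (t (dlt R a) x) (t l y) *: (k a 0 *: z)))).
  rewrite ctrZ !ctrD !ctrN ctr_scal.
  rewrite (ctr_rank1 _ (bil_tau_coordEl F B (t k z) (dlt R a))).
  rewrite (ctr_rank1 _ (bil_tau_coordEl F B (t l y) (dlt R a))).
  rewrite (ctr_rank1 _ (bil_tau_coordE F B (t k y) l)).
  by rewrite !(tauZr, homZ, appZ) /GRing.scale /=; ring.
apply: funext => x; rewrite phi_frame !(homZ (cmp F a)) !(homD (cmp F a)).
rewrite !(homN (cmp F a)) !(homZ (cmp F a)) !cmp_tau !dltE eqxx scale1r; vring.
Qed.

End RicciPhi.

(** * The four types of bilinear forms and their irreducibility *)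

Section BilinearFormModules.
Variables (R : realType) (V : vectType R) (J : 'I_3 -> 'End(V)) (N : nat).
Variables (F : frame J N) (G : {vspace 'End(V)}).
Hypothesis GJ : corresponds G J.
Local Notation t := (tau F).
Implicit Types (h k l : 'cV[R]_2) (x y z : 'cV[R]_N) (m : 'M[R]_2) (M : 'M[R]_N).
Implicit Types (A : 'End(V)) (S : Tens V) (B : Bil V) (X Y Z : V) (s e : R).

(* [B] is [s]-symmetric in R^2 and [e]-symmetric in R^N. *)
Definition btype s e B :=
  forall h x k y, B (t h x) (t k y) = s * B (t k x) (t h y)
               /\ B (t h x) (t k y) = e * B (t h y) (t k x).

Lemma bil_expandH B X l z :
  B X (t l z) = l 0 0 * B X (t (dlt R 0) z) + l 1 0 * B X (t (dlt R 1) z).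
Proof. by rewrite -(bil_tau_coordH F B X z l) sum2E. Qed.

Lemma bil_expandHl B X l z :
  B (t l z) X = l 0 0 * B (t (dlt R 0) z) X + l 1 0 * B (t (dlt R 1) z) X.
Proof. by rewrite -(bil_tau_coordHl F B X z l) sum2E. Qed.

Lemma bil_expand B h x k y : B (t h x) (t k y) =
  \sum_(a < 2) \sum_(b < 2) \sum_(i < N) \sum_(j < N)
    h a 0 * k b 0 * x i 0 * y j 0 * B (t (dlt R a) (dlt R i)) (t (dlt R b) (dlt R j)).
Proof.
rewrite -(bil_tau_coordHl F B (t k y) x h); apply: eq_bigr => a _ /=.
rewrite -(bil_tau_coordH F B _ y k) mulr_sumr; apply: eq_bigr => b _ /=.
rewrite -(bil_tau_coordEl F B (t (dlt R b) y) (dlt R a) x) !mulr_sumr.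
apply: eq_bigr => i _ /=.
rewrite -(bil_tau_coordE F B _ (dlt R b) y) !mulr_sumr.
by apply: eq_bigr => j _ /=; ring.
Qed.

Section Irreducibility.
Variables (s e : R) (U : {vspace Bil V}) (B : Bil V).
Hypothesis UA : forall A B, A \in normalizer G -> B \in U -> bil_act A B \in U.
Hypotheses (UB : B \in U) (B0 : B != 0) (Bse : btype s e B).

(** Rank one endomorphisms of R^N, then of R^2, replace the two factors of a nonzero B by
    symmetrized products of arbitrary covectors, and such products span all forms of the given
    type. *)
Lemma bil_irreducible B' : btype s e B' -> B' \in U.
Proof.
move=> Bse'.
have [h0 [v [k0 [w s0]]]] : exists h v k w, B (t h v) (t k w) != 0.
  apply: contrapT => H; case/eqP: B0; apply: (@bil_frame_ext _ _ _ _ F) => h x k y.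
  rewrite !app0; apply: contrapT => /eqP Bn.
  by apply: H; exists h, x, k, y.
pose sg h k := B (t h v) (t k w).
have sgC h k : sg h k = s * sg k h by have [] := Bse h v k w.
have sgE h k : B (t h w) (t k v) = e * sg h k by have [] := Bse h w k v.
have actE M B1 h x k y :
    (- bil_act (gE F M) B1) (t h x) (t k y)
    = B1 (t h (M *m x)) (t k y) + B1 (t h x) (t k (M *m y)).
  by rewrite !appN bil_actE !gE_tau opprB opprK addrC.
have actH m B1 h x k y :
    (- bil_act (gH F m) B1) (t h x) (t k y)
    = B1 (t (m *m h) x) (t k y) + B1 (t h x) (t (m *m k) y).
  by rewrite !appN bil_actE !gH_tau opprB opprK addrC.
have UE M B1 : B1 \in U -> - bil_act (gE F M) B1 \in U.
  by move=> ?; rewrite memvN UA // gE_normalizer.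
have UH m B1 : B1 \in U -> - bil_act (gH F m) B1 \in U.
  by move=> ?; rewrite memvN UA // gH_normalizer.
pose B1 xi := - bil_act (gE F (v *m xi)) B.
have B1E xi h x k y : B1 xi (t h x) (t k y) =
    dot xi x * B (t h v) (t k y) + dot xi y * B (t h x) (t k v).
  by rewrite actE !rank1_mul !(tauZr, homZ, appZ).
(* The subtracted term cancels the contributions in which both endomorphisms act on the same
   argument; what remains depends on x and y only through xi and eta. [D] repeats this in R^2. *)
pose B2 xi eta := - bil_act (gE F (w *m eta)) (B1 xi) - dot xi w *: B1 eta.
have B2U xi eta : B2 xi eta \in U by rewrite memvB ?memvZ ?UE.
pose P xi eta x y := dot xi x * dot eta y + e * (dot eta x * dot xi y).
have B2E xi eta h x k y : B2 xi eta (t h x) (t k y) = sg h k * P xi eta x y.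
  rewrite 2!appB 2!appZ actE !rank1_mul !(tauZr, homZ, appZ) /GRing.scale /= !B1E.
  by rewrite sgE -/(sg h k) /P; ring.
pose B3 xi eta al := - bil_act (gH F (h0 *m al)) (B2 xi eta).
have B3E xi eta al h x k y : B3 xi eta al (t h x) (t k y) =
    (dot al h * sg h0 k + dot al k * sg h h0) * P xi eta x y.
  by rewrite actH !rank1_mul !(tauZl, homZ, appZ) /GRing.scale /= !B2E; ring.
pose D xi eta al be := - bil_act (gH F (k0 *m be)) (B3 xi eta al)
                       - dot al k0 *: B3 xi eta be.
have DU xi eta al be : D xi eta al be \in U by rewrite memvB ?memvZ ?UH.
have DE xi eta al be h x k y : D xi eta al be (t h x) (t k y) =
   sg h0 k0 * ((dot al h * dot be k + s * (dot be h * dot al k)) * P xi eta x y).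
  rewrite 2!appB 2!appZ actH !rank1_mul !(tauZl, homZ, appZ) /GRing.scale /= !B3E.
  by rewrite (sgC k0 h0); ring.
(* Each of the two symmetrizations in [D] doubles a form of type (s, e), whence the 4. *)
have -> : B' = (4%:R * sg h0 k0)^-1 *:
    \sum_(a < 2) \sum_(b < 2) \sum_(i < N) \sum_(j < N)
    B' (t (dlt R a) (dlt R i)) (t (dlt R b) (dlt R j)) *:
    D (dlt R i)^T (dlt R j)^T (dlt R a)^T (dlt R b)^T.
  apply: (@bil_frame_ext _ _ _ _ F) => h x k y.
  have c0 : 4%:R * sg h0 k0 != 0 by rewrite mulf_neq0 ?pnatr_eq0.
  apply: (scalerI c0); rewrite !appZ scalerA mulfV // scale1r.
  have [H1 H2] := Bse' h x k y; have [H3 H4] := Bse' h y k x.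
  transitivity (sg h0 k0 * (B' (t h x) (t k y) + s * B' (t k x) (t h y)
     + e * B' (t h y) (t k x) + e * (s * B' (t k y) (t h x)))).
    by rewrite -H3 -H1 -H2 /GRing.scale /=; ring.
  rewrite !(bil_expand B') !mulr_sumr -!big_split !mulr_sumr !sum_lfunE.
  apply: eq_bigr => a _ /=.
  rewrite !mulr_sumr -!big_split !mulr_sumr !sum_lfunE; apply: eq_bigr => b _ /=.
  rewrite !mulr_sumr -!big_split !mulr_sumr !sum_lfunE; apply: eq_bigr => i _ /=.
  rewrite !mulr_sumr -!big_split !mulr_sumr !sum_lfunE; apply: eq_bigr => j _ /=.
  rewrite !appZ DE /P !dot_dlt /GRing.scale /=; ring.
apply: memvZ; do 4![apply: memv_suml => ? _]; exact: memvZ.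
Qed.

End Irreducibility.

Definition area h k : R := h 0 0 * k 1 0 - h 1 0 * k 0 0.

Lemma hermitian_area B : (forall h x k y, B (t h x) (t k y) = - B (t k x) (t h y)) ->
  forall h x k y, B (t h x) (t k y) = area h k * B (t (dlt R 0) x) (t (dlt R 1) y).
Proof.
move=> BH h x k y.
have B0 h' x' y' : B (t h' x') (t h' y') = 0.
  by have /eqP := BH h' x' h' y'; rewrite -subr_eq0 opprK -mulr2n mulrn_eq0 => /eqP.
rewrite bil_expandHl !(bil_expandH _ _ k) !B0 (BH (dlt R 1)) /area; ring.
Qed.

(** Hermitian means invariant under sl_2, and the invariant forms on R^2 are the multiples of the
    area. In coordinates, [J 1] makes e_0 and e_1 isotropic, and [J 0] relates the two mixed
    values. *)
Lemma mem_hermitian_frame B : B \in Defs.hermitian G <->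
  forall h x k y, B (t h x) (t k y) = - B (t k x) (t h y).
Proof.
rewrite Defs.mem_hermitian; split=> [BG h x k y|BH A X Y /(mem_G_gH F GJ)[m tm ->]].
  have BJ i h' x' k' y' : B (t (jmx R i *m h') x') (t k' y')
      = - B (t h' x') (t (jmx R i *m k') y').
    by rewrite -!(J_tau F); apply/BG/(J_in_G GJ).
  have j1 : jmx R 1 *m dlt R 0 = dlt R 0 /\ jmx R 1 *m dlt R 1 = - dlt R 1.
    by split; apply/colP; apply: ord2P; rewrite !mxE sum2E !mxE /=; ring.
  have j0 : jmx R 0 *m dlt R 0 = dlt R 1.
    by apply/colP; apply: ord2P; rewrite !mxE sum2E !mxE /=; ring.
  have two (r : R) : r = - r -> r = 0.
    by move/eqP; rewrite -subr_eq0 opprK -mulr2n mulrn_eq0 => /eqP.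
  have B00 x' y' : B (t (dlt R 0) x') (t (dlt R 0) y') = 0.
    by apply: two; have := BJ 1 (dlt R 0) x' (dlt R 0) y'; rewrite j1.1.
  have B11 x' y' : B (t (dlt R 1) x') (t (dlt R 1) y') = 0.
    apply: two; have := BJ 1 (dlt R 1) x' (dlt R 1) y'.
    by rewrite j1.2 -scaleN1r !tauZl !(homZ, appZ) !scaleN1r opprK => ->.
  have B10 x' y' : B (t (dlt R 1) x') (t (dlt R 0) y')
      = - B (t (dlt R 0) x') (t (dlt R 1) y').
    by have := BJ 0 (dlt R 0) x' (dlt R 0) y'; rewrite j0.
  rewrite (bil_expandHl _ _ h) !(bil_expandH _ _ k).
  by rewrite (bil_expandHl _ _ k) !(bil_expandH _ _ h) !B00 !B11 !B10; ring.
move: X; apply: (@frame_ind _ _ _ _ F) => [X X' H H'|h x].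
  by rewrite !homD !appD H H' opprD.
move: Y; apply: (@frame_ind _ _ _ _ F) => [Y Y' H H'|k y].
  by rewrite (homD (gH F m)) !(homD (B _)) H H' opprD.
rewrite !gH_tau (hermitian_area BH) (hermitian_area BH h) /area !mxE !sum2E.
move: tm => /eqP; rewrite addr_eq0 => /eqP ->; ring.
Qed.

(** By [casimir], the projector is the antisymmetrization in the factor R^2. *)
Lemma Pi_frame B h x k y : Pi J B (t h x) (t k y) =
  2%:R^-1 * (B (t h x) (t k y) - B (t k x) (t h y)).
Proof.
rewrite PiE (eq_bigr (fun i => eps R i * B (t (jmx R i *m h) x) (t (jmx R i *m k) y))).
  have := @casimir R R^o (fun h k => B (t h x) (t k y)) h k.
  rewrite /GRing.scale /= => ->; first by field.
  - by move=> k' a u v; rewrite !(homD, homZ, appD, appZ) ?(homD, homZ, appD, appZ).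
  - by move=> k' a u v; rewrite !(homD, homZ, appD, appZ) ?(homD, homZ, appD, appZ).
by move=> i _; rewrite !(J_tau F).
Qed.

Lemma symmetric_frame c B :
  (forall h x k y, B (t h x) (t k y) = c * B (t k y) (t h x)) ->
  forall X Y, B X Y = c * B Y X.
Proof.
move=> H X Y; move: X; apply: (@frame_ind _ _ _ _ F) => [X X' H1 H2|h x].
  by rewrite !homD appD H1 H2 mulrDr.
move: Y; apply: (@frame_ind _ _ _ _ F) => [Y Y' H1 H2|k y].
  by rewrite !homD appD H1 H2 mulrDr.
exact: H.
Qed.

Lemma btype_sym s e B : btype s e B -> forall X Y, B X Y = (s * e) * B Y X.
Proof.
move=> Bse; apply: symmetric_frame => h x k y.
by have [-> _] := Bse h x k y; have [_ ->] := Bse k x h y; rewrite mulrA.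
Qed.

Lemma mem_S2h B : B \in S2h G <-> btype (- 1) (- 1) B.
Proof.
rewrite memv_cap; split=> [/andP[/mem_S2 BS /mem_hermitian_frame BH] h x k y|Bse].
  by rewrite BH !mulN1r; split=> //; rewrite BS -BH BS.
apply/andP; split; first by apply/mem_S2 => X Y; rewrite (btype_sym Bse); ring.
by apply/mem_hermitian_frame => h x k y; have [-> _] := Bse h x k y; ring.
Qed.

Lemma mem_L2h B : B \in L2h G <-> btype (- 1) 1 B.
Proof.
rewrite memv_cap; split=> [/andP[/mem_L2 BS /mem_hermitian_frame BH] h x k y|Bse].
  by rewrite BH mulN1r mul1r; split=> //; rewrite BS opprK.
apply/andP; split; first by apply/mem_L2 => X Y; rewrite (btype_sym Bse); ring.
by apply/mem_hermitian_frame => h x k y; have [-> _] := Bse h x k y; ring.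
Qed.

Lemma mix_btype c B : (forall X Y, B X Y = c * B Y X) ->
  btype 1 c ((\1 - Pi J)%VF B).
Proof.
move=> BS h x k y; rewrite appB id_lfunE !appB !Pi_frame.
by rewrite (BS (t h x) (t k y)) (BS (t k x) (t h y)); split; field.
Qed.

Lemma btype_mix c B : btype 1 c B -> (\1 - Pi J)%VF B = B.
Proof.
move=> Bse; apply: (@bil_frame_ext _ _ _ _ F) => h x k y.
rewrite appB id_lfunE !appB Pi_frame.
by have [-> _] := Bse k x h y; field.
Qed.

Lemma mem_S2mix B : B \in S2mix J <-> btype 1 1 B.
Proof.
split=> [/memv_imgP[B' /mem_S2 BS ->]|Bse].
  by apply: mix_btype => X Y; rewrite mul1r.
rewrite -(btype_mix Bse); apply/memv_img/mem_S2 => X Y.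
by rewrite (btype_sym Bse) !mul1r.
Qed.

Lemma mem_L2mix B : B \in L2mix J <-> btype 1 (- 1) B.
Proof.
split=> [/memv_imgP[B' /mem_L2 BS ->]|Bse].
  by apply: mix_btype => X Y; rewrite mulN1r.
rewrite -(btype_mix Bse); apply/memv_img/mem_L2 => X Y.
by rewrite (btype_sym Bse) mul1r mulN1r.
Qed.

End BilinearFormModules.

(** * The sl_2 and gl_N components of a curvature tensor *)

Section CurvatureBlocks.
Variables (R : realType) (V : vectType R) (J : 'I_3 -> 'End(V)) (N : nat).
Variables (F : frame J N) (G : {vspace 'End(V)}).
Hypothesis GJ : corresponds G J.
Hypothesis N_gt0 : (0 < N)%N.
Local Notation t := (tau F).
Local Notation e a := (dlt R a).
Implicit Types (h k l : 'cV[R]_2) (x y z : 'cV[R]_N) (m : 'M[R]_2) (M : 'M[R]_N).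
Implicit Types (A : 'End(V)) (S : Tens V) (X Y Z : V) (a b c d : 'I_2).

Lemma gH0 : gH F 0 = 0.
Proof. by rewrite -[X in gH F X](scale0r 0) gHZ scale0r. Qed.

Lemma gE0 : gE F 0 = 0.
Proof. by rewrite -[X in gE F X](scale0r 0) gEZ scale0r. Qed.

(** The partial trace of A over R^N, corrected by the share of the gl_N component. It is defined for
    every A, so linearity needs no choice of a decomposition; on the normalizer it reads the entries
    of the sl_2 component. *)
Definition hpart A c d : R :=
  N%:R^-1 * ctr (fun x => cmp F c (A (t (e d) x)))
  - (c == d)%:R * ((2 * N)%:R^-1 * trace A).

Definition epart A z : 'cV[R]_N := cmp F 0 (A (t (e 0) z)) - hpart A 0 0 *: z.

Lemma cmp_gH a m d x : cmp F a (gH F m (t (e d) x)) = m a d *: x.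
Proof. by rewrite gH_tau cmp_tau -colE mxE. Qed.

Lemma cmp_gE a M d x : cmp F a (gE F M (t (e d) x)) = (a == d)%:R *: (M *m x).
Proof. by rewrite gE_tau cmp_tau dltE. Qed.

Lemma parts_gHE m M : m 0 0 + m 1 1 = 0 ->
  (forall c d, hpart (gH F m + gE F M) c d = m c d) /\
  forall z, epart (gH F m + gE F M) z = M *m z.
Proof.
move=> tm; set A := gH F m + gE F M.
have cE c d : ctr (fun x => cmp F c (A (t (e d) x)))
    = m c d * N%:R + (c == d)%:R * ctr (mulmx M).
  rewrite -ctr_scal -ctrZ -ctrD; congr ctr; apply: funext => x.
  by rewrite appD homD cmp_gH cmp_gE.
have tA : trace A = 2%:R * ctr (mulmx M).
  rewrite (frame_traceE F) sum2E !cE !eqxx !mul1r.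
  by rewrite addrACA -mulrDl tm; ring.
have N0 : (N%:R : R) != 0 by rewrite pnatr_eq0 -lt0n.
have hE c d : hpart A c d = m c d.
  rewrite /hpart cE tA natrM; field; exact: N0.
split=> // z; rewrite /epart hE appD homD cmp_gH cmp_gE eqxx scale1r; vring.
Qed.

Lemma hpart_linear c d : linear ((fun A => hpart A c d) : _ -> R^o).
Proof.
move=> r A A'; rewrite /hpart trace_linear.
have -> : ctr (fun x => cmp F c ((r *: A + A') (t (e d) x)))
    = r * ctr (fun x => cmp F c (A (t (e d) x))) + ctr (fun x => cmp F c (A' (t (e d) x))).
  rewrite -ctrZ -ctrD; congr ctr; apply: funext => x.
  by rewrite appD appZ homD homZ.
by rewrite /GRing.scale /=; ring.
Qed.

Lemma hpartN A c d : hpart (- A) c d = - hpart A c d.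
Proof.
have := hpart_linear c d (- 1) A 0; rewrite addr0 scaleN1r => ->.
have := hpart_linear c d (- 1) 0 0; rewrite scaler0 addr0 => ->.
by rewrite /GRing.scale /=; ring.
Qed.

Lemma epartN A z : epart (- A) z = - epart A z.
Proof. by rewrite /epart hpartN appN homN; vring. Qed.

Lemma normalizer_hpart A : A \in normalizer G ->
  (hpart A 0 0 + hpart A 1 1 = 0) *
  (forall d z c, cmp F d (A (t (e c) z)) = (d == c)%:R *: epart A z + hpart A d c *: z).
Proof.
move=> /(normalizer_traceless F GJ)[m [M [tm ->]]].
have [hE eE] := parts_gHE M tm; split; first by rewrite !hE.
by move=> d z c; rewrite hE eE appD homD cmp_gH cmp_gE addrC.
Qed.

Lemma cmp_ext X Y : (forall a, cmp F a X = cmp F a Y) -> X = Y.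
Proof.
by move=> H; rewrite (frameK F X) (frameK F Y); apply: eq_bigr => a _; rewrite H.
Qed.

Definition hform S a b x y c d := hpart (S (t (e a) x) (t (e b) y)) c d.
Definition eform S a b x y z := epart (S (t (e a) x) (t (e b) y)) z.

Section BianchiIdentities.
Variable S : Tens V.
Hypothesis Sc : S \in curv (normalizer G).

Let SG X Y : S X Y \in normalizer G.
Proof. by have /mem_curv[] := Sc. Qed.
Let SC X Y : S X Y = - S Y X.
Proof. by have /mem_curv[] := Sc. Qed.
Let SB X Y Z : S X Y Z + S Y Z X + S Z X Y = 0.
Proof. by have /mem_curv[] := Sc. Qed.

Lemma cmp_curv a b c d x y z :
  cmp F d (S (t (e a) x) (t (e b) y) (t (e c) z)) =
  (d == c)%:R *: eform S a b x y z + hform S a b x y d c *: z.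
Proof. by rewrite normalizer_hpart. Qed.

Lemma hformC a b c d x y : hform S a b x y c d = - hform S b a y x c d.
Proof. by rewrite /hform SC hpartN. Qed.

Lemma eformC a b x y z : eform S a b x y z = - eform S b a y x z.
Proof. by rewrite /eform SC epartN. Qed.

Lemma hform_coordwise a b c d y : coordwise (fun x => hform S a b x y c d).
Proof.
apply: linear_coordwise => r x x'.
by rewrite /hform tauDr tauZr homD homZ appD appZ hpart_linear.
Qed.

Lemma hform_trace a b x y : hform S a b x y 0 0 + hform S a b x y 1 1 = 0.
Proof. by rewrite /hform normalizer_hpart. Qed.

Lemma hform_bianchi a b c d x y z :
  (d == c)%:R *: eform S a b x y z + hform S a b x y d c *: z
  + ((d == a)%:R *: eform S b c y z x + hform S b c y z d a *: x)
  + ((d == b)%:R *: eform S c a z x y + hform S c a z x d b *: y) = 0.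
Proof. by rewrite -!cmp_curv -!homD SB hom0. Qed.

Lemma Ric_hform b c y z : Ric V S (t (e b) y) (t (e c) z) =
  ctr (fun x => eform S c b x y z) + \sum_(d < 2) hform S d b z y d c.
Proof.
rewrite (Ric_frame F) (eq_bigr (fun d : 'I_2 =>
  (d == c)%:R * ctr (fun x => eform S c b x y z) + hform S d b z y d c)).
  rewrite big_split /=; congr (_ + _).
  by rewrite -[RHS](sum_dlt (fun=> ctr (fun x => eform S c b x y z)) c).
move=> d _; rewrite -(ctr_rank1 z (hform_coordwise d b d c y)).
have [->|dc] := eqVneq d c.
  rewrite mul1r -ctrD; congr ctr; apply: funext => x.
  by rewrite cmp_curv eqxx scale1r.
rewrite mul0r add0r; congr ctr; apply: funext => x.
by rewrite cmp_curv (negPf dc) scale0r add0r.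
Qed.

Hypothesis RicS : Ric V S = 0.

Let ric0 b c y z :
  ctr (fun x => eform S c b x y z) + \sum_(d < 2) hform S d b z y d c = 0.
Proof. by rewrite -Ric_hform RicS !app0. Qed.

Lemma weyl_hform : N != 2%N -> forall a b c d x y, hform S a b x y c d = 0.
Proof.
exact: (bianchi_zero N_gt0 hform_coordwise hformC eformC hform_trace hform_bianchi ric0).
Qed.

(** By the symmetry in [bianchi_two], the three coefficients are values of one and the same
    alternating form, to which [cyclic_area] applies. *)
Lemma weyl_hform2 : N = 2%N -> forall a b c d x y z,
  hform S a b x y d c *: z + hform S b c y z d a *: x + hform S c a z x d b *: y = 0.
Proof.
move=> N2 a b c d x y z.
have H := bianchi_two N_gt0 hform_coordwise hformC eformC hform_trace hform_bianchi ric0 N2.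
rewrite -(H a b c d y z).1 (H c a b d z x).1.
apply: (cyclic_area N2 (h := fun x y => hform S a b x y d c)) => [u|u v].
  move=> v; rewrite (H a b c d u v).2 -hform_coordwise -sumrN.
  by apply: eq_bigr => i _; rewrite (H a b c d u _).2 mulrN.
by rewrite (H a b c d u v).2.
Qed.

End BianchiIdentities.

Definition hmx A : 'M[R]_2 := \matrix_(c, d) hpart A c d.

Lemma gH_hmx_linear : linear (fun A => gH F (hmx A)).
Proof.
move=> r A A'; rewrite -gHZ -gHD; congr gH.
by apply/matrixP => c d; rewrite !mxE hpart_linear.
Qed.

Lemma gH_hmx_gHE m M : m 0 0 + m 1 1 = 0 -> gH F (hmx (gH F m + gE F M)) = gH F m.
Proof.
move=> tm; congr gH; apply/matrixP => c d.
by rewrite mxE (parts_gHE M tm).1.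
Qed.

Lemma sub_hmx_centralizer A : A \in normalizer G -> A - gH F (hmx A) \in centralizer G.
Proof.
move=> /(normalizer_traceless F GJ)[m [M [tm ->]]].
rewrite gH_hmx_gHE // addrC addKr; apply/(mem_centralizer_gE F GJ); by exists M.
Qed.

Lemma weyl_centralizer S : N != 2%N -> S \in weyl G -> S \in curv (centralizer G).
Proof.
move=> N2; rewrite memv_cap memv_ker => /andP[/eqP S0 Sc].
have /mem_curv[SG SC SB] := Sc; apply/mem_curv; split=> // X Y.
suff h0 : hmx (S X Y) = 0.
  have := sub_hmx_centralizer (SG X Y).
  by rewrite h0 gH0 subr0.
apply/matrixP => c d; rewrite !mxE; move: X; apply: (@frame_ind_dlt _ _ _ _ F) => [X X' H H'|a x].
  by rewrite homD appD -[S X Y]scale1r hpart_linear H H' scaler0 addr0.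
move: Y; apply: (@frame_ind_dlt _ _ _ _ F) => [Y Y' H H'|b y].
  by rewrite homD -[S _ Y]scale1r hpart_linear H H' scaler0 addr0.
exact: (weyl_hform Sc S0 N2).
Qed.

Definition hcurv S : Tens V := bilinfun (fun X Y => gH F (hmx (S X Y))).

Lemma hcurvE S X Y : hcurv S X Y = gH F (hmx (S X Y)).
Proof.
rewrite /hcurv bilinfunE // => [X' r Y1 Y2|Y' r X1 X2].
  by rewrite homD homZ gH_hmx_linear.
by rewrite homD homZ appD appZ gH_hmx_linear.
Qed.

Lemma weyl_split S : N = 2%N -> S \in weyl G ->
  hcurv S \in curv G /\ S - hcurv S \in curv (centralizer G).
Proof.
move=> N2; rewrite memv_cap memv_ker => /andP[/eqP S0 Sc].
have /mem_curv[SG SC SB] := Sc.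
have hC X Y : hcurv S X Y = - hcurv S Y X.
  rewrite !hcurvE SC -[RHS]scaleN1r -gHZ; congr gH; apply/matrixP => c d.
  by rewrite !mxE hpartN mulN1r.
have hB X Y Z : hcurv S X Y Z + hcurv S Y Z X + hcurv S Z X Y = 0.
  move: X Y Z; apply: (bianchi_dlt (F := F)) => a x b y c z.
  rewrite !hcurvE; apply: cmp_ext => d; rewrite !homD hom0 !cmp_gH !mxE.
  exact: (weyl_hform2 Sc S0 N2).
split; apply/mem_curv; split=> // X Y.
- rewrite hcurvE; apply/(mem_G_gH F GJ); exists (hmx (S X Y)) => //.
  by rewrite !mxE (normalizer_hpart (SG X Y)).1.
- by rewrite !appB hcurvE sub_hmx_centralizer.
- by rewrite !appB hC SC opprD.
move=> Z; rewrite !appB.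
have -> : forall u v w u' v' w' : V, u - u' + (v - v') + (w - w') = (u + v + w) - (u' + v' + w').
  by move=> *; vring.
by rewrite SB hB subr0.
Qed.

(** Contracting the Bianchi identity over x gives [key], where the coefficient N - 1 is 1. Then
    [key] turns the two terms of the Ricci tensor into the trace of an element of sl_2. *)
Lemma curvG_Ric S : N = 2%N -> S \in curv G -> Ric V S = 0.
Proof.
move=> N2 SG'; have Sc : S \in curv (normalizer G).
  by apply: (subvP (curvS (sub_normalizer F GJ))).
have E0 a b x y z : eform S a b x y z = 0.
  have /mem_curv[/(_ (t (e a) x) (t (e b) y)) /(mem_G_gH F GJ)[m tm E] _ _] := SG'.
  rewrite /eform E -[gH F m]addr0 -gE0.
  by rewrite (parts_gHE _ tm).2 mul0mx.
have hB := hform_bianchi Sc; have ht := hform_trace Sc.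
have n2 : N%:R = 2%:R :> R by rewrite N2.
have key b c d y z : c != b -> hform S b b z y d c = hform S c b z y d b.
  move=> cb; have := ctr_eq0 (fun x => hB b b c d x y z).
  rewrite (_ : (fun x => _) = fun x => hform S b b x y d c *: z
     + hform S b c y z d b *: x + - (hform S b c x z d b *: y)); last first.
    by apply: funext => x; rewrite !E0 !scaler0 !add0r (hformC Sc c b) scaleNr.
  rewrite !ctrD ctrN ctr_scal !(ctr_rank1 _ (hform_coordwise _ _ _ _ _ _)) n2.
  by rewrite (hformC Sc c b) => H; apply: subr0_eq; rewrite -[RHS]H; ring.
apply: (@bil_frame_ext _ _ _ _ F) => k y l z; rewrite !app0.
have ric0 b c : forall y z, Ric V S (t (e b) y) (t (e c) z) = 0.
  move=> y' z'; rewrite (Ric_hform Sc) ctr_eq0 ?add0r => [|x]; last by rewrite E0.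
  move: b c; apply: ord2P; apply: ord2P; rewrite sum2E.
  - by rewrite -(key 0 1 1) ?ht.
  - by rewrite (key 0 1 0) ?ht.
  - by rewrite (key 1 0 1) ?ht.
  - by rewrite -(key 1 0 0) ?ht.
rewrite -(bil_tau_coordHl F) big1 // => b _; rewrite -(bil_tau_coordH F) big1 ?mulr0 // => c _.
by rewrite ric0 mulr0.
Qed.

End CurvatureBlocks.

(** * Curvature tensors with values in the centralizer *)

Section CentralizerCurvature.
Variables (R : realType) (V : vectType R) (J : 'I_3 -> 'End(V)) (N : nat).
Variables (F : frame J N) (G : {vspace 'End(V)}).
Hypothesis GJ : corresponds G J.
Hypothesis N_gt0 : (0 < N)%N.
Local Notation t := (tau F).
Local Notation e a := (dlt R a).
Local Notation E := 'cV[R]_N.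
Implicit Types (h k l : 'cV[R]_2) (x y z : E) (m : 'M[R]_2) (M : 'M[R]_N).
Implicit Types (A : 'End(V)) (S : Tens V) (X Y Z : V) (T : E -> E -> E -> E).

Definition fun_mx (f : E -> E) : 'M[R]_N := \matrix_(i, j) f (dlt R j) i 0.

Lemma fun_mxE f x : linear f -> fun_mx f *m x = f x.
Proof.
move=> fL; rewrite (linear_expand fL); apply/colP => i.
by rewrite mxE summxE; apply: eq_bigr => j _; rewrite !mxE mulrC.
Qed.

Lemma fun_mx_linear r f g : fun_mx (fun x => r *: f x + g x) = r *: fun_mx f + fun_mx g.
Proof. by apply/matrixP => i j; rewrite !mxE. Qed.

(** The tensor prescribed by [of_form], with the area of R^2 written out in the components of X and
    Y. *)
Definition sym_curv T : Tens V := bilinfun (fun X Y =>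
  gE F (fun_mx (T (cmp F 0 X) (cmp F 1 Y)))
  - gE F (fun_mx (T (cmp F 1 X) (cmp F 0 Y)))).

Definition of_form S T :=
  forall h x k y l z, S (t h x) (t k y) (t l z) = area h k *: t l (T x y z).

Lemma sym_curvE T X Y : symmetric3 T -> sym_curv T X Y =
  gE F (fun_mx (T (cmp F 0 X) (cmp F 1 Y)))
  - gE F (fun_mx (T (cmp F 1 X) (cmp F 0 Y))).
Proof.
move=> Ts; have Tl := symmetric3_linr Ts; rewrite /sym_curv bilinfunE // => [X' r Y1 Y2|Y' r X1 X2].
  rewrite !homD !homZ.
  have H u : fun_mx (T u (r *: cmp F 1 Y1 + cmp F 1 Y2)) =
      r *: fun_mx (T u (cmp F 1 Y1)) + fun_mx (T u (cmp F 1 Y2)).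
    by rewrite -fun_mx_linear; congr fun_mx; apply: funext => z; rewrite Tl.
  have H' u : fun_mx (T u (r *: cmp F 0 Y1 + cmp F 0 Y2)) =
      r *: fun_mx (T u (cmp F 0 Y1)) + fun_mx (T u (cmp F 0 Y2)).
    by rewrite -fun_mx_linear; congr fun_mx; apply: funext => z; rewrite Tl.
  by rewrite H H' !gED !gEZ; vring.
rewrite !homD !homZ.
have H u a : fun_mx (T (r *: cmp F a X1 + cmp F a X2) u) =
    r *: fun_mx (T (cmp F a X1) u) + fun_mx (T (cmp F a X2) u).
  by rewrite -fun_mx_linear; congr fun_mx; apply: funext => z; rewrite (sym3_lin Ts).
by rewrite !H !gED !gEZ; vring.
Qed.

Lemma sym_curv_form T : symmetric3 T -> of_form (sym_curv T) T.
Proof.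
move=> Ts h x k y l z; have Tl := symmetric3_linr Ts; rewrite sym_curvE //.
have T3 u v : linear (T u v) by move=> r w w'; rewrite Tl.
rewrite appB !gE_tau !fun_mxE // !cmp_tau.
have Z1 r u v w : T (r *: u) v w = r *: T u v w.
  have := sym3_lin Ts r u 0 v w; have := sym3_lin Ts (- 1) 0 0 v w.
  by rewrite scaler0 !addr0 scaleN1r addNr => -> ->; rewrite addr0.
have Z2 r u v w : T u (r *: v) w = r *: T u v w.
  by rewrite (sym3_12 Ts) Z1 (sym3_12 Ts).
by rewrite !Z1 !Z2 !tauZr /area; vring.
Qed.

Lemma areaC h k : area h k = - area k h.
Proof. by rewrite /area; ring. Qed.

Lemma area_jacobi h k l : area h k *: l + area k l *: h + area l h *: k = 0.
Proof. by apply/colP; apply: ord2P; rewrite /area !mxE; ring. Qed.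

Lemma form_bianchi S T : symmetric3 T -> of_form S T ->
  forall X Y Z, S X Y Z + S Y Z X + S Z X Y = 0.
Proof.
move=> Ts ST; apply: (bianchi_frame (F := F)) => h x k y l z; rewrite !ST.
rewrite (sym3_23 Ts y z x) (sym3_12 Ts y x z) (sym3_12 Ts z x y) (sym3_23 Ts x z y).
rewrite -!tauZl -!tauDl area_jacobi -(scale0r 0) tauZl scale0r //.
Qed.

Lemma form_antisym S T : symmetric3 T -> of_form S T -> forall X Y, S X Y = - S Y X.
Proof.
move=> Ts ST X Y; apply: (@frame_ext _ _ _ _ F) => l z; rewrite appN.
move: X; apply: (@frame_ind _ _ _ _ F) => [X X' H H'|h x].
  by rewrite (homD S) (homD (S Y)) !appD H H' opprD.
move: Y; apply: (@frame_ind _ _ _ _ F) => [Y Y' H H'|k y].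
  by rewrite (homD S) (homD (S _)) !appD H H' opprD.
by rewrite !ST areaC (sym3_12 Ts) scaleNr.
Qed.

Lemma form_trace S T h x k y : of_form S T ->
  trace (S (t h x) (t k y)) = 2%:R * area h k * ctr (T x y).
Proof.
move=> ST; rewrite (frame_traceE F) sum2E.
have H a : ctr (fun z => cmp F a (S (t h x) (t k y) (t (e a) z)))
    = area h k * ctr (T x y).
  rewrite -ctrZ; congr ctr; apply: funext => z.
  by rewrite ST homZ cmp_tau dltE eqxx scale1r.
by rewrite !H; ring.
Qed.

Lemma form_Ric S T k y l z : symmetric3 T -> of_form S T ->
  Ric V S (t k y) (t l z) = area l k * ctr (T y z).
Proof.
move=> Ts ST; rewrite (Ric_frame F) sum2E.
have H a : ctr (fun x => cmp F a (S (t (e a) x) (t k y) (t l z)))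
    = (area (e a) k * l a 0) * ctr (T y z).
  rewrite -ctrZ; congr ctr; apply: funext => x.
  by rewrite ST homZ cmp_tau scalerA (sym3_12 Ts) (sym3_23 Ts).
by rewrite !H /area !dltE /=; ring.
Qed.

Lemma Ric_trace_free S T : symmetric3 T -> of_form S T -> Ric V S = 0 <-> trace_free T.
Proof.
move=> Ts ST; split=> [S0 y z|T0].
  have := form_Ric (e 1) y (e 0) z Ts ST; rewrite S0 !app0 /area !dltE /= => H.
  by rewrite [RHS]H; ring.
by apply: (@bil_frame_ext _ _ _ _ F) => k y l z; rewrite (form_Ric k y l z Ts ST) T0 mulr0 !app0.
Qed.

Lemma sym_curv_centralizer T : symmetric3 T -> sym_curv T \in curv (centralizer G).
Proof.
move=> Ts; apply/mem_curv; split=> [X Y||].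
- rewrite sym_curvE //; apply/(mem_centralizer_gE F GJ).
  by exists (fun_mx (T (cmp F 0 X) (cmp F 1 Y)) - fun_mx (T (cmp F 1 X) (cmp F 0 Y)));
     rewrite -[- fun_mx _]scaleN1r gED gEZ scaleN1r.
- exact: form_antisym (sym_curv_form Ts).
- exact: form_bianchi (sym_curv_form Ts).
Qed.

(** Without an sl_2 component, the Bianchi identity kills A 0 0 and A 1 1 and makes A 0 1 invariant
    under two transpositions of its arguments, hence totally symmetric. *)
Lemma centralizer_curv_form S : S \in curv (centralizer G) ->
  exists2 T, symmetric3 T & of_form S T.
Proof.
move=> Sh; have Sc : S \in curv (normalizer G).
  by apply: (subvP (curvS (centralizer_normalizer F GJ))).
have h0 a b c d x y : hform F S a b x y c d = 0.
  have /mem_curv[/(_ (t (e a) x) (t (e b) y)) /(mem_centralizer_gE F GJ)[M E0] _ _] := Sh.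
  rewrite /hform E0 -[gE F M]add0r -(gH0 F).
  by rewrite (parts_gHE F N_gt0 _ _).1 ?mxE ?addr0.
pose A a b x y z := eform F S a b x y z.
have B a b c d x y z : (d == c)%:R *: A a b x y z + (d == a)%:R *: A b c y z x
    + (d == b)%:R *: A c a z x y = 0.
  by have := hform_bianchi F GJ N_gt0 Sc a b c d x y z; rewrite !h0 !scale0r !addr0.
have AC a b x y z : A a b x y z = - A b a y x z by exact: eformC Sc _ _ _ _ _.
have A00 x y z : A 0 0 x y z = 0.
  by have := B 0 0 1 1 x y z; rewrite /= scale1r !scale0r !addr0.
have A11 x y z : A 1 1 x y z = 0.
  by have := B 1 1 0 0 x y z; rewrite /= scale1r !scale0r !addr0.
have T13 x y z : A 0 1 x y z = A 0 1 z y x.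
  have := B 0 0 1 0 z x y; rewrite /= !scale1r !scale0r !add0r (AC 1 0).
  by move/eqP; rewrite subr_eq0 => /eqP.
have T23 x y z : A 0 1 x y z = A 0 1 x z y.
  have := B 1 1 0 1 y z x; rewrite /= !scale1r !scale0r !add0r (AC 1 0) addrC.
  by move/eqP; rewrite subr_eq0 => /eqP.
have Tl r x y z z' : A 0 1 x y (r *: z + z') = r *: A 0 1 x y z + A 0 1 x y z'.
  by rewrite /A /eform /epart !(tauDr, tauZr) !(homD, homZ); vring.
exists (A 0 1).
  split=> // [r x x' y z|x y z].
    by rewrite T13 Tl T13 (T13 x').
  by rewrite T23 T13 T23.
have SE a b c x y z : S (t (e a) x) (t (e b) y) (t (e c) z) = t (e c) (A a b x y z).
  apply: (cmp_ext (F := F)) => d.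
  by rewrite (cmp_curv F GJ N_gt0 Sc) h0 scale0r addr0 cmp_tau dltE.
have E2 (u : 'cV[R]_2) : u = u 0 0 *: e 0 + u 1 0 *: e 1 by rewrite {1}(cvE u) sum2E.
move=> h x k y l z; rewrite {1}(E2 h) {1}(E2 k) {1}(E2 l).
rewrite !tauDl !tauZl (homD S) !(homZ S) !appD !appZ.
rewrite !(homD (S _)) !(homZ (S _)) !appD !appZ.
rewrite !(homD (S _ _)) !(homZ (S _ _)) !SE A00 A11 (AC 1 0).
rewrite (T23 y x z) (T13 y z x) (T23 x z y).
have t0 u : t u 0 = 0 by rewrite hom0.
have tN u v : t u (- v) = - t u v by rewrite homN.
have tl u : t l u = l 0 0 *: t (e 0) u + l 1 0 *: t (e 1) u.
  by rewrite {1}(E2 l) tauDl !tauZl.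
by rewrite !t0 !tN tl /area; vring.
Qed.

End CentralizerCurvature.

(** * Irreducibility of the curvature modules *)

Section Jacobi.
Variables (R : realType) (V : vectType R).
Implicit Types (L : {vspace 'End(V)}) (A B C : 'End(V)).

Lemma lie_jacobi A B C : lie (lie A B) C = lie A (lie B C) - lie B (lie A C).
Proof. by apply/lfunP => X; rewrite [RHS]appB !lieE !homB; vring. Qed.

Lemma lie_normalizer L A B :
  A \in normalizer L -> B \in normalizer L -> lie A B \in normalizer L.
Proof.
move=> /mem_normalizer LA /mem_normalizer LB; apply/mem_normalizer => C LC.
by rewrite lie_jacobi memvB ?LA ?LB ?LA ?LB.
Qed.

Lemma normalizer_normalizer L A : A \in normalizer L -> A \in normalizer (normalizer L).
Proof. by move=> LA; apply/mem_normalizer => B; apply: lie_normalizer. Qed.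

End Jacobi.

Section Modules.
Variables (R : realType) (V : vectType R) (J : 'I_3 -> 'End(V)) (N : nat).
Variables (F : frame J N) (G : {vspace 'End(V)}).
Hypothesis GJ : corresponds G J.
Local Notation t := (tau F).
Local Notation e a := (dlt R a).
Local Notation E := 'cV[R]_N.
Implicit Types (h k l : 'cV[R]_2) (x y z : E) (m : 'M[R]_2) (M : 'M[R]_N).
Implicit Types (A : 'End(V)) (S : Tens V) (B : Bil V) (X Y Z : V) (T : E -> E -> E -> E).

Lemma weyl_submodule : submodule (normalizer G) (weyl G).
Proof.
split; first exact: capvSr.
move=> A S GA; rewrite !memv_cap => /andP[]; rewrite !memv_ker => /eqP S0 Sc.
rewrite lie_act_curv ?normalizer_normalizer // andbT Ric_lie_act S0.
by apply/eqP; apply: bil_ext => X Y; rewrite bil_actE !app0 oppr0 addr0.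
Qed.

(** A nonzero tensor, trace-free for distinct i and j; it shows that W, and R(G') in dimension four,
    do not vanish. *)
Definition cube_tens (i j : 'I_N) x y z : E := (x i 0 * y i 0 * z i 0) *: e j.

Lemma cube_tens_sym i j : symmetric3 (cube_tens i j).
Proof. by split=> *; rewrite /cube_tens ?mxE; vring. Qed.

Lemma cube_tens_trace_free i j : i != j -> trace_free (cube_tens i j).
Proof.
move=> ij x y; apply: big1 => k _; rewrite /cube_tens !mxE eqxx andbT.
case: (eqVneq i k) => [<-|_]; last by rewrite mulr0 mul0r.
by rewrite (negPf ij) mulr0.
Qed.

Lemma sym_curv_cube_neq0 i j : sym_curv F (cube_tens i j) != 0.
Proof.
apply: contraTneq isT => S0.
have := sym_curv_form F (cube_tens_sym i j) (e 0) (e i) (e 1) (e i) (e 0) (e i).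
rewrite S0 !app0 /area /cube_tens !dltE !eqxx /= !mulr1 mul0r subr0 !scale1r.
move=> /(congr1 (cmp F 0)); rewrite hom0 cmp_tau dltE scale1r => H.
by have := dlt_neq0 R j; rewrite -H eqxx.
Qed.

Section Weyl.
Hypothesis N_gt2 : (2 < N)%N.
Let N_gt0 : (0 < N)%N. Proof. exact: leq_trans N_gt2. Qed.
Let N_neq2 : N != 2%N. Proof. by rewrite gtn_eqF. Qed.

Lemma weyl_form S : S \in weyl G -> exists T, [/\ symmetric3 T, trace_free T & of_form F S T].
Proof.
move=> SW; have Sh := weyl_centralizer F GJ N_gt0 N_neq2 SW.
have [T Ts ST] := centralizer_curv_form F GJ N_gt0 Sh.
exists T; split=> //; apply/(Ric_trace_free Ts ST).
by move: SW; rewrite memv_cap memv_ker => /andP[/eqP].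
Qed.

Lemma of_form_inj S S' T : of_form F S T -> of_form F S' T -> S = S'.
Proof. by move=> ST ST'; apply: (@tens_frame_ext _ _ _ _ F) => *; rewrite ST ST'. Qed.

Lemma weyl_irreducible : irreducible (normalizer G) (weyl G).
Proof.
split; first exact: weyl_submodule.
  pose i := Ordinal N_gt0; pose j : 'I_N := Ordinal (ltn_trans (isT : 1 < 2)%N N_gt2).
  apply: contraNneq (sym_curv_cube_neq0 i j) => W0; rewrite -memv0 -W0 memv_cap.
  have Ts := cube_tens_sym i j; have ST := sym_curv_form F Ts.
  rewrite memv_ker ((Ric_trace_free Ts ST).2 (cube_tens_trace_free _)) //= eqxx /=.
  apply: (subvP (curvS (centralizer_normalizer F GJ))).
  exact: sym_curv_centralizer.
move=> U [Uc UA] UW; have [->|U0] := eqVneq U 0%VS; [by left | right].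
apply/eqP; rewrite eqEsubv UW; apply/subvP => S SW.
have S1U := memv_pick U; have S10 : vpick U != 0 by rewrite vpick0.
move: (vpick U) S1U S10 => S1 S1U S10.
have [T1 [T1s T1t ST1]] := weyl_form (subvP UW _ S1U).
(* The submodule U read on symmetric tensors. Stability under rank one actions comes from the
   elements [gE] of the normalizer. *)
pose Q T := exists2 S, S \in U & of_form F S T.
have QT1 : Q T1 by exists S1.
have Qlin a T T' : Q T -> Q T' -> Q (fun x y z => a *: T x y z + T' x y z).
  move=> [S2 S2U H2] [S3 S3U H3]; exists (a *: S2 + S3); first by rewrite memvD ?memvZ.
  by move=> h x k y l z; rewrite !appD !appZ H2 H3 tauDr tauZr; vring.
have Qact v xi T : Q T -> Q (rank1_act v xi T).
  move=> [S2 S2U H2]; exists (lie_act (gE F (v *m xi)) S2).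
    by apply: UA S2U; exact: gE_normalizer.
  move=> h x k y l z; rewrite lie_actE !gE_tau !rank1_mul !tauZr.
  rewrite (homZ (S2 _ _)) (homZ S2) (homZ (S2 _)) !appZ !H2 homZ gE_tau rank1_mul.
  by rewrite /rank1_act -!scaleNr !(tauDr, tauZr); vring.
have Qtf T : Q T -> trace_free T.
  move=> [S2 S2U H2]; have [T2 [T2s T2t H2']] := weyl_form (subvP UW _ S2U).
  rewrite (_ : T = T2) //; apply: funext => x; apply: funext => y; apply: funext => z.
  have := H2 (e 0) x (e 1) y (e 0) z; rewrite H2' /area !dltE /= mulr1 mul0r subr0 !scale1r.
  by move/(tau_inj (dlt_neq0 _ _)).
have T10 : exists x y z, T1 x y z != 0.
  apply: contrapT => H; case/eqP: S10; apply: (@tens_frame_ext _ _ _ _ F) => h x k y l z.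
  rewrite ST1 !app0; have -> : T1 x y z = 0.
    by apply: contrapT => /eqP H0; apply: H; exists x, y, z.
  by rewrite hom0 scaler0.
have [T [Ts Tt ST]] := weyl_form SW.
have [S2 S2U H2] := symmetric3_irreducible Qlin Qact Qtf QT1 N_gt2 T1s T10 Ts Tt.
by rewrite (of_form_inj ST H2).
Qed.

End Weyl.

Lemma btype_act s c A B : A \in normalizer G ->
  btype F s c B -> btype F s c (bil_act A B).
Proof.
move=> /(mem_normalizer_gHE F GJ)[m [M ->]] Bse h x k y.
rewrite !bil_actE !appD !gH_tau !gE_tau !(homD B) !(homD (B _)) !appD.
split.
  have e1 u v w r := (Bse u v w r).1.
  rewrite (e1 (m *m h)) (e1 h (M *m x)) (e1 h x (m *m k)) (e1 h x k (M *m y)); ring.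
have e2 u v w r := (Bse u v w r).2.
rewrite (e2 (m *m h)) (e2 h (M *m x)) (e2 h x (m *m k)) (e2 h x k (M *m y)); ring.
Qed.

Lemma Ric_phi_btype s c B : s * s = 1 -> btype F s c B ->
  Ric V (phi J B) = (2%:R * (N%:R + 2%:R - s - c)) *: B.
Proof.
move=> ss Bse; apply: (@bil_frame_ext _ _ _ _ F) => k y l z.
rewrite Ric_phi !appZ /GRing.scale /= (Bse k z l y).2.
have -> : B (t l y) (t k z) = s * B (t k y) (t l z).
  by rewrite (Bse k y l z).1 mulrA ss mul1r.
ring.
Qed.

Hypothesis N_gt1 : (1 < N)%N.
Let N_gt0 : (0 < N)%N. Proof. exact: ltnW. Qed.

(** A number of square 1 is at most 1, so the second factor is at least N. *)
Lemma eigenvalue_neq0 s c : s * s = 1 -> c * c = 1 -> 2%:R * (N%:R + 2%:R - s - c) != 0 :> R.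
Proof.
move=> ss cc; rewrite mulf_neq0 ?pnatr_eq0 //.
have le1 r : r * r = 1 -> r <= 1 :> R by nra.
have N0 : 0 < N%:R :> R by rewrite ltr0n.
by rewrite gt_eqF //; have := le1 _ ss; have := le1 _ cc; lra.
Qed.

Lemma phi_btype_inj s c B : s * s = 1 -> c * c = 1 -> btype F s c B ->
  Ric V (phi J B) = 0 -> B = 0.
Proof.
move=> ss cc Bse; rewrite (Ric_phi_btype ss Bse) => /eqP; rewrite scaler_eq0.
by rewrite (negPf (eigenvalue_neq0 ss cc)) => /eqP.
Qed.

Lemma btype_neq0 s c : s * s = 1 -> c * c = 1 -> exists2 B, btype F s c B & B != 0.
Proof.
move=> ss cc; pose i := Ordinal N_gt0; pose j := Ordinal N_gt1.
(* Two distinct indices keep this nonzero also in the antisymmetric case c = -1; this is where N > 1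
   enters. *)
pose ef x y : R := x i 0 * y j 0 + c * (x j 0 * y i 0).
pose f X Y : R := ef (cmp F 0 X) (cmp F 1 Y) + s * ef (cmp F 1 X) (cmp F 0 Y).
pose B : Bil V := bilinfun (W := R^o) f.
have BE X Y : B X Y = f X Y.
  apply: bilinfunE => [X' r u v|Y' r u v];
    by rewrite /f /ef !(homD, homZ) !mxE /GRing.scale /=; ring.
have BF h x k y : B (t h x) (t k y) = (h 0 0 * k 1 0 + s * (h 1 0 * k 0 0)) * ef x y.
  by rewrite BE /f /ef !cmp_tau !mxE; ring.
exists B.
  move=> h x k y; rewrite !BF; split.
    have -> : s * ((k 0 0 * h 1 0 + s * (k 1 0 * h 0 0)) * ef x y)
        = (s * (k 0 0 * h 1 0) + (s * s) * (k 1 0 * h 0 0)) * ef x y by ring.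
    by rewrite ss; ring.
  rewrite /ef; have -> (r u v : R) : c * (r * (u + c * v)) = r * (c * u + (c * c) * v) by ring.
  by rewrite cc; ring.
apply: contraTneq isT => B0.
have /esym/eqP := BF (e 0) (e i) (e 1) (e j); rewrite B0 !app0 /ef !dltE.
by rewrite [X in X == 0](_ : _ = 1) ?oner_eq0 //=; ring.
Qed.

Lemma phi_irreducible s c (U : {vspace Bil V}) : s * s = 1 -> c * c = 1 ->
  (forall B, B \in U <-> btype F s c B) ->
  irreducible (normalizer G) (phi J @: U)%VS.
Proof.
move=> ss cc UE; split; first split.
- by apply/subvP => _ /memv_imgP[B _ ->]; exact: (phi_curv F GJ).
- move=> A _ GA /memv_imgP[B BU ->]; rewrite -(phi_equivariant F GJ) //.
  by apply/memv_img/UE/btype_act/UE.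
- have [B Bse B0] := btype_neq0 ss cc; apply: contraNneq B0 => U0.
  apply/eqP/(phi_btype_inj ss cc Bse).
  have : phi J B \in (phi J @: U)%VS by apply/memv_img/UE.
  by rewrite U0 memv0 => /eqP ->; rewrite hom0.
move=> U' [U'c U'A] U'U; have [->|U'0] := eqVneq U' 0%VS; [by left | right].
apply/eqP; rewrite eqEsubv U'U; apply/subvP => _ /memv_imgP[B BU ->].
have S1U := memv_pick U'; have S10 : vpick U' != 0 by rewrite vpick0.
have /memv_imgP[B1 B1U B1E] := subvP U'U _ S1U.
rewrite B1E in S1U S10.
have B10 : B1 != 0 by apply: contraNneq S10 => ->; rewrite hom0.
(* Equivariance of [phi] makes the preimage of U' stable under the normalizer, so irreducibility is
   decided on bilinear forms. *)
suff : B \in (phi J @^-1: U')%VS by rewrite memv_preim.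
apply: (@bil_irreducible _ _ _ _ F G GJ s c _ B1) => //.
- move=> A B' GA; rewrite -!memv_preim => H.
  by rewrite (phi_equivariant F GJ) // U'A.
- by rewrite -memv_preim.
- exact/UE.
- exact/UE.
Qed.

End Modules.

(** * The direct sum decompositions *)

Lemma proj_split (K : fieldType) (U : vectType K) (f : 'End(U)) u :
  f u + (\1 - f)%VF u = u.
Proof. by rewrite appB id_lfunE addrC subrK. Qed.

Section EigenSplitting.
Variables (K : fieldType) (U T : vectType K) (p : 'Hom(U, T)) (r : 'Hom(T, U)).
Variables (C : {vspace T}) (A1 A2 A3 A4 : {vspace U}) (c1 c2 c3 c4 : K).
Hypothesis pC : forall u, p u \in C.
Hypotheses (c1_neq0 : c1 != 0) (c2_neq0 : c2 != 0) (c3_neq0 : c3 != 0) (c4_neq0 : c4 != 0).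
Hypothesis E1 : forall u, u \in A1 -> r (p u) = c1 *: u.
Hypothesis E2 : forall u, u \in A2 -> r (p u) = c2 *: u.
Hypothesis E3 : forall u, u \in A3 -> r (p u) = c3 *: u.
Hypothesis E4 : forall u, u \in A4 -> r (p u) = c4 *: u.
Hypothesis A_full : forall u, exists u1 u2 u3 u4, [/\ u = u1 + u2 + u3 + u4,
  u1 \in A1, u2 \in A2, u3 \in A3 & u4 \in A4].
Hypothesis A_free : forall u1 u2 u3 u4,
  u1 \in A1 -> u2 \in A2 -> u3 \in A3 -> u4 \in A4 -> u1 + u2 + u3 + u4 = 0 ->
  [/\ u1 = 0, u2 = 0, u3 = 0 & u4 = 0].
Let W := (lker r :&: C)%VS.

(** Applying r kills w and leaves a relation between multiples of the b_i in U, where the four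
    summands are independent. All the intersections in [eigen_direct] reduce to this. *)
Let split0 w b1 b2 b3 b4 :
  w \in W -> b1 \in A1 -> b2 \in A2 -> b3 \in A3 -> b4 \in A4 ->
  w + p b1 + p b2 + p b3 + p b4 = 0 -> [/\ b1 = 0, b2 = 0, b3 = 0 & b4 = 0].
Proof.
rewrite memv_cap memv_ker => /andP[/eqP w0 _] H1 H2 H3 H4.
move=> /(congr1 r); rewrite hom0 !homD w0 add0r E1 // E2 // E3 // E4 //.
have nz c b : c != 0 -> c *: b = 0 -> b = 0 :> U.
  by move=> c0 /eqP; rewrite scaler_eq0 (negPf c0) => /eqP.
move=> H; have [] := A_free (memvZ c1 H1) (memvZ c2 H2) (memvZ c3 H3) (memvZ c4 H4) H.
by move=> /(nz _ _ c1_neq0) -> /(nz _ _ c2_neq0) -> /(nz _ _ c3_neq0) ->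
  /(nz _ _ c4_neq0) ->.
Qed.

(** Dividing the components of r S by the eigenvalues gives q in the image of p with r q = r S, so
    that S - q lies in the kernel. *)
Lemma eigen_decomposition : C = (W + p @: A1 + p @: A2 + p @: A3 + p @: A4)%VS.
Proof.
have sub A : (p @: A <= C)%VS by apply/subvP => _ /memv_imgP[u _ ->].
apply/eqP; rewrite eqEsubv !subv_add !sub capvSr !andbT; apply/subvP => S Sc.
have [b1 [b2 [b3 [b4 [rS H1 H2 H3 H4]]]]] := A_full (r S).
pose q := p (c1^-1 *: b1) + p (c2^-1 *: b2) + p (c3^-1 *: b3) + p (c4^-1 *: b4).
have rq : r q = r S.
  by rewrite /q !homD E1 ?memvZ // E2 ?memvZ // E3 ?memvZ // E4 ?memvZ //
    !scalerA !mulfV // !scale1r rS.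
have -> : S = (S - q) + p (c1^-1 *: b1) + p (c2^-1 *: b2) + p (c3^-1 *: b3)
    + p (c4^-1 *: b4) by rewrite -3!(addrA (S - q)) subrK.
do 4![apply: memv_add; last by rewrite memv_img ?memvZ].
by rewrite memv_cap memv_ker homB rq subrr eqxx /= memvB // /q !memvD.
Qed.

Lemma eigen_direct : directv (W + p @: A1 + p @: A2 + p @: A3 + p @: A4).
Proof.
have z0 (A : {vspace U}) : 0 \in A by exact: mem0v.
rewrite !directv_addE /= !directvE /= !eqxx /= -!subv0.
rewrite -!andbA; apply/and4P; split; apply/subvP => S; rewrite memv_cap memv0 => /andP[].
- move=> WS /memv_imgP[b Hb E]; move: WS; rewrite E => WS.
  have [] := @split0 (p b) (- b) 0 0 0 WS _ (z0 _) (z0 _) (z0 _).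
  + by rewrite memvN.
  + by rewrite homN !hom0 subrr !addr0.
  by move/eqP; rewrite oppr_eq0 => /eqP -> _ _ _; rewrite hom0.
- move=> /memv_addP[w Hw [_ /memv_imgP[b1 H1 ->] E']] /memv_imgP[b Hb E].
  have [] := @split0 w b1 (- b) 0 0 Hw H1 _ (z0 _) (z0 _).
  + by rewrite memvN.
  + by rewrite homN !hom0 -E' E subrr !addr0.
  by move=> _ /eqP; rewrite oppr_eq0 E => /eqP -> _ _; rewrite hom0.
- move=> /memv_addP[_ /memv_addP[w Hw [_ /memv_imgP[b1 H1 ->] ->]]
    [_ /memv_imgP[b2 H2 ->] E']] /memv_imgP[b Hb E].
  have [] := @split0 w b1 b2 (- b) 0 Hw H1 H2 _ (z0 _).
  + by rewrite memvN.
  + by rewrite homN !hom0 -E' E subrr !addr0.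
  by move=> _ _ /eqP; rewrite oppr_eq0 E => /eqP -> _; rewrite hom0.
move=> /memv_addP[_ /memv_addP[_ /memv_addP[w Hw [_ /memv_imgP[b1 H1 ->] ->]]
    [_ /memv_imgP[b2 H2 ->] ->]] [_ /memv_imgP[b3 H3 ->] E']] /memv_imgP[b Hb E].
have [] := @split0 w b1 b2 b3 (- b) Hw H1 H2 H3 _.
+ by rewrite memvN.
+ by rewrite homN -E' E subrr.
by move=> _ _ _ /eqP; rewrite oppr_eq0 E => /eqP ->; rewrite hom0.
Qed.

End EigenSplitting.

Section Decomposition.
Variables (R : realType) (V : vectType R) (J : 'I_3 -> 'End(V)) (N : nat).
Variables (F : frame J N) (G : {vspace 'End(V)}).
Hypothesis GJ : corresponds G J.
Hypothesis N_gt1 : (1 < N)%N.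
Local Notation t := (tau F).
Local Notation e a := (dlt R a).
Implicit Types (h k l : 'cV[R]_2) (x y z : 'cV[R]_N) (m : 'M[R]_2) (M : 'M[R]_N).
Implicit Types (A : 'End(V)) (S : Tens V) (B : Bil V) (X Y Z : V).

Let N_gt0 : (0 < N)%N. Proof. exact: ltnW. Qed.

Let sq1 : 1 * 1 = 1 :> R. Proof. by rewrite mulr1. Qed.
Let sqN1 : - 1 * - 1 = 1 :> R. Proof. by rewrite mulrNN mulr1. Qed.

Lemma btypeZ s c a B : btype F s c B -> btype F s c (a *: B).
Proof.
move=> Bse h x k y; rewrite !appZ /GRing.scale /= -(mulrCA a) -(mulrCA a).
by have [<- <-] := Bse h x k y.
Qed.

(** Swapping the vectors of R^2, of R^N, or of both gives four equations whose coefficients are the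
    four sign characters of a product of two groups of order 2. *)
Lemma btypes_independent b1 b2 b3 b4 :
  btype F (- 1) (- 1) b1 -> btype F 1 1 b2 -> btype F (- 1) 1 b3 -> btype F 1 (- 1) b4 ->
  b1 + b2 + b3 + b4 = 0 -> [/\ b1 = 0, b2 = 0, b3 = 0 & b4 = 0].
Proof.
move=> H1 H2 H3 H4 b0.
have ev h x k y : [/\ b1 (t h x) (t k y) = 0, b2 (t h x) (t k y) = 0,
    b3 (t h x) (t k y) = 0 & b4 (t h x) (t k y) = 0].
  have E X Y : b1 X Y + b2 X Y + b3 X Y + b4 X Y = 0 by rewrite -!appD b0 !app0.
  have := E (t k y) (t h x); have := E (t h y) (t k x).
  have := E (t k x) (t h y); have := E (t h x) (t k y).
  rewrite (H1 k x h y).1 (H2 k x h y).1 (H3 k x h y).1 (H4 k x h y).1.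
  rewrite (H1 k y h x).1 (H2 k y h x).1 (H3 k y h x).1 (H4 k y h x).1.
  rewrite (H1 h y k x).2 (H2 h y k x).2 (H3 h y k x).2 (H4 h y k x).2.
  move: (b1 _ _) (b2 _ _) (b3 _ _) (b4 _ _) => u1 u2 u3 u4 *.
  by split; lra.
by split; apply: (@bil_frame_ext _ _ _ _ F) => h x k y; rewrite !app0;
  have [] := ev h x k y.
Qed.

Lemma Pi_btype c B : c * c = 1 -> (forall X Y, B X Y = c * B Y X) ->
  btype F (- 1) (- c) (Pi J B).
Proof.
move=> cc BS h x k y; rewrite !(Pi_frame F).
split; first by ring.
rewrite (BS (t h y)) (BS (t k y)).
have -> (u v : R) : - c * (2%:R^-1 * (c * u - c * v)) = (c * c) * (2%:R^-1 * (v - u)) by move=> *; ring.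
by rewrite cc; ring.
Qed.

Lemma bil_split B : exists b1 b2 b3 b4, [/\ B = b1 + b2 + b3 + b4,
  btype F (- 1) (- 1) b1, btype F 1 1 b2, btype F (- 1) 1 b3 & btype F 1 (- 1) b4].
Proof.
pose BT : Bil V := bilinfun (W := R^o) (fun X Y => B Y X).
have BTE X Y : BT X Y = B Y X.
  rewrite /BT bilinfunE // => [X' r u v|Y' r u v]; last by rewrite homD homZ.
  by rewrite homD homZ appD appZ.
have c2 : (2%:R : R) != 0 by rewrite pnatr_eq0.
pose Bs := 2%:R^-1 *: (B + BT); pose Ba := 2%:R^-1 *: (B - BT).
have BsS X Y : Bs X Y = 1 * Bs Y X.
  by rewrite mul1r /Bs !appZ !appD !BTE addrC.
have BaS X Y : Ba X Y = - 1 * Ba Y X.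
  by rewrite /Ba !appZ !appB !BTE /GRing.scale /=; ring.
exists (Pi J Bs), ((\1 - Pi J)%VF Bs), (Pi J Ba), ((\1 - Pi J)%VF Ba); split.
- rewrite proj_split -addrA proj_split.
  rewrite /Bs /Ba -scalerDr addrACA subrr addr0 -mulr2n -[B *+ 2]scaler_nat.
  by rewrite scalerA mulVf // scale1r.
- exact: Pi_btype.
- exact: mix_btype.
- by have := Pi_btype sqN1 BaS; rewrite opprK.
- exact: mix_btype.
Qed.

Let A_free b1 b2 b3 b4 :
  b1 \in S2h G -> b2 \in S2mix J -> b3 \in L2h G -> b4 \in L2mix J ->
  b1 + b2 + b3 + b4 = 0 -> [/\ b1 = 0, b2 = 0, b3 = 0 & b4 = 0].
Proof.
move=> /(mem_S2h F GJ) H1 /(mem_S2mix F) H2 /(mem_L2h F GJ) H3 /(mem_L2mix F) H4.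
exact: btypes_independent.
Qed.

Let A_full B : exists b1 b2 b3 b4, [/\ B = b1 + b2 + b3 + b4,
  b1 \in S2h G, b2 \in S2mix J, b3 \in L2h G & b4 \in L2mix J].
Proof.
have [b1 [b2 [b3 [b4 [E H1 H2 H3 H4]]]]] := bil_split B.
exists b1, b2, b3, b4; split=> //.
- exact/(mem_S2h F GJ).
- exact/(mem_S2mix F).
- exact/(mem_L2h F GJ).
- exact/(mem_L2mix F).
Qed.

Lemma curv_decomposition (W := weyl G) (RS2h := (phi J @: S2h G)%VS)
    (RS2mix := (phi J @: S2mix J)%VS) (RL2h := (phi J @: L2h G)%VS)
    (RL2mix := (phi J @: L2mix J)%VS) :
  curv (normalizer G) = (W + RS2h + RS2mix + RL2h + RL2mix)%VS /\
  directv (W + RS2h + RS2mix + RL2h + RL2mix).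
Proof.
have phic B : phi J B \in curv (normalizer G) by exact: (phi_curv F GJ).
have ev s c (U : {vspace Bil V}) : s * s = 1 -> (forall B, B \in U <-> btype F s c B) ->
    forall B, B \in U -> Ric V (phi J B) = (2%:R * (N%:R + 2%:R - s - c)) *: B.
  by move=> ss UE B /UE; exact: Ric_phi_btype.
have e1 := ev _ _ _ sqN1 (mem_S2h F GJ); have e2 := ev _ _ _ sq1 (mem_S2mix F).
have e3 := ev _ _ _ sqN1 (mem_L2h F GJ); have e4 := ev _ _ _ sq1 (mem_L2mix F).
have n1 := eigenvalue_neq0 N_gt1 sqN1 sqN1; have n2 := eigenvalue_neq0 N_gt1 sq1 sq1.
have n3 := eigenvalue_neq0 N_gt1 sqN1 sq1; have n4 := eigenvalue_neq0 N_gt1 sq1 sqN1.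
split; first exact: (eigen_decomposition phic n1 n2 n3 n4 e1 e2 e3 e4 A_full).
apply: (eigen_direct _ n1 n2 n3 n4 e1 e2 e3 e4 A_free).
Qed.

(** Here B is the area times a symmetric form on R^N. The terms of [phi_frame] that move l combine
    by [area_jacobi] into a multiple of l, so the gl_2 component is a scalar and can be counted in
    gl_N. *)
Lemma phi_L2h_centralizer B : B \in L2h G -> phi J B \in curv (centralizer G).
Proof.
move=> /(mem_L2h F GJ) Bse.
have /mem_curv[SG SC SB] := phi_curv F GJ B.
apply/mem_curv; split=> // X Y.
move: X; apply: (@frame_ind _ _ _ _ F) => [X X' HX HX'|h x]; first by rewrite homD appD memvD.
move: Y; apply: (@frame_ind _ _ _ _ F) => [Y Y' HY HY'|k y]; first by rewrite homD memvD.
apply/(mem_centralizer_gE F GJ).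
exists (2%:R *: (x *m fun_row (fun z => B (t k y) (t h z))
  - y *m fun_row (fun z => B (t h x) (t k z))
  - (area h k * B (t (e 0) x) (t (e 1) y))%:M)).
apply: (@frame_ext _ _ _ _ F) => l z; rewrite phi_frame gE_tau.
rewrite -scalemxAl !mulmxBl !rank1_mul mul_scalar_mx !dot_fun_row;
  try exact: bil_tau_coordE.
have BA h' x' k' y' : B (t h' x') (t k' y') = area h' k' * B (t (e 0) x') (t (e 1) y').
  by apply: hermitian_area => *; rewrite (Bse _ _ _ _).1 mulN1r.
have Bs x' y' : B (t (e 0) x') (t (e 1) y') = B (t (e 0) y') (t (e 1) x').
  by rewrite (Bse _ _ _ _).2 mul1r.
rewrite (BA k y l x) (BA h x l y) (Bs y x).
have H : t (area h k *: l + area k l *: h + area l h *: k) z = 0.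
  by rewrite area_jacobi -(scale0r 0) tauZl scale0r.
move: H; rewrite !tauDl !tauZl => H.
apply: subr0_eq; rewrite !tauZr -!scaleN1r !tauDr !tauZr (areaC h l).
transitivity ((2%:R * B (t (e 0) x) (t (e 1) y)) *: (area h k *: t l z + area k l *: t h z + area l h *: t k z)).
  by vring.
by rewrite H scaler0.
Qed.

(** By [form_Ric] the Ricci tensor is the area times a symmetric form, hence lies in [L2h G]; [phi]
    of that tensor divided by the eigenvalue c removes it. *)
Lemma centralizer_curv_split S : S \in curv (centralizer G) ->
  exists2 B, B \in L2h G & S - phi J B \in curv (centralizer G) /\ Ric V (S - phi J B) = 0.
Proof.
move=> Sh; have [T Ts ST] := centralizer_curv_form F GJ N_gt0 Sh.
pose c : R := 2%:R * (N%:R + 2%:R - - 1 - 1).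
have RB : btype F (- 1) 1 (Ric V S).
  move=> h x k y; rewrite !(form_Ric _ _ _ _ Ts ST) (areaC h k).
  have -> : ctr (T y x) = ctr (T x y).
    by congr ctr; apply: funext => z; rewrite (sym3_12 Ts).
  by split; ring.
exists (c^-1 *: Ric V S); first exact/memvZ/(mem_L2h F GJ).
split; first by rewrite memvB // phi_L2h_centralizer ?memvZ //; apply/(mem_L2h F GJ).
rewrite homB (Ric_phi_btype sqN1 (btypeZ _ RB)) scalerA mulfV ?scale1r ?subrr //.
exact: eigenvalue_neq0.
Qed.

Lemma phi_L2h_Ric_inj B : B \in L2h G -> Ric V (phi J B) = 0 -> phi J B = 0.
Proof.
move=> /(mem_L2h F GJ) Bse B0.
by rewrite (phi_btype_inj N_gt1 sqN1 sq1 Bse B0) hom0.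
Qed.

(** U is left abstract to serve both cases of (ii): the Ricci-flat part of R(aut H) is W for n at
    least 2, and R(G') for n = 1. *)
Lemma centralizer_curv_decomposition (U : {vspace Tens V}) :
  (forall S, S \in U <-> S \in curv (centralizer G) /\ Ric V S = 0) ->
  curv (centralizer G) = (U + phi J @: L2h G)%VS /\ directv (U + phi J @: L2h G).
Proof.
move=> UE; split.
  apply/eqP; rewrite eqEsubv; apply/andP; split.
    apply/subvP => S /centralizer_curv_split[B BL SB].
    by rewrite -[S](subrK (phi J B)) memv_add ?memv_img //; apply/UE.
  rewrite subv_add; apply/andP; split; apply/subvP => S; first by move=> /UE[].
  by move=> /memv_imgP[B BL ->]; exact: phi_L2h_centralizer.
apply/directv_addP/eqP; rewrite -subv0; apply/subvP => S.
rewrite memv_cap memv0 => /andP[/UE[_ S0] /memv_imgP[B BL E]].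
by rewrite E; apply/eqP/phi_L2h_Ric_inj => //; rewrite -E.
Qed.

End Decomposition.

(** * Dimension four: the complementary structure and the splitting of W *)

Section Complementary.
Variables (R : realType) (V : vectType R) (J : 'I_3 -> 'End(V)).
Variables (G : {vspace 'End(V)}).
Hypothesis GJ : corresponds G J.
Hypothesis pG : paraquaternionic G.
Implicit Types (A B : 'End(V)) (S : Tens V) (X Y Z : V).

(** In a frame adapted to a triple of [G'] itself, its elements are m (x) 1 with m trace-free. *)
Lemma trace_paraquaternionic G' A : paraquaternionic G' -> A \in G' -> trace A = 0.
Proof.
move=> [_ [J' GJ']]; have [N' [F']] := frame_exists GJ'.1.
move=> /(mem_G_gH F' GJ')[m tm ->]; rewrite (frame_traceE F') sum2E.
have H a : ctr (fun x => cmp F' a (gH F' m (tau F' (dlt R a) x))) = m a a * N'%:R.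
  by rewrite -ctr_scal; congr ctr; apply: funext => x; rewrite cmp_gH.
by rewrite !H -mulrDl tm mul0r.
Qed.

Lemma trace1 : trace (\1%VF : 'End(V)) = (\dim {:V})%:R.
Proof. by rewrite /trace passmx.mxof1 ?(basis_free (vbasisP _)) // mxtrace1. Qed.

Lemma G_centralizer N (F : frame J N) A : (0 < N)%N ->
  A \in G -> A \in centralizer G -> A = 0.
Proof.
move=> N0 /(mem_G_gH F GJ)[m tm E] /(mem_centralizer_gE F GJ)[M E'].
rewrite E; suff -> : m = 0 by rewrite gH0.
apply/matrixP => c d; rewrite [RHS]mxE.
have <- := (parts_gHE F N0 0 tm).1 c d; rewrite gE0 addr0 -E E'.
have := (parts_gHE F N0 M (_ : (0 : 'M[R]_2) 0 0 + (0 : 'M[R]_2) 1 1 = 0)).1 c d.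
by rewrite gH0 add0r !mxE => -> //; rewrite addr0.
Qed.

Variable G' : {vspace 'End(V)}.
Hypothesis GG' : complementary G G'.
Hypothesis V_neq0 : (0 < \dim {:V})%N.

(** In the sum defining [G'], the trace kills the component along the identity, and the component in
    G commutes with G, hence vanishes. So [G'] is determined by G. *)
Lemma mem_complementary A : A \in G' <-> A \in centralizer G /\ trace A = 0.
Proof.
have [N [F]] := frame_exists GJ.1.
have N0 : (0 < N)%N by move: V_neq0; rewrite (frame_dim F) muln_gt0.
have [pG' comm nE _] := GG'; split=> [GA|[CA tA]].
  split; last exact: trace_paraquaternionic GA.
  by apply/mem_centralizer => B GB; rewrite lieC comm ?oppr0.
have := subvP (centralizer_normalizer F GJ) _ CA.
rewrite nE => /memv_addP[_ /memv_addP[_ /vlineP[c ->] [g Gg ->]] [g' Gg' E]].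
have tg := trace_paraquaternionic pG Gg; have tg' := trace_paraquaternionic pG' Gg'.
have c0 : c = 0.
  move: tA; rewrite E !traceD tg tg' !addr0 traceZ trace1 => /eqP.
  by rewrite mulf_eq0 pnatr_eq0 -[\dim _ == _]negbK -lt0n V_neq0 orbF => /eqP.
rewrite E c0 scale0r add0r; suff -> : g = 0 by rewrite add0r.
apply: (G_centralizer F N0 Gg); apply/mem_centralizer => B GB.
have -> : g = A - g' by rewrite E c0 scale0r add0r addrK.
rewrite -[A]scale1r -scaleN1r addrC lie_linear_l scale1r lieC comm // oppr0 scaler0 add0r.
by move/mem_centralizer: CA => ->.
Qed.

Lemma complementary_submodule : submodule (normalizer G) (curv G').
Proof.
have [N [F]] := frame_exists GJ.1.
have sG' : (G' <= normalizer G)%VS.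
  apply/subvP => A /mem_complementary[CA _].
  exact: (subvP (centralizer_normalizer F GJ)).
split; first exact: curvS.
move=> A S GA; apply: lie_act_curv; apply/mem_normalizer => B GB.
have [CB tB] := (mem_complementary B).1 GB.
apply/mem_complementary; split; last exact: trace_lie.
apply/mem_centralizer => C GC; rewrite lie_jacobi.
move/mem_centralizer: CB => CB; rewrite CB //.
move/mem_normalizer: GA => GA; rewrite (CB _ (GA _ GC)).
by rewrite /lie comp_lfun0r comp_lfun0l !subrr.
Qed.

Section DimensionFour.
Variable F : frame J 2.
Local Notation t := (tau F).
Local Notation e a := (dlt R a).

(** For S built from T, both the trace of S(X, Y) and the Ricci tensor are area forms times the
    contraction of T, so they vanish together. *)
Lemma complementary_curv S :
  S \in curv G' <-> S \in curv (centralizer G) /\ Ric V S = 0.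
Proof.
split.
  move=> SG'; have Sh : S \in curv (centralizer G).
    by apply: (subvP (curvS _)) SG'; apply/subvP => A /mem_complementary[].
  split=> //; have [T Ts ST] := centralizer_curv_form F GJ isT Sh.
  apply/(Ric_trace_free Ts ST) => x y.
  have /mem_curv[/(_ (t (e 0) x) (t (e 1) y)) /mem_complementary[_ tS] _ _] := SG'.
  move: tS; rewrite (form_trace _ _ _ _ ST) => /eqP; rewrite mulf_eq0 => /orP[|/eqP //].
  by rewrite /area !dltE /= mulr1 mul0r subr0 mulr1 pnatr_eq0.
move=> [Sh S0]; have [T Ts ST] := centralizer_curv_form F GJ isT Sh.
have T0 := (Ric_trace_free Ts ST).1 S0.
have /mem_curv[SL SC SB] := Sh; apply/mem_curv; split=> // X Y.
apply/mem_complementary; split=> //.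
move: X; apply: (@frame_ind _ _ _ _ F) => [X X' H H'|h x].
  by rewrite homD appD traceD H H' addr0.
move: Y; apply: (@frame_ind _ _ _ _ F) => [Y Y' H H'|k y].
  by rewrite homD traceD H H' addr0.
by rewrite (form_trace _ _ _ _ ST) T0 mulr0.
Qed.

Lemma complementary_curv_neq0 : curv G' != 0%VS.
Proof.
apply: contraNneq (sym_curv_cube_neq0 F 0 1) => C0; rewrite -memv0 -C0.
have Ts := cube_tens_sym R (0 : 'I_2) 1; have ST := sym_curv_form F Ts.
apply/complementary_curv; split; first exact: sym_curv_centralizer.
by apply/(Ric_trace_free Ts ST); apply: cube_tens_trace_free.
Qed.

Lemma paraquaternionic_curv_neq0 : curv G != 0%VS.
Proof.
(* The analogue of [cube_tens] with the two planes exchanged: the tensor h_0 k_0 l_0 e_1 on the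
   first factor, times the area on the second. *)
pose f X Y : 'End(V) := area (cmp F 0 X) (cmp F 0 Y) *: gH F (mx2 0 0 1 0).
pose S : Tens V := bilinfun f.
have SE X Y : S X Y = f X Y.
  apply: bilinfunE => [X' r u v|Y' r u v]; by rewrite /f /area !homD !homZ !mxE; vring.
have Sc : S \in curv G.
  apply/mem_curv; split=> [X Y|X Y|].
  - rewrite SE; apply: memvZ; apply/(mem_G_gH F GJ); exists (mx2 0 0 1 0) => //.
    by rewrite !mxE /= addr0.
  - by rewrite !SE /f areaC scaleNr.
  apply: (bianchi_frame (F := F)) => h x k y l z.
  rewrite !SE /f !cmp_tau !appZ !gH_tau.
  have mE u : mx2 0 0 1 0 *m u = u 0 0 *: e 1.
    by apply/colP; apply: ord2P; rewrite !mxE sum2E !mxE /=; ring.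
  rewrite !mE !tauZl.
  have a2 r s (u v : 'cV[R]_2) : area (r *: u) (s *: v) = (r * s) * area u v.
    by rewrite /area !mxE; ring.
  rewrite !a2; have H := congr1 (t (e 1)) (area_jacobi x y z).
  move: H; rewrite hom0 !homD !homZ => H.
  by rewrite -[RHS](scaler0 _ (h 0 0 * k 0 0 * l 0 0)) -H; vring.
apply: contraTneq isT => C0.
have : S = 0 by apply/eqP; rewrite -memv0 -C0.
move=> S0; have := SE (t (e 0) (e 0)) (t (e 0) (e 1)).
rewrite S0 !app0 /f !cmp_tau !dltE !scale1r => /(congr1 (fun A : 'End(V) => A (t (e 0) (e 0)))).
rewrite app0 appZ gH_tau => /(congr1 (cmp F 1)).
rewrite hom0 homZ cmp_tau /area !dltE /= !mxE sum2E !mxE /=.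
rewrite !(mulr1, mul1r, mulr0, mul0r, addr0, subr0, scale1r) => H.
by have := dlt_neq0 R (0 : 'I_2); rewrite -H eqxx.
Qed.

Lemma weyl_sum : weyl G = (curv G + curv G')%VS.
Proof.
apply/eqP; rewrite eqEsubv; apply/andP; split.
  apply/subvP => S SW; have [S1 S2] := weyl_split F GJ isT (erefl _) SW.
  rewrite -[S](subrK (hcurv F S)) addrC memv_add //.
  apply/complementary_curv; split=> //.
  rewrite homB (curvG_Ric F GJ isT (erefl _) S1) subr0.
  by move: SW; rewrite memv_cap memv_ker => /andP[/eqP].
rewrite subv_add; apply/andP; split; apply/subvP => S SG.
  rewrite memv_cap memv_ker (curvG_Ric F GJ isT (erefl _) SG) eqxx /=.
  exact: (subvP (curvS (sub_normalizer F GJ))).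
have [Sh S0] := (complementary_curv S).1 SG; rewrite memv_cap memv_ker S0 eqxx /=.
exact: (subvP (curvS (centralizer_normalizer F GJ))).
Qed.

Lemma weyl_sum_direct : directv (curv G + curv G').
Proof.
apply/directv_addP/eqP; rewrite -subv0; apply/subvP => S.
rewrite memv_cap memv0 => /andP[/mem_curv[SG _ _] /mem_curv[SG' _ _]].
apply/eqP; apply: tens_ext => X Y Z.
have /mem_complementary[CS _] := SG' X Y.
by rewrite (G_centralizer F isT (SG X Y) CS) !app0.
Qed.

End DimensionFour.

End Complementary.

Section ComplementaryExists.
Variables (R : realType) (V : vectType R) (J : 'I_3 -> 'End(V)) (F : frame J 2).
Variables (G : {vspace 'End(V)}).
Hypothesis GJ : corresponds G J.

Lemma jmx_free (c : 'I_3 -> R) : \sum_i c i *: jmx R i = 0 -> forall i, c i = 0.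
Proof.
rewrite sum3E => /matrixP H.
have := H 0 0; have := H 0 1; have := H 1 0; rewrite /jmx /= !mxE /= => h1 h2 h3.
by apply: ord3P; lra.
Qed.

Lemma jmx_mul (i : 'I_3) : jmx R i *m jmx R i = (- eps R i)%:M /\
  jmx R (i + 1) *m jmx R (i + 2%:R) = - eps R i *: jmx R i.
Proof.
have e11 : (1 + 1 : 'I_3) = 2%:R by apply: val_inj.
have e12 : (1 + 2%:R : 'I_3) = 0 by apply: val_inj.
have e21 : (2%:R + 1 : 'I_3) = 0 by apply: val_inj.
have e22 : (2%:R + 2%:R : 'I_3) = 1 by apply: val_inj.
move: i; apply: ord3P; rewrite ?add0r ?e11 ?e12 ?e21 ?e22 /jmx /eps /=;
  split; apply: mx2_ext; rewrite !mxE !sum2E !mxE /=; ring.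
Qed.

Lemma gE_inj (M M' : 'M[R]_2) : gE F M = gE F M' -> M = M'.
Proof.
move=> E; apply/matrixP => i j.
have := congr1 (fun A : 'End(V) => cmp F 0 (A (tau F (dlt R 0) (dlt R j)))) E.
by rewrite !gE_tau !cmp_tau !dltE !scale1r -!colE => /colP/(_ i); rewrite !mxE.
Qed.

Let J' i := gE F (jmx R i).
Let G' := <<[seq J' i | i : 'I_3]>>%VS.

Let gE_sum (c : 'I_3 -> R) : \sum_i c i *: J' i = gE F (\sum_i c i *: jmx R i).
Proof. by rewrite !sum3E !gED !gEZ. Qed.

Let mem_G' A : A \in G' <-> exists2 M : 'M[R]_2, M 0 0 + M 1 1 = 0 & A = gE F M.
Proof.
rewrite mem_span_family; split=> [[c ->]|[M /traceless_jmx[c ->] ->]].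
  by rewrite gE_sum; eexists; last by []; apply/traceless_jmx; exists c.
by exists c; rewrite gE_sum.
Qed.

(** For N = 2 the second factor is also a plane, and the matrices [jmx] acting on it span the
    required algebra. *)
Lemma complementary_exists : exists G', complementary G G'.
Proof.
exists G'; split.
- split.
    move=> A A' /mem_G'[M tM ->] /mem_G'[M' tM' ->]; apply/mem_G'.
    exists (M *m M' - M' *m M); first by rewrite !mxE !sum2E; ring.
    by rewrite -[- (M' *m M)]scaleN1r gED gEZ scaleN1r /lie !comp_gE.
  exists J'; split; first split=> i.
  + by rewrite comp_gE (jmx_mul i).1 gE_scalar.
  + by rewrite comp_gE (jmx_mul i).2 gEZ.
  rewrite /basis_of eqxx /=; apply: free_family => c.
  by rewrite gE_sum -(gE0 F) => /gE_inj; exact: jmx_free.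
- move=> A A' /(mem_G_gH F GJ)[m _ ->] /mem_G'[M _ ->].
  by rewrite /lie comp_gEH subrr.
- apply/eqP; rewrite eqEsubv !subv_add; apply/and3P; split.
  + apply/subvP => A /(normalizer_traceless F GJ)[m [M [tm ->]]].
    pose a := 2%:R^-1 * (M 0 0 + M 1 1).
    have c2 : (2%:R : R) != 0 by rewrite pnatr_eq0.
    have -> : M = a%:M + (M - a%:M) by rewrite addrC subrK.
    rewrite gED gE_scalar addrA; apply: memv_add.
      rewrite addrC; apply: memv_add; first exact/memvZ/memv_line.
      by apply/(mem_G_gH F GJ); exists m.
    by apply/mem_G'; exists (M - a%:M) => //; rewrite !mxE /= /a; field.
  + rewrite andbC (sub_normalizer F GJ) /=; apply/subvP => _ /vlineP[c ->].
    by rewrite -(gE_scalar F); exact: gE_normalizer.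
  by apply/subvP => A /mem_G'[M _ ->]; exact: gE_normalizer.
have GEH (m M : 'M[R]_2) : m 0 0 + m 1 1 = 0 -> gH F m = gE F M -> m = 0.
  move=> tm E; have := G_centralizer GJ F (isT : (0 < 2)%N) (A := gH F m).
  move=> /(_ _ _)/wrap[].
  - by apply/(mem_G_gH F GJ); exists m.
  - by rewrite E; apply/(mem_centralizer_gE F GJ); exists M.
  move=> H; apply/matrixP => c d; have := (parts_gHE F isT 0 tm).1 c d.
  rewrite gE0 addr0 H -(gH0 F) -[gH F 0]addr0 -(gE0 F).
  by rewrite (parts_gHE F isT 0 _).1 ?mxE ?addr0.
rewrite !directv_addE /= !directvE /= !eqxx /= -!subv0.
apply/andP; split; apply/subvP => A; rewrite memv_cap memv0 => /andP[].
  move=> /vlineP[a ->]; rewrite -(gE_scalar F) => /(mem_G_gH F GJ)[m tm E].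
  by rewrite E (GEH m _ tm (esym E)) gH0.
move=> /memv_addP[_ /vlineP[a ->] [_ /(mem_G_gH F GJ)[m tm ->] ->]].
move=> /mem_G'[M tM]; rewrite -(gE_scalar F) => E.
have m0 : m = 0.
  apply: (GEH m (M - a%:M) tm); rewrite -[- a%:M]scaleN1r gED gEZ scaleN1r -E.
  by rewrite addrC addKr.
move: E; rewrite m0 gH0 addr0 => /gE_inj E; move: tM; rewrite -E !mxE /= => a0.
by rewrite (_ : a = 0) ?gE_scalar ?scale0r //; lra.
Qed.

End ComplementaryExists.

(** * Irreducibility of the four form modules and assembly of both statements *)

Section FormModules.
Variables (R : realType) (V : vectType R) (J : 'I_3 -> 'End(V)) (N : nat).
Variables (F : frame J N) (G : {vspace 'End(V)}).
Hypotheses (GJ : corresponds G J) (N_gt1 : (1 < N)%N).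

Lemma form_modules_irreducible :
  (irreducible (normalizer G) (phi J @: S2h G)%VS
   /\ irreducible (normalizer G) (phi J @: S2mix J)%VS)
  /\ (irreducible (normalizer G) (phi J @: L2h G)%VS
   /\ irreducible (normalizer G) (phi J @: L2mix J)%VS).
Proof.
have sq1 : 1 * 1 = 1 :> R by rewrite mulr1.
have sqN1 : - 1 * - 1 = 1 :> R by rewrite mulrNN mulr1.
split; split.
- exact: (phi_irreducible GJ N_gt1 sqN1 sqN1 (mem_S2h F GJ)).
- exact: (phi_irreducible GJ N_gt1 sq1 sq1 (mem_S2mix F)).
- exact: (phi_irreducible GJ N_gt1 sqN1 sq1 (mem_L2h F GJ)).
- exact: (phi_irreducible GJ N_gt1 sq1 sqN1 (mem_L2mix F)).
Qed.

End FormModules.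

Theorem theorem4p1 (R : realType) (V : vectType R) (n : nat)
    (G : {vspace 'End(V)}) (J : 'I_3 -> 'End(V)) :
  \dim {:V} = (4 * n)%N ->
  paraquaternionic G ->
  corresponds G J ->
  let autG := normalizer G in
  let autH := centralizer G in
  let W := weyl G in
  let RS2h := (phi J @: S2h G)%VS in
  let RS2mix := (phi J @: S2mix J)%VS in
  let RL2h := (phi J @: L2h G)%VS in
  let RL2mix := (phi J @: L2mix J)%VS in
  (* (i) *)
  [/\ (2 <= n)%N ->
        [/\ curv autG = (W + RS2h + RS2mix + RL2h + RL2mix)%VS,
            directv (W + RS2h + RS2mix + RL2h + RL2mix),
            irreducible autG W,
            irreducible autG RS2h /\ irreducible autG RS2mix
          & irreducible autG RL2h /\ irreducible autG RL2mix],
      n = 1%N ->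
        [/\ curv autG = (W + RS2h + RS2mix + RL2h + RL2mix)%VS,
            directv (W + RS2h + RS2mix + RL2h + RL2mix),
            irreducible autG RS2h /\ irreducible autG RS2mix,
            irreducible autG RL2h /\ irreducible autG RL2mix
          & (exists G', complementary G G') /\
            forall G', complementary G G' ->
              [/\ W = (curv G + curv G')%VS,
                  directv (curv G + curv G'),
                  submodule autG (curv G) /\ curv G != 0%VS
                & submodule autG (curv G') /\ curv G' != 0%VS]],
  (* (ii) *)
      (2 <= n)%N ->
        curv autH = (W + RL2h)%VS /\ directv (W + RL2h)
    & n = 1%N ->
        forall G', complementary G G' ->
          curv autH = (curv G' + RL2h)%VS /\ directv (curv G' + RL2h)].
Proof.
move=> dimV pG GJ autG autH W RS2h RS2mix RL2h RL2mix.
have [N [F]] := frame_exists GJ.1.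
have Nn : N = (2 * n)%N.
  by apply/eqP; rewrite -(eqn_pmul2l (isT : (0 < 2)%N)) -(frame_dim F) dimV mulnA.
have big : (2 <= n)%N -> (2 < N)%N.
  by move=> n2; rewrite Nn; apply: leq_trans (leq_mul (leqnn 2) n2).
have main : (1 < N)%N ->
    curv autG = (W + RS2h + RS2mix + RL2h + RL2mix)%VS
    /\ directv (W + RS2h + RS2mix + RL2h + RL2mix).
  by move=> N1; exact: (curv_decomposition F GJ N1).
have irr : (1 < N)%N -> (irreducible autG RS2h /\ irreducible autG RS2mix)
    /\ (irreducible autG RL2h /\ irreducible autG RL2mix).
  by move=> N1; exact: (form_modules_irreducible F GJ N1).
split=> [n2|n1|n2|n1].
- have N2 := big n2; have N1 : (1 < N)%N by exact: ltnW.
  have [-> dir] := main N1; have [i1 i2] := irr N1.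
  by split=> //; exact: (weyl_irreducible F GJ N2).
- have N2 : N = 2%N by rewrite Nn n1.
  have N1 : (1 < N)%N by rewrite N2.
  have [-> dir] := main N1; have [i1 i2] := irr N1; split=> //.
  clear Nn; subst N; split; first exact: (complementary_exists F GJ).
  have V0 : (0 < \dim {:V})%N by rewrite dimV n1.
  move=> G' GG'; split.
  + exact: (weyl_sum GJ pG GG' V0 F).
  + exact: (weyl_sum_direct GJ pG GG' V0 F).
  + split; last exact: (paraquaternionic_curv_neq0 GJ F).
    split; first exact: (curvS (sub_normalizer F GJ)).
    by move=> A S; exact: lie_act_curv.
  + split; last exact: (complementary_curv_neq0 GJ pG GG' V0 F).
    exact: (complementary_submodule GJ pG GG' V0).
- have N2 := big n2; have N1 : (1 < N)%N by exact: ltnW.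
  (* For N > 2 a Weyl tensor has no sl_2 component, so W is the Ricci-flat part of R(aut H). *)
  apply: (centralizer_curv_decomposition F GJ N1) => S; split.
    move=> SW; split.
      by apply: (weyl_centralizer F GJ _ _ SW); [exact: ltnW | rewrite gtn_eqF].
    by move: SW; rewrite memv_cap memv_ker => /andP[/eqP].
  move=> [Sh S0]; rewrite memv_cap memv_ker S0 eqxx /=.
  exact: (subvP (curvS (centralizer_normalizer F GJ))).
have N2 : N = 2%N by rewrite Nn n1.
have V0 : (0 < \dim {:V})%N by rewrite dimV n1.
clear Nn; subst N; move=> G' GG'.
apply: (centralizer_curv_decomposition F GJ (isT : (1 < 2)%N)) => S.
exact: (complementary_curv GJ pG GG' V0 F).
Qed.
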